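(* Let $\mathbb{P}_K$ be a Pfaffian point process on $E$ induced by a self-adjoint quaternion kernel $K: E\times E \rightarrow \mathbb{H}_{\mathbb{C}}$, with correlation measures $\lambda_m$. For each $m\ge 1$ and $\lambda_m$-almost every $(x_1,\dots,x_m)\in E^m$, we have $\operatorname{Qdet}[K(x_i,x_j)]_{i,j=1}^m>0$, and the (reduced) Palm measure $\mathbb{P}_K^{x_1,\dots,x_m}$ is a Pfaffian point process with correlation kernel $K^{x_1,\dots,x_m}$ given by $$K^{x_1,\dots,x_m}(x,y)=\frac{\operatorname{Qdet}\begin{bmatrix}K(x,y)&K(x,x_1)&\cdots&K(x,x_m)\\ K(x_1,y)&K(x_1,x_1)&\cdots&K(x_1,x_m)\\ \vdots&\vdots&\ddots&\vdots\\ K(x_m,y)&K(x_m,x_1)&\cdots&K(x_m,x_m)\end{bmatrix}}{\operatorname{Qdet}[K(x_i,x_j)]_{i,j=1}^m},\qquad x,y\in E,$$ where the matrix in the numerator is almost self-adjoint with distinguished index $k=1$ (first row and column). In notation, $\mathbb{P}_K^{x_1,\dots,x_m}=\mathbb{P}_{K^{x_1,\dots,x_m}}$.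
   Context: **Space.** $E$ is a locally compact $\sigma$-compact Polish space, with a metric for which every bounded set is relatively compact, endowed with a positive $\sigma$-finite Radon measure $\mu$. A configuration on $E$ is a locally finite collection of points of $E$ (multiplicities allowed, order disregarded); $\operatorname{Conf}(E)$ is the set of configurations, identified with the Radon measures $\sum_{x\in X}\delta_x$ and given the Borel sigma-algebra of the vague topology. A point process is a Borel probability measure on $\operatorname{Conf}(E)$; it is simple if almost every configuration has no multiple points. **Correlation functions.** The $k$-point correlation function $\rho_k:E^k\to\mathbb{R}_+$ of $\mathbb{P}$ (if it exists) is determined $\mu^{\otimes k}$-a.e. by $$\int_{A_1^{l_1}\times\cdots\times A_j^{l_j}}\rho_k\,d\mu^{\otimes k}=\int_{\operatorname{Conf}(E)}\prod_{i=1}^j\frac{\#(X\cap A_i)!}{(\#(X\cap A_i)-l_i)!}\,d\mathbb{P}(X)$$ for all bounded disjoint Borel sets $A_1,\dots,A_j$ and positive integers $l_1+\cdots+l_j=k$ (a ratio is $0$ if $\#(X\cap A_i)<l_i$). The $k$-th correlation measure is $d\lambda_k=\rho_k\,d\mu^{\otimes k}$. **Complexified quaternions.** $\mathbb{H}_{\mathbb{C}}$ is the complex algebra of elements $q=q_0+q_1\mathbf{i}+q_2\mathbf{j}+q_3\mathbf{k}$, $q_0,\dots,q_3\in\mathbb{C}$, with $\mathbf{i}^2=\mathbf{j}^2=\mathbf{k}^2=-1$, $\mathbf{i}\mathbf{j}=-\mathbf{j}\mathbf{i}=\mathbf{k}$, $\mathbf{j}\mathbf{k}=-\mathbf{k}\mathbf{j}=\mathbf{i}$,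 $\mathbf{k}\mathbf{i}=-\mathbf{i}\mathbf{k}=\mathbf{j}$, and complex scalars central. The adjoint is $\overline{q}=q_0-q_1\mathbf{i}-q_2\mathbf{j}-q_3\mathbf{k}$ (the complex coefficients are not conjugated); elements with $q=\overline q$ are the scalars and are identified with $\mathbb{C}$. A kernel $K$ is self-adjoint if $K(x,y)=\overline{K(y,x)}$. **Quaternion determinant.** A square matrix $M$ over $\mathbb{H}_{\mathbb{C}}$ is self-adjoint if $M_{ij}=\overline{M_{ji}}$ for all $i,j$; it is almost self-adjoint with distinguished index $k$ if $M_{ij}=\overline{M_{ji}}$ whenever $i\ne k$ and $j\neq k$. For such an $n\times n$ matrix, $\operatorname{Qdet}M=M_{11}$ if $n=1$, and for $n>1$ $$\operatorname{Qdet}M=\sum_{l=1}^n\epsilon_{kl}M_{kl}\operatorname{Qdet}M(k,l),\qquad \epsilon_{kk}=1,\ \epsilon_{kl}=-1\ (l\ne k),$$ where $M(k,l)$ is obtained from $M$ by replacing the $l$-th column by the $k$-th column and then deleting the $k$-th row and $k$-th column (it is self-adjoint if $l=k$, and almost self-adjoint with distinguished index the one corresponding to $l$ if $l\neq k$). For self-adjoint $M$ the value does not depend on $k$ and is in $\mathbb{C}$. **Pfaffian point process.** A point process $\mathbb{P}$ is the Pfaffian point process $\mathbb{P}_K$ induced by (with correlation kernel) a self-adjoint quaternion kernel $K$ if for every $k\ge1$ its $k$-point correlation function exists and equals $\rho_k(x_1,\dots,x_k)=\operatorname{Qdet}[K(x_i,x_j)]_{i,j=1}^k$. Such a process is simple.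 **Palm measures.** For a simple point process $\mathbb{P}$ with $k$-th correlation measure $\lambda_k$, the (reduced) Palm measures $\mathbb{P}^{\mathfrak q}$, defined for $\lambda_k$-a.e. $\mathfrak q=(q_1,\dots,q_k)\in E^k$, are the point processes on $E$ such that for every non-negative Borel $u:\operatorname{Conf}(E)\times E^k\to\mathbb{R}$, $$\int_{\operatorname{Conf}(E)}\sum_{q_1,\dots,q_k\in X}^{*}u(X;\mathfrak q)\,\mathbb{P}(dX)=\int_{E^k}\lambda_k(d\mathfrak q)\int_{\operatorname{Conf}(E)}u(X\cup\{q_1,\dots,q_k\};\mathfrak q)\,\mathbb{P}^{\mathfrak q}(dX),$$ where $\sum^*$ is over mutually distinct points of $X$.
   Formalization: Correlation functions are required to be locally integrable (integral of ρ_k over B^k finite for bounded Borel B), in the hypothesis and in the conclusion; without this the defining identity need not determine ρ_k and the claim can fail. *)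

(* Defs.v *)
From HB Require Import structures.
From mathcomp Require Import all_boot all_order all_algebra.
From mathcomp Require Import all_classical all_reals all_analysis.
From mathcomp Require Import measurable_realfun complex ring.

Set Implicit Arguments.
Unset Strict Implicit.
Unset Printing Implicit Defensive.
Import Order.TTheory GRing.Theory Num.Theory.
Import numFieldNormedType.Exports.

Local Open Scope classical_set_scope.
Local Open Scope ring_scope.

(** The complexified quaternions are [quat R[i]]; the scalar [c] is [c%:A]. *)

Record quat (C : Type) := Quat { q0 : C; q1 : C; q2 : C; q3 : C }.

Section QuatEncoding.
Variable C : Type.
Definition quat_enc (p : quat C) := (q0 p, q1 p, q2 p, q3 p).
Definition quat_dec (t : C * C * C * C) :=
  let: (a, b, c, d) := t in Quat a b c d.
Lemma quat_encK : cancel quat_enc quat_dec. Proof. by case. Qed.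
End QuatEncoding.

HB.instance Definition _ (C : eqType) :=
  Equality.copy (quat C) (can_type (@quat_encK C)).
HB.instance Definition _ (C : choiceType) :=
  Choice.copy (quat C) (can_type (@quat_encK C)).

Section QuatAlgebra.
Variable C : comNzRingType.
Implicit Types p q r : quat C.

Definition addq p q := Quat (q0 p + q0 q) (q1 p + q1 q) (q2 p + q2 q) (q3 p + q3 q).
Definition oppq p := Quat (- q0 p) (- q1 p) (- q2 p) (- q3 p).
Definition scaleq (c : C) p := Quat (c * q0 p) (c * q1 p) (c * q2 p) (c * q3 p).
Definition mulq p q := Quat
  (q0 p * q0 q - q1 p * q1 q - q2 p * q2 q - q3 p * q3 q)
  (q0 p * q1 q + q1 p * q0 q + q2 p * q3 q - q3 p * q2 q)
  (q0 p * q2 q + q2 p * q0 q + q3 p * q1 q - q1 p * q3 q)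
  (q0 p * q3 q + q3 p * q0 q + q1 p * q2 q - q2 p * q1 q).

Lemma addqA : associative addq.
Proof. by move=> [? ? ? ?] [? ? ? ?] [? ? ? ?]; congr Quat => /=; ring. Qed.
Lemma addqC : commutative addq.
Proof. by move=> [? ? ? ?] [? ? ? ?]; congr Quat => /=; ring. Qed.
Lemma add0q : left_id (Quat 0 0 0 0) addq.
Proof. by move=> [? ? ? ?]; congr Quat => /=; ring. Qed.
Lemma addNq : left_inverse (Quat 0 0 0 0) oppq addq.
Proof. by move=> [? ? ? ?]; congr Quat => /=; ring. Qed.

HB.instance Definition _ :=
  GRing.isZmodule.Build (quat C) addqA addqC add0q addNq.

Lemma mulqA : associative mulq.
Proof. by move=> [? ? ? ?] [? ? ? ?] [? ? ? ?]; congr Quat => /=; ring. Qed.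
Lemma mul1q : left_id (Quat 1 0 0 0) mulq.
Proof. by move=> [? ? ? ?]; congr Quat => /=; ring. Qed.
Lemma mulq1 : right_id (Quat 1 0 0 0) mulq.
Proof. by move=> [? ? ? ?]; congr Quat => /=; ring. Qed.
Lemma mulqDl : left_distributive mulq addq.
Proof. by move=> [? ? ? ?] [? ? ? ?] [? ? ? ?]; congr Quat => /=; ring. Qed.
Lemma mulqDr : right_distributive mulq addq.
Proof. by move=> [? ? ? ?] [? ? ? ?] [? ? ? ?]; congr Quat => /=; ring. Qed.
Lemma quat1_neq0 : Quat 1 0 0 0 != 0 :> quat C.
Proof. by apply/eqP => -[/eqP]; rewrite oner_eq0. Qed.

HB.instance Definition _ := GRing.Zmodule_isNzRing.Build (quat C)
  mulqA mul1q mulq1 mulqDl mulqDr quat1_neq0.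

Lemma scaleqA a b p : scaleq a (scaleq b p) = scaleq (a * b) p.
Proof. by case: p => ? ? ? ?; congr Quat => /=; ring. Qed.
Lemma scale1q : left_id 1 scaleq.
Proof. by move=> [? ? ? ?]; congr Quat => /=; ring. Qed.
Lemma scaleqDr : right_distributive scaleq +%R.
Proof. by move=> ? [? ? ? ?] [? ? ? ?]; congr Quat => /=; ring. Qed.
Lemma scaleqDl p : {morph scaleq^~ p : a b / a + b}.
Proof. by case: p => ? ? ? ? ? ?; congr Quat => /=; ring. Qed.

HB.instance Definition _ := GRing.Zmodule_isLmodule.Build C (quat C)
  scaleqA scale1q scaleqDr scaleqDl.

Lemma scaleqAl (a : C) p q : a *: (p * q) = a *: p * q.
Proof. by case: p q => ? ? ? ? [? ? ? ?]; congr Quat => /=; ring. Qed.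
HB.instance Definition _ := GRing.Lmodule_isLalgebra.Build C (quat C) scaleqAl.

Lemma scaleqAr (a : C) p q : a *: (p * q) = p * (a *: q).
Proof. by case: p q => ? ? ? ? [? ? ? ?]; congr Quat => /=; ring. Qed.
HB.instance Definition _ := GRing.Lalgebra_isAlgebra.Build C (quat C) scaleqAr.

Definition adjq p := Quat (q0 p) (- q1 p) (- q2 p) (- q3 p).

(** The matrix [M(k,l)] of the expansion of the quaternion determinant. *)
Definition qminor n (M : 'M[quat C]_n.+2) (k l : 'I_n.+2) : 'M[quat C]_n.+1 :=
  row' k (col' k (\matrix_(i, j) M i (if j == l then k else j))).

(** [qdet k M] is the quaternion determinant of [M] with distinguished index
    [k]; it is meant for [M] almost self-adjoint with that index. The index of
    [M(k,l)] corresponding to [l != k] is the [j] such that [l = lift k j]. For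
    [l = k] the matrix is self-adjoint, the index is immaterial, and the first
    one is used. *)
Fixpoint qdet n : 'I_n.+1 -> 'M[quat C]_n.+1 -> quat C :=
  match n with
  | 0 => fun k M => M k k
  | n'.+1 => fun k M => \sum_(l < n'.+2)
      (if l == k then 1 else - 1) * M k l *
      qdet (odflt ord0 (unlift k l)) (qminor M k l)
  end.

(** For [M] self-adjoint, where the distinguished index is immaterial. *)
Definition Qdet n (M : 'M[quat C]_n.+1) : quat C := qdet ord0 M.

Definition selfadjoint_kernel (E : Type) (K : E -> E -> quat C) :=
  forall x y, K x y = adjq (K y x).

Definition kernel_mx (E : Type) (K : E -> E -> quat C) n (s t : n.-tuple E) :
    'M[quat C]_n :=
  \matrix_(i, j) K (tnth s i) (tnth t j).

End QuatAlgebra.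

(** The denominator is a self-adjoint element, identified with its scalar
    part [q0]. *)
Definition palm_kernel (C : fieldType) (E : Type) (K : E -> E -> quat C) n
    (x : n.+1.-tuple E) (y z : E) : quat C :=
  (q0 (Qdet (kernel_mx K x x)))^-1 *:
    qdet ord0 (kernel_mx K [tuple of y :: x] [tuple of z :: x]).

#[short(type="pmetricType")]
HB.structure Definition PointedMetric (K : numDomainType) :=
  {M of Pointed M & Metric K M}.

Notation borel T := (g_sigma_algebraType (@open T)).

Definition sigma_compact (T : topologicalType) :=
  exists F : (set T)^nat, (forall n, compact (F n)) /\ \bigcup_n F n = setT.

Definition metric_complete (R : realType) (T : Type) (d : T -> T -> R) :=
  forall u : T^nat,
    (forall e, 0 < e -> exists N, forall n p,
      (N <= n)%N -> (N <= p)%N -> d (u n) (u p) < e) ->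
    exists x, forall e, 0 < e -> exists N, forall n, (N <= n)%N -> d x (u n) < e.

Definition polish (R : realType) (T : topologicalType) :=
  (exists2 D : set T, countable D & dense D) /\
  exists d : T -> T -> R,
    [/\ forall x y, d x y = 0 <-> x = y,
        forall x y, d x y = d y x,
        forall x y z, d x z <= d x y + d y z,
        forall x A, nbhs x A <-> exists2 e, 0 < e & [set y | d x y < e] `<=` A &
        metric_complete d].

Definition mbounded (R : realType) (E : metricType R) (A : set E) :=
  exists M : R, forall x y, A x -> A y -> mdist x y <= M.

Definition proper_space (R : realType) (E : metricType R) :=
  [/\ locally_compact [set: E], sigma_compact E, polish R E &
      forall A : set E, mbounded A -> precompact A].

Definition radon (R : realType) (E : pmetricType R)
    (mu : {measure set (borel E) -> \bar R}) :=
  (forall C : set E, compact C -> (mu C < +oo)%E) /\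
  (forall A : set (borel E), measurable A ->
     mu A = ereal_sup [set mu C | C in [set C : set E | compact C /\ C `<=` A]]).

Section PowerMeasure.
Context d (T : measurableType d) (R : realType).

Definition tuple_consr n (p : n.-tuple T * T) : n.+1.-tuple T :=
  [tuple of p.2 :: p.1].

Lemma measurable_tuple_consr n : measurable_fun setT (@tuple_consr n).
Proof. exact: measurable_cons. Qed.

Section Step.
Variables (n : nat) (m : {measure set (n.-tuple T * T) -> \bar R}).

Definition consr_measure := pushforward m (@tuple_consr n).

Let consr_measure0 : consr_measure set0 = 0%E.
Proof. by rewrite /consr_measure /pushforward preimage_set0 measure0. Qed.

Let consr_measure_ge0 A : (0 <= consr_measure A)%E.
Proof. exact: (measure_ge0 m). Qed.

Let consr_measure_sigma_additive : semi_sigma_additive consr_measure.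
Proof.
have mf A : measurable A -> measurable (@tuple_consr n @^-1` A).
  by move=> mA; rewrite -[X in measurable X]setTI; exact: measurable_tuple_consr.
move=> F mF tF mUF; rewrite /consr_measure /pushforward preimage_bigcup.
apply: measure_semi_sigma_additive => [i||].
- exact: mf.
- apply/trivIsetP => i j _ _ ij; rewrite -preimage_setI.
  by move/trivIsetP: tF => /(_ _ _ Logic.I Logic.I ij) ->; rewrite preimage_set0.
- by rewrite -preimage_bigcup; exact: mf.
Qed.

HB.instance Definition _ := isMeasure.Build _ _ _ consr_measure
  consr_measure0 consr_measure_ge0 consr_measure_sigma_additive.

End Step.

Variable mu : {sigma_finite_measure set T -> \bar R}.

Fixpoint power_measure n : {measure set (n.-tuple T) -> \bar R} :=
  match n with
  | 0 => \d_ [tuple]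
  | n'.+1 => consr_measure (power_measure n' \x mu)%E
  end.

End PowerMeasure.

(** [X x] is the multiplicity of the point [x] in [X]. In the spaces considered
    the bounded sets are the relatively compact ones, so that finiteness on
    bounded sets is local finiteness. *)
Record conf (R : realType) (E : metricType R) := Conf {
  mult :> E -> nat ;
  mult_locfin : forall B : set E, mbounded B ->
    finite_set (B `&` [set x | mult x != 0%N])
}.

Section Configurations.
Context (R : realType) (E : pmetricType R).

Lemma conf0_locfin (B : set E) : mbounded B ->
  finite_set (B `&` [set x : E | 0%N != 0%N]).
Proof.
by move=> _; rewrite (_ : _ `&` _ = set0)// -subset0 => x [].
Qed.

HB.instance Definition _ := gen_eqMixin (conf E).
HB.instance Definition _ := gen_choiceMixin (conf E).
HB.instance Definition _ := isPointed.Build (conf E) (Conf conf0_locfin).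

Definition compactly_supported (f : E -> R) := compact (closure [set x | f x != 0]).

Definition conf_sum (f : E -> R) (X : conf E) : R :=
  \sum_(x \in [set: E]) (f x *+ X x).

(** The vague topology, generated by the maps [X |-> \sum_(x in X) f x], for
    [f] continuous with compact support. *)
HB.instance Definition _ := isSubBaseTopological.Build (conf E)
  [set fV : (E -> R) * set R |
    [/\ continuous fV.1, compactly_supported fV.1 & open fV.2]]
  (fun fV => conf_sum fV.1 @^-1` fV.2).

(** [#(X \cap A)], for [A] bounded (in which case the sum is finite). *)
Definition count_in (A : set E) (X : conf E) : nat :=
  (\big[addn/0]_(x \in A) X x)%N.

Lemma conf_add_locfin (X : conf E) k (q : k.-tuple E) (B : set E) : mbounded B ->
  finite_set (B `&` [set x | (X x + count_mem x q)%N != 0%N]).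
Proof.
move=> Bb; apply: (@sub_finite_set _ _
  ((B `&` [set x | X x != 0%N]) `|` [set` (q : seq E)])).
  move=> x [Bx] /=; rewrite addn_eq0 negb_and => /orP[Xx|]; first by left.
  by rewrite -lt0n -has_count has_pred1; right.
by rewrite finite_setU; split; [exact: mult_locfin|exact: finite_seq].
Qed.

(** [X \cup {q_1, ..., q_k}], multiplicities being added. *)
Definition conf_add (X : conf E) k (q : k.-tuple E) : conf E :=
  Conf (@conf_add_locfin X k q).

Definition distinct_points (X : conf E) k : set (k.-tuple E) :=
  [set q : k.-tuple E | uniq q /\ forall i, X (tnth q i) != 0%N].

End Configurations.
Arguments distinct_points {R E} X k.

Section PointProcesses.
Context (R : realType) (E : pmetricType R).

Definition point_process := probability (borel (conf E)) R.

(** [A_1^{l_1} x ... x A_j^{l_j}] *)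
Definition rect k j (A : 'I_j -> set E) (l : 'I_j -> nat) :
    set (k.-tuple (borel E)) :=
  [set x | forall p : 'I_k,
    nth set0 (flatten [seq nseq (l i) (A i) | i <- enum 'I_j]) p (tnth x p)].

Variable mu : {sigma_finite_measure set (borel E) -> \bar R}.

(** Local integrability (i.e. the correlation measure is Radon) is what makes
    [rho] determined almost everywhere by the moment identity of the last clause.
    [n ^_ l] is the falling factorial, i.e. [n! / (n - l)!] or 0 if [n < l]. *)
Definition correlation_function (P : point_process) k
    (rho : k.-tuple (borel E) -> R) :=
  [/\ measurable_fun setT rho,
      forall x, 0 <= rho x,
      forall B : set (borel E), measurable B -> mbounded (B : set E) ->
        (\int[power_measure mu k]_(x in [set x | forall p, B (tnth x p)])
           (rho x)%:E < +oo)%E &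
      forall j (A : 'I_j -> set (borel E)) (l : 'I_j -> nat),
        (forall i, measurable (A i)) -> (forall i, mbounded (A i : set E)) ->
        trivIset setT A -> (forall i, 0 < l i)%N -> (\sum_(i < j) l i)%N = k ->
        (\int[power_measure mu k]_(x in rect A l) (rho x)%:E =
         \int[P]_X ((\prod_(i < j) (count_in (A i) X) ^_ (l i))%N%:R)%:E)%E].

Definition correlation_measure (P : point_process) k
    (lambda : {measure set (k.-tuple (borel E)) -> \bar R}) :=
  exists2 rho, correlation_function P rho &
    forall A, measurable A ->
      lambda A = (\int[power_measure mu k]_(x in A) (rho x)%:E)%E.

(** As correlation functions are determined up to null sets, so is the
    equality with the quaternion determinant, an element of [quat R[i]]. *)
Definition pfaffian_process (P : point_process) (K : E -> E -> quat R[i]) :=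
  selfadjoint_kernel K /\
  forall k, exists2 rho : k.+1.-tuple (borel E) -> R,
    correlation_function P rho &
    {ae power_measure mu k.+1, forall x,
      Qdet (kernel_mx K x x) = (real_complex R (rho x))%:A}.

(** Adding points with multiplicities in [conf_add] makes these the reduced
    Palm measures: [Pq q] is the law of the configuration without the points
    [q]. [Pq] is a version of the family of reduced Palm measures of [P], where
    [lambda] is the [k]-th correlation measure of [P]. *)
Definition palm_measures (P : point_process) k
    (lambda : {measure set (k.-tuple (borel E)) -> \bar R})
    (Pq : k.-tuple (borel E) -> point_process) :=
  (forall A, measurable A -> measurable_fun setT (Pq ^~ A)) /\
  forall u : borel (conf E) * k.-tuple (borel E) -> R,
    measurable_fun setT u -> (forall p, 0 <= u p) ->
    (\int[P]_X (\esum_(q in distinct_points X k) (u (X, q))%:E) =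
     \int[lambda]_q \int[Pq q]_X (u (conf_add X q, q))%:E)%E.

End PointProcesses.

(* Main.v *)
From HB Require Import structures.
Require Import Defs.
From mathcomp Require Import all_boot all_order all_algebra.
From mathcomp Require Import finmap.
From mathcomp Require Import all_classical all_reals all_analysis.
From mathcomp Require Import measurable_realfun complex ring lra.

Set Implicit Arguments.
Unset Strict Implicit.
Unset Printing Implicit Defensive.
Import Order.TTheory GRing.Theory Num.Theory.
Import numFieldNormedType.Exports.

Local Open Scope classical_set_scope.
Local Open Scope ring_scope.

(** Let [A] be the self-adjoint matrix of [K] on points [y, x], and [X] its block
    on [x]. The quaternion determinants bordering [X] by one of the [y]'s in row
    and one in column are, up to the factor [Qdet X], the entries of the Schur
    complement of [X] in [A]; hence the matrix they form has determinant
    [(Qdet X)^(k-1) Qdet A]. This is first proved for matrices all of whose nested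
    principal minors are invertible, by showing that the expansion defining the
    quaternion determinant satisfies Cramer's rule, and then for all of them by
    deforming [A] to the identity. Thus
    [Qdet [K^x(y_i, y_j)] = Qdet [K on (y, x)] / Qdet [K on x]].

    It remains to show that [rho_(k+m)(y, x) / rho_m(x)] is a correlation function
    of the Palm measure at [x]. Fix a partition of [E] in small cells and count the
    points in [k] distinct cells containing no point of [x]: these counts do not
    see the added points [x], so that the Palm formula yields
    the expected moment for almost every [x]. Countably many cells generate the
    sets of tuples [y] such that [y] and [x] have no collision, and collisions do
    not occur: the process is simple because [Qdet] vanishes at a double point. *)

(** * The quaternion determinant *)

(** The determinant is defined by an expansion along one distinguished index, not by a sum that is
    visibly symmetric. Independence of the index and Cramer's rule therefore have to come out of a
    single induction; it works with inverses, hence the invertible minors. As the identities are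
    polynomial in the entries, a generic deformation then removes this assumption.

    For the process, the obstacle is that each moment identity of a Palm measure holds off its own
    null set of [x], while the sets to be tested are uncountably many, and that adding the points of
    [x] alters the counts in sets containing them. Measures on tuples of distinct points answer
    both: countably many cell counts determine them off the collisions, and evaluating them on
    rectangles returns all factorial moments. Collisions must then be shown null twice: for the
    density, because the diagonals have no mass when the process is simple, and for the Palm
    measure, by the Palm formula applied to the event that the configuration is not simple.
    Simplicity has real content when [mu] has atoms, as the diagonal is then not null. *)

Section Quaternions.
Variable C : comNzRingType.
Implicit Types p q : quat C.

Lemma quatP p q :
  q0 p = q0 q -> q1 p = q1 q -> q2 p = q2 q -> q3 p = q3 q -> p = q.
Proof. by case: p q => [? ? ? ?] [? ? ? ?] /= -> -> -> ->. Qed.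

Lemma adjqD p q : adjq (p + q) = adjq p + adjq q.
Proof. by apply: quatP => /=; rewrite ?opprD. Qed.

Lemma adjqN p : adjq (- p) = - adjq p.
Proof. by apply: quatP. Qed.

Lemma adjqB p q : adjq (p - q) = adjq p - adjq q.
Proof. by rewrite adjqD adjqN. Qed.

Lemma adjq0 : adjq 0 = 0 :> quat C.
Proof. by apply: quatP => //=; rewrite oppr0. Qed.

Lemma adjqM p q : adjq (p * q) = adjq q * adjq p.
Proof. by apply: quatP => /=; ring. Qed.

Lemma adjqZ (c : C) p : adjq (c *: p) = c *: adjq p.
Proof. by apply: quatP => /=; ring. Qed.

Lemma adjq_sum (I : Type) (r : seq I) (P : pred I) (F : I -> quat C) :
  adjq (\sum_(i <- r | P i) F i) = \sum_(i <- r | P i) adjq (F i).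
Proof. by apply: (big_morph (@adjq C)); [exact: adjqD|exact: adjq0]. Qed.

Lemma q0A (c : C) : q0 (c%:A : quat C) = c.
Proof. by rewrite /= mulr1. Qed.

Lemma adjqA (c : C) : adjq (c%:A) = c%:A :> quat C.
Proof. by apply: quatP => /=; ring. Qed.

Lemma scalar_mulC (c : C) p : p * c%:A = c%:A * p.
Proof. by rewrite -scalerAl -scalerAr mulr1 mul1r. Qed.

Lemma normqC p : p * adjq p = adjq p * p.
Proof. by apply: quatP => /=; ring. Qed.

Lemma normq_scalar p : p * adjq p = (q0 (p * adjq p))%:A.
Proof. by apply: quatP => /=; ring. Qed.

End Quaternions.

Lemma selfadj_scalar (F : idomainType) (p : quat F) :
  2%:R != 0 :> F -> adjq p = p -> p = (q0 p)%:A.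
Proof.
move=> two; case: p => a b c d [h1 h2 h3].
have nz (x : F) : - x = x -> x = 0.
  move=> /eqP; rewrite eq_sym -addr_eq0 -mulr2n -mulr_natl mulf_eq0.
  by rewrite (negbTE two) => /eqP.
by apply: quatP; rewrite /= ?mulr1 ?mulr0 //; exact: nz.
Qed.

Section MapQuat.
Variables (C D : comNzRingType) (f : {rmorphism C -> D}).

Definition mapq (p : quat C) := Quat (f (q0 p)) (f (q1 p)) (f (q2 p)) (f (q3 p)).

Lemma mapq_is_zmod : zmod_morphism mapq.
Proof. by move=> p q; apply: quatP; rewrite /= rmorphB. Qed.
HB.instance Definition _ := GRing.isZmodMorphism.Build _ _ mapq mapq_is_zmod.

Lemma mapq_is_monoid : monoid_morphism mapq.
Proof.
split; first by apply: quatP; rewrite /= ?rmorph1 ?rmorph0.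
by move=> p q; apply: quatP; rewrite /= ?(rmorphB, rmorphD, rmorphM).
Qed.
HB.instance Definition _ := GRing.isMonoidMorphism.Build _ _ mapq mapq_is_monoid.

Lemma mapqZ c p : mapq (c *: p) = f c *: mapq p.
Proof. by apply: quatP; rewrite /= rmorphM. Qed.

Lemma mapq_adj p : mapq (adjq p) = adjq (mapq p).
Proof. by apply: quatP; rewrite /= ?rmorphN. Qed.

Lemma mapqD p q : mapq (p + q) = mapq p + mapq q.
Proof. exact: rmorphD. Qed.

Lemma mapq_natr n : mapq n%:R = n%:R.
Proof. exact: rmorph_nat. Qed.

Lemma mapq_inj : injective f -> injective mapq.
Proof. by move=> fI p q [/fI ? /fI ? /fI ? /fI ?]; apply: quatP. Qed.

(** The expansion uses ring operations only, hence commutes with a change of scalars. Identities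
    thus move between a field, its polynomials and their fractions. *)
Lemma map_qdet n (k : 'I_n.+1) (M : 'M[quat C]_n.+1) :
  mapq (qdet k M) = qdet k (map_mx mapq M).
Proof.
elim: n k M => [|n IH] k M /=; first by rewrite mxE.
rewrite rmorph_sum; apply: eq_bigr => l _.
rewrite !rmorphM mxE; congr (_ * _ * _).
  by case: ifP => _; rewrite ?rmorphN rmorph1.
by rewrite [LHS]IH; congr qdet; apply/matrixP => i j; rewrite !mxE.
Qed.

End MapQuat.

Section AdjointMatrix.
Variable C : comNzRingType.

Definition adjmx m n (M : 'M[quat C]_(m, n)) : 'M[quat C]_(n, m) :=
  \matrix_(i, j) adjq (M j i).

Definition selfadj n (M : 'M[quat C]_n) := forall i j, M i j = adjq (M j i).

Definition minor n (k : 'I_n.+1) (M : 'M[quat C]_n.+1) : 'M[quat C]_n :=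
  \matrix_(i, j) M (lift k i) (lift k j).

Definition colrep n (M : 'M[quat C]_n) (k : 'I_n) (c : 'I_n -> quat C) :=
  \matrix_(i, j) (if j == k then c i else M i j).

(** The value 1 on the empty matrix lets the cofactor of a 1 by 1 matrix follow the general
    formulas. *)
Definition Qdet0 n : 'M[quat C]_n -> quat C :=
  match n with 0 => fun _ => 1 | _.+1 => fun M => Qdet M end.

Lemma adjmxM m n p (M : 'M[quat C]_(m, n)) (N : 'M[quat C]_(n, p)) :
  adjmx (M *m N) = adjmx N *m adjmx M.
Proof.
apply/matrixP => i j; rewrite !mxE adjq_sum; apply: eq_bigr => l _.
by rewrite !mxE adjqM.
Qed.

Lemma adjmx1 n : adjmx 1%:M = 1%:M :> 'M[quat C]_n.
Proof.
apply/matrixP => i j; rewrite !mxE [j == i]eq_sym.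
by case: (i == j); [rewrite -[1]scale1r adjqA|rewrite adjq0].
Qed.

Lemma selfadjP n (M : 'M[quat C]_n) : selfadj M <-> adjmx M = M.
Proof.
split=> [h|h i j]; first by apply/matrixP => i j; rewrite mxE -h.
by rewrite -[in LHS]h mxE.
Qed.

Lemma selfadj_minor n k (M : 'M[quat C]_n.+1) : selfadj M -> selfadj (minor k M).
Proof. by move=> h i j; rewrite !mxE. Qed.

Lemma colrep_id n (M : 'M[quat C]_n) k : colrep M k (fun i => M i k) = M.
Proof. by apply/matrixP => i j; rewrite mxE; case: eqP => [->|]. Qed.

Lemma qdet1 (k : 'I_1) (M : 'M[quat C]_1) : qdet k M = M 0 0.
Proof. by rewrite /= (ord1 k). Qed.

Lemma lift_eqF n (k : 'I_n.+1) (i : 'I_n) : (lift k i == k) = false.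
Proof. by rewrite eq_sym; apply: negbTE; exact: neq_lift. Qed.

(** For [l] other than [k], the matrix [M(k,l)] is the minor at [k] with a column replaced by column
    [k]. So [c] enters only through [c k] and through replaced columns of the minor: column
    replacement is stable under the recursion, and Cramer's rule can be proved by induction. *)
Lemma qdet_colrep n (M : 'M[quat C]_n.+2) k c :
  qdet k (colrep M k c) = c k * Qdet (minor k M) -
    \sum_(l < n.+1)
       M k (lift k l) * qdet l (colrep (minor k M) l (c \o lift k)).
Proof.
rewrite [LHS]/= (bigD1_ord k) //= eqxx mul1r mxE eqxx unlift_none /=.
rewrite -sumrN; congr (_ + _).
  congr (_ * qdet _ _); apply/matrixP => i j.
  by rewrite !mxE !lift_eqF.
apply: eq_bigr => l _; rewrite lift_eqF mulN1r liftK /=.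
rewrite mxE lift_eqF mulNr; congr (- (_ * qdet _ _)).
apply/matrixP => i j; rewrite !mxE (inj_eq (@lift_inj _ k)).
by case: (j == l); rewrite ?eqxx ?lift_eqF.
Qed.

End AdjointMatrix.

(** * Cramer's rule and Schur complements for invertible nested minors *)

Section RegularMatrix.
Variable F : fieldType.
Hypothesis two : 2%:R != 0 :> F.

(** Every distinguished index is required at every stage, because independence of the index is only
    obtained within the induction. *)
Fixpoint regular n : 'M[quat F]_n -> Prop :=
  match n with
  | 0 => fun _ => True
  | _.+1 => fun A =>
      (forall k, qdet k A != 0) /\ (forall k, regular (minor k A))
  end.

Lemma scale_quatA (a b : F) : a *: (b%:A : quat F) = (a * b)%:A.
Proof. by rewrite scalerA. Qed.

Lemma scalarq_inj : injective (fun a : F => a%:A : quat F).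
Proof. by move=> a b /(congr1 (@q0 _)); rewrite !q0A. Qed.

(** Block elimination at the index [k]: the inverse of a principal submatrix is the Schur complement
    of the entry [W k k] in the inverse [W]. This entry is a scalar, so dividing by it raises no
    question of order. *)
Lemma inverse_minor n (A W : 'M[quat F]_n.+1) k (w : F) :
  W *m A = 1%:M -> w != 0 -> W k k = w%:A ->
  (\matrix_(i, j) (W (lift k i) (lift k j)
     - w^-1 *: (W (lift k i) k * W k (lift k j)))) *m minor k A = 1%:M.
Proof.
move=> WA w0 Wkk; apply/matrixP => i p.
have E i' : \sum_j W i' (lift k j) * A (lift k j) (lift k p) =
    (i' == lift k p)%:R - W i' k * A k (lift k p).
  have /matrixP/(_ i' (lift k p)) := WA; rewrite !mxE (bigD1_ord k) //= => <-.
  by rewrite addrC addrK.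
rewrite !mxE; under eq_bigr do rewrite !mxE mulrBl -scalerAl -mulrA.
rewrite sumrB -scaler_sumr -mulr_sumr !E Wkk (negbTE (neq_lift _ _)) sub0r.
rewrite (inj_eq (@lift_inj _ k)) mulrN -scalerAl mul1r -scalerAr scalerN scalerA.
by rewrite mulVf // scale1r opprK subrK.
Qed.

Lemma minor_minor n (A : 'M[quat F]_n.+2) (k : 'I_n.+1) :
  minor k (minor ord0 A) = minor ord0 (minor (lift ord0 k) A).
Proof.
have E (i : 'I_n) : lift ord0 (lift k i) = lift (lift ord0 k) (lift ord0 i).
  by apply: val_inj; rewrite /= /bump /= !add1n ltnS addnS.
by apply/matrixP => i j; rewrite !mxE !E.
Qed.

Lemma regular_Qdet0 n (A : 'M[quat F]_n) : regular A -> Qdet0 A != 0.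
Proof. by case: n A => [|n] A; [move=> _; exact: oner_neq0|case=> h _; exact: h]. Qed.

(* The inverse [W] of [A] plays the role of the adjugate: replacing a column
   by [c] multiplies the determinant by the entry of [W c] (Cramer's rule). *)
Definition cramer_inverse n (A W : 'M[quat F]_n.+1) (d : F) :=
  [/\ W *m A = 1%:M, adjmx W = W,
      forall k c, qdet k (colrep A k c) = d *: \sum_j W k j * c j &
      forall k, Qdet0 (minor k A) = d *: W k k].

(** Column [k] is replaced by itself, and [W *m A = 1%:M]. Since [d] does not depend on [k], neither
    does the determinant. *)
Lemma cramer_qdet n (A W : 'M[quat F]_n.+1) d k :
  cramer_inverse A W d -> qdet k A = d%:A.
Proof.
move=> [WA _ h _]; rewrite -[A in LHS](colrep_id _ k) h.
have /matrixP/(_ k k) := WA; rewrite !mxE eqxx => ->.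
by [].
Qed.

(** Adjunction reverses products and fixes [A] and [W], which turns the left inverse into a right
    one. *)
Lemma cramer_invr n (A W : 'M[quat F]_n.+1) d :
  selfadj A -> cramer_inverse A W d -> A *m W = 1%:M.
Proof.
move=> /selfadjP sA [WA sW _ _].
by rewrite -sW -[X in X *m _]sA -adjmxM WA adjmx1.
Qed.

(* Up to a scalar, row [k] of the inverse of [A], normalised to have a [1] on
   the diagonal; [W] is the inverse of [minor k A]. *)
Definition pivot_row n (A : 'M[quat F]_n.+1) k (W : 'M[quat F]_n)
    (j : 'I_n.+1) : quat F :=
  if unlift k j is Some j' then - \sum_i A k (lift k i) * W i j' else 1.

Lemma pivot_row_diag n (A : 'M[quat F]_n.+1) k W : pivot_row A k W k = 1.
Proof. by rewrite /pivot_row unlift_none. Qed.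

Lemma pivot_rowE n (A : 'M[quat F]_n.+1) k W c :
  \sum_j pivot_row A k W j * c j =
    c k - \sum_i A k (lift k i) * \sum_j W i j * c (lift k j).
Proof.
rewrite (bigD1_ord k) //= pivot_row_diag mul1r -sumrN; congr (_ + _).
under [RHS]eq_bigr do rewrite mulr_sumr -sumrN.
rewrite exchange_big /=; apply: eq_bigr => j _.
rewrite /pivot_row liftK mulNr mulr_suml -sumrN.
by apply: eq_bigr => i _; rewrite mulrA.
Qed.

Lemma pivot_rowP n (A : 'M[quat F]_n.+2) k W d c :
  cramer_inverse (minor k A) W d ->
  qdet k (colrep A k c) = d *: \sum_j pivot_row A k W j * c j.
Proof.
move=> hW; rewrite qdet_colrep [Qdet _](cramer_qdet _ hW).
rewrite scalar_mulC -scalerAl mul1r pivot_rowE scalerBr; congr (_ - _).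
rewrite scaler_sumr; apply: eq_bigr => l _.
by have [_ _ -> _] := hW; rewrite scalerAr.
Qed.

Lemma pivot_row_mul n (A : 'M[quat F]_n.+2) k W d j :
  cramer_inverse (minor k A) W d ->
  \sum_i pivot_row A k W i * A i j =
    if j == k then \sum_i pivot_row A k W i * A i k else 0.
Proof.
move=> [WA _ _ _]; case: eqP => [->//|/eqP].
case: (unliftP k j) => [p -> _|->]; last by rewrite eqxx.
rewrite pivot_rowE.
under eq_bigr => i _.
  have -> : \sum_j0 W i j0 * A (lift k j0) (lift k p) = (i == p)%:R.
    have /matrixP/(_ i p) := WA; rewrite !mxE => <-.
    by apply: eq_bigr => j0 _; rewrite mxE.
  over.
rewrite (bigD1 p) //= eqxx mulr1 big1 ?addr0 ?subrr // => i /negbTE ->.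
by rewrite mulr0.
Qed.

(** The pivot row [T] satisfies [T A = s e_k], and [qdet k A] is [d s]. Multiplying by the right
    inverse [Z] gives [s z = T_k = 1]; the double sum below is this product taken in both orders. *)
Lemma pivot_qdet n (A Z : 'M[quat F]_n.+2) k W d z :
  cramer_inverse (minor k A) W d -> A *m Z = 1%:M -> Z k k = z%:A ->
  z *: qdet k A = Qdet0 (minor k A).
Proof.
move=> hW AZ Zk; rewrite [RHS](cramer_qdet _ hW).
rewrite -[A in qdet k A](colrep_id _ k) (pivot_rowP _ hW) scalerA mulrC -scalerA.
congr (_ *: _); set s := \sum_j _.
have /matrixP AZ' := AZ.
transitivity (\sum_j (\sum_i pivot_row A k W i * A i j) * Z j k).
  rewrite (bigD1 k) //= [X in _ + X]big1 => [|j /negbTE jk].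
    by rewrite addr0 Zk scalar_mulC -scalerAl mul1r.
  by rewrite (pivot_row_mul _ hW) jk mul0r.
under eq_bigr do rewrite mulr_suml.
rewrite exchange_big /= (bigD1 k) //= [X in _ + X]big1 => [|i /negbTE ik].
  under eq_bigr do rewrite -mulrA.
  have := AZ' k k; rewrite !mxE eqxx -mulr_sumr pivot_row_diag mul1r => ->.
  by rewrite addr0.
under eq_bigr do rewrite -mulrA.
by have := AZ' i k; rewrite !mxE ik -mulr_sumr => ->; rewrite mulr0.
Qed.

(** Induction on the size: the pivot rows, divided by their pivots [s k], form a left inverse of
    [A]. The delicate point is that [d_ k * s k], which is the determinant with distinguished index
    [k], is the same for all [k]. *)
Lemma regular_cramer n (A : 'M[quat F]_n.+1) :
  selfadj A -> regular A -> exists Wd, cramer_inverse A Wd.1 Wd.2.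
Proof.
elim: n A => [|n IH] A sA [rA rA'].
  have sc : A 0 0 = (q0 (A 0 0))%:A by apply: selfadj_scalar; rewrite // -sA.
  set a := q0 _ in sc.
  have a0 : a != 0.
    by apply: contra (rA 0) => /eqP a0; rewrite qdet1 sc a0 scale0r.
  exists (a^-1%:A%:M, a); split => /=.
  - apply/matrixP => i j; rewrite !ord1 mxE big_ord1 !mxE sc /=.
    by rewrite mulr1n -scalerAl mul1r scalerA mulVf // scale1r.
  - by apply/matrixP => i j; rewrite !ord1 !mxE mulr1n adjqA.
  - move=> k c; rewrite ord1 mxE big_ord1 mxE /= mulr1n -scalerAl mul1r scalerA.
    by rewrite mulfV // scale1r.
  - by move=> k; rewrite ord1 mxE mulr1n scalerA mulfV // scale1r.
have /choice[Wd hWd] : forall k, exists Wd, cramer_inverse (minor k A) Wd.1 Wd.2.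
  by move=> k; apply: IH; [exact: selfadj_minor|exact: rA'].
pose W_ k := (Wd k).1; pose d_ k := (Wd k).2.
have Qd k : Qdet (minor k A) = (d_ k)%:A by exact: cramer_qdet (hWd k).
pose T k := pivot_row A k (W_ k).
have gE k c : qdet k (colrep A k c) = d_ k *: \sum_j T k j * c j.
  exact: pivot_rowP (hWd k).
pose sigma k := \sum_j T k j * A j k.
have TA k j : \sum_i T k i * A i j = if j == k then sigma k else 0.
  exact: pivot_row_mul (hWd k).
(* The pivot is the entry [A k k] minus a product row, [W_ k], column; it is self-adjoint because
   [A] and [W_ k] are, hence a scalar. *)
have [s sE] : exists s : 'I_n.+2 -> F, forall k, sigma k = (s k)%:A.
  exists (fun k => q0 (sigma k)) => k; apply: selfadj_scalar => //.
  rewrite /sigma pivot_rowE adjqB -sA; congr (_ - _).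
  rewrite adjq_sum.
  under eq_bigr => i _.
    rewrite adjqM adjq_sum mulr_suml.
    under eq_bigr => j _ do rewrite adjqM -!sA.
    over.
  rewrite exchange_big /=; apply: eq_bigr => j _.
  rewrite mulr_sumr; apply: eq_bigr => i _.
  have [_ sW _ _] := hWd k.
  by rewrite -mulrA; congr (_ * (_ * _)); rewrite /W_ -[in RHS]sW mxE.
have dsE k : qdet k A = (d_ k * s k)%:A.
  by rewrite -[A in LHS](colrep_id _ k) gE -/(sigma k) sE scalerA.
have ds0 k : d_ k * s k != 0.
  by apply: contra (rA k) => /eqP ds0; rewrite dsE ds0 scale0r.
have s0 k : s k != 0 by move: (ds0 k); rewrite mulf_eq0 => /norP[].
have d0 k : d_ k != 0 by move: (ds0 k); rewrite mulf_eq0 => /norP[].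
pose W := \matrix_(k, j) ((s k)^-1 *: T k j).
have WA : W *m A = 1%:M.
  apply/matrixP => k j; rewrite !mxE.
  under eq_bigr do rewrite mxE -scalerAl.
  rewrite -scaler_sumr TA eq_sym; case: eqP => _; last by rewrite scaler0.
  by rewrite sE scalerA mulVf // scale1r.
(* The adjoint of a left inverse of the self-adjoint [A] is a right inverse, and the two
   coincide. *)
have sW : adjmx W = W.
  have AW : A *m adjmx W = 1%:M.
    by rewrite -[X in X *m _](iffLR (selfadjP _)) // -adjmxM WA adjmx1.
  by rewrite -[LHS]mul1mx -WA -mulmxA AW mulmx1.
have Wkk k : W k k = (s k)^-1%:A by rewrite mxE /T pivot_row_diag.
(* The determinant of [A] without the indices 0 and [k1] is computed through each of the two minors.
   By [inverse_minor] the results are [d_ 0 s_0] and [d_ k1 s_k1] times the same factor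
   [1 / (s_0 s_k1) - N], the quaternion determinant of [W] on these two indices. Regularity makes
   that factor nonzero, so it cancels. *)
have ds k : d_ k * s k = d_ ord0 * s ord0.
  case: (unliftP ord0 k) => [k'|] ->//; set k1 := lift ord0 k'.
  have Wk j : W_ j = \matrix_(i, p) (W (lift j i) (lift j p)
     - s j *: (W (lift j i) j * W j (lift j p))).
    have := inverse_minor WA _ (Wkk j); rewrite invr_eq0 invrK => /(_ (s0 j)) L.
    have R : minor j A *m W_ j = 1%:M.
      exact: cramer_invr (selfadj_minor _ sA) (hWd j).
    by rewrite -[LHS]mul1mx -L -mulmxA R mulmx1.
  have B1 : Qdet0 (minor k' (minor ord0 A)) = d_ ord0 *: W_ ord0 k' k'.
    by have [_ _ _ ->] := hWd ord0.
  have B2 : Qdet0 (minor ord0 (minor k1 A)) = d_ k1 *: W_ k1 ord0 ord0.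
    by have [_ _ _ ->] := hWd k1.
  have l0 : lift k1 ord0 = ord0 by exact: val_inj.
  have B0 : Qdet0 (minor k' (minor ord0 A)) != 0.
    by have [_ /(_ k')] := rA' ord0; exact: regular_Qdet0.
  have Nk : W k1 ord0 = adjq (W ord0 k1) by rewrite -[in LHS]sW mxE.
  pose N := q0 (W ord0 k1 * adjq (W ord0 k1)).
  have E1 : Qdet0 (minor k' (minor ord0 A)) =
      (d_ ord0 * ((s k1)^-1 - s ord0 * N))%:A.
    rewrite B1 Wk mxE -/k1 Wkk Nk -normqC normq_scalar -/N.
    by rewrite !scale_quatA -scalerBl scalerA.
  have E2 : Qdet0 (minor k' (minor ord0 A)) =
      (d_ k1 * ((s ord0)^-1 - s k1 * N))%:A.
    rewrite minor_minor B2 Wk mxE l0 Wkk Nk normq_scalar -/N.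
    by rewrite !scale_quatA -scalerBl scalerA.
  have E : d_ ord0 * ((s k1)^-1 - s ord0 * N) = d_ k1 * ((s ord0)^-1 - s k1 * N).
    by apply: scalarq_inj; rewrite /= -E1.
  have a1 : s ord0 * ((s ord0 * s k1)^-1 - N) = (s k1)^-1 - s ord0 * N.
    by rewrite mulrBr invfM mulrA mulfV // mul1r.
  have a2 : s k1 * ((s ord0 * s k1)^-1 - N) = (s ord0)^-1 - s k1 * N.
    by rewrite mulrBr invfM mulrCA mulfV // mulr1.
  have t0 : (s ord0 * s k1)^-1 - N != 0.
    by apply: contra B0 => /eqP t0; rewrite E1 -a1 t0 !mulr0 scale0r.
  by apply: (mulIf t0); rewrite -!mulrA a1 a2 E.
exists (W, d_ ord0 * s ord0); split; [exact: WA|exact: sW|move=> k c|move=> k].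
- rewrite [LHS]gE [(_, _).2]/= [(_, _).1]/= -(ds k) -scalerA; congr (_ *: _).
  rewrite scaler_sumr; apply: eq_bigr => j _.
  by rewrite mxE -scalerAl scalerA mulfV // scale1r.
- rewrite [LHS]Qd [(_, _).2]/= [(_, _).1]/= -(ds k) Wkk scalerA.
  by rewrite mulfK.
Qed.

(** Regularity is assumed of the minor alone: this serves for Schur complements, whose own
    determinants are not yet known to be nonzero. *)
Lemma minor_qdet n (A Z : 'M[quat F]_n.+1) k z :
  selfadj A -> regular (minor k A) -> A *m Z = 1%:M -> Z k k = z%:A ->
  z *: qdet k A = Qdet0 (minor k A).
Proof.
case: n A Z k => [|n] A Z k sA rk AZ Zk; last first.
  have [[W d] /= hW] := regular_cramer (selfadj_minor k sA) rk.
  exact: pivot_qdet hW AZ Zk.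
have /matrixP/(_ 0 0) := AZ; rewrite !mxE big_ord1 qdet1.
by rewrite ord1 in Zk *; rewrite Zk scalar_mulC -scalerAl mul1r => ->.
Qed.

Definition schur k m (A : 'M[quat F]_(k + m)) (W : 'M[quat F]_m) : 'M[quat F]_k :=
  ulsubmx A - ursubmx A *m W *m dlsubmx A.

Lemma lift_lshift k m (i : 'I_k.+1) (j : 'I_k) :
  lift (lshift m i) (lshift m j) = lshift m (lift i j) :> 'I_(k.+1 + m).
Proof. exact: val_inj. Qed.

Lemma lift_rshift k m (i : 'I_k.+1) (j : 'I_m) :
  lift (lshift m i) (rshift k j) = rshift k.+1 j :> 'I_(k.+1 + m).
Proof.
apply: val_inj => /=; rewrite /bump; case: leqP => //.
by rewrite ltnNge -ltnS (leq_trans (ltn_ord i)) // leq_addr.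
Qed.

(** Deleting an index outside the eliminated block commutes with the elimination, which permits
    induction on [k]. *)
Lemma schur_minor k m (A : 'M[quat F]_(k.+1 + m)) W (i : 'I_k.+1) :
  schur (minor (lshift m i) A : 'M[quat F]_(k + m)) W = minor i (schur A W).
Proof.
apply/matrixP => p q; rewrite !mxE !lift_lshift; congr (_ - _).
apply: eq_bigr => j _; rewrite !mxE lift_lshift lift_rshift; congr (_ * _).
by apply: eq_bigr => j' _; rewrite !mxE lift_lshift lift_rshift.
Qed.

(** The lower left block of [A *m Z = 1%:M] lets [W] cancel against [drsubmx A]; what remains is the
    upper left block of the same equation. *)
Lemma schur_inverse k m (A Z : 'M[quat F]_(k + m)) (W : 'M[quat F]_m) :
  A *m Z = 1%:M -> W *m drsubmx A = 1%:M -> schur A W *m ulsubmx Z = 1%:M.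
Proof.
move=> AZ WA; move: AZ.
rewrite -[A in A *m _]submxK -[Z in _ *m Z]submxK mulmx_block scalar_mx_block.
move=> /eq_block_mx[E1 _ E2 _].
rewrite /schur mulmxBl -!mulmxA.
have -> : dlsubmx A *m ulsubmx Z = - (drsubmx A *m dlsubmx Z).
  by apply/eqP; rewrite -addr_eq0 E2.
by rewrite mulmxN mulmxA WA mul1mx mulmxN opprK.
Qed.

Lemma schur_selfadj k m (A : 'M[quat F]_(k + m)) W :
  selfadj A -> adjmx W = W -> selfadj (schur A W).
Proof.
move=> sA sW; apply/selfadjP.
have adjmxB (M N : 'M[quat F]_k) : adjmx (M - N) = adjmx M - adjmx N.
  by apply/matrixP => p q; rewrite !mxE adjqB.
rewrite /schur adjmxB !adjmxM sW mulmxA.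
have -> : adjmx (ulsubmx A) = ulsubmx A.
  by apply/matrixP => p q; rewrite !mxE -sA.
have -> : adjmx (dlsubmx A) = ursubmx A.
  by apply/matrixP => p q; rewrite !mxE -sA.
by have -> : adjmx (ursubmx A) = dlsubmx A
  by apply/matrixP => p q; rewrite !mxE -sA.
Qed.

(** Let [S] be the Schur complement. By induction the cofactor [D Z_ii] of [A] is [d] times the
    cofactor of [S] at [i]. As the block of [Z] inverts [S], [minor_qdet] says that this cofactor of
    [S] is [Z_ii] times [qdet i S]. Cancelling [Z_ii] leaves [D / d] as the value of [qdet i S] for
    every [i], which also gives the nonvanishing required by [regular]. *)
Lemma regular_schur k m (A : 'M[quat F]_(k + m.+1)) W d :
  selfadj A -> regular A -> d != 0 -> cramer_inverse (drsubmx A) W d ->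
  regular (schur A W) /\ Qdet0 A = d *: Qdet0 (schur A W).
Proof.
elim: k A => [|k IH] A sA rA d0 hW.
  split=> //=; rewrite -(cramer_qdet ord0 hW).
  by congr qdet; apply/matrixP => i j; rewrite !mxE; congr (A _ _); exact: val_inj.
have sS : selfadj (schur A W) by apply: schur_selfadj => //; case: hW.
have [Z [D hZ]] : exists (Z : 'M[quat F]_(k.+1 + m.+1)) D, cramer_inverse A Z D.
  by have [[Z D] hZ] := regular_cramer sA rA; exists Z, D.
have D0 : D != 0.
  by apply: contra (rA.1 ord0) => /eqP D0; rewrite (cramer_qdet _ hZ) D0 scale0r.
have AZ : A *m Z = 1%:M by exact: cramer_invr hZ.
have Mi (i : 'I_k.+1) : drsubmx (minor (lshift m.+1 i) A : 'M[quat F]_(k + m.+1)) = drsubmx A.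
  by apply/matrixP => p q; rewrite !mxE !lift_rshift.
have IHi (i : 'I_k.+1) : regular (minor i (schur A W)) /\
    D *: Z (lshift m.+1 i) (lshift m.+1 i) = d *: Qdet0 (minor i (schur A W)).
  rewrite -schur_minor; have [_ _ _ <-] := hZ.
  apply: IH => //; [exact: selfadj_minor|exact: rA.2|by rewrite Mi].
have SZ : schur A W *m ulsubmx (Z : 'M[quat F]_(k.+1 + m.+1)) = 1%:M.
  by apply: schur_inverse => //; case: hW.
have q (i : 'I_k.+1) : qdet i (schur A W) = (D / d)%:A.
  have Zs : Z (lshift m.+1 i) (lshift m.+1 i) =
      (q0 (Z (lshift m.+1 i) (lshift m.+1 i)))%:A.
    by apply: selfadj_scalar => //; have [_ sZ _ _] := hZ; rewrite -[in RHS]sZ mxE.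
  have [ri] := IHi i; set z := q0 _ in Zs; rewrite Zs => zE.
  have Qi : Qdet0 (minor i (schur A W)) = (D * z / d)%:A.
    apply: (scalerI d0); rewrite -zE !scalerA; congr (_ *: _).
    by rewrite mulrCA mulfV ?mulr1.
  have z0 : z != 0.
    apply: contra (regular_Qdet0 ri) => /eqP z0.
    by rewrite Qi z0 mulr0 mul0r scale0r.
  have pq : z *: qdet i (schur A W) = Qdet0 (minor i (schur A W)).
    by apply: (minor_qdet sS ri SZ); rewrite !mxE Zs.
  apply: (scalerI z0); rewrite pq Qi scalerA; congr (_ *: _).
  by rewrite mulrCA mulrA.
split.
  split=> [i|i]; last exact: (IHi i).1.
  rewrite q; apply: contra (mulf_neq0 D0 (invr_neq0 d0)) => /eqP.
  by move=> /(congr1 (@q0 _)); rewrite q0A => ->.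
by rewrite [Qdet0 _](cramer_qdet _ hZ) [Qdet0 _]q scalerA mulrCA mulfV ?mulr1.
Qed.

End RegularMatrix.

(** * Bordered determinants and the Palm kernel *)

Section Bordered.
Variable C : comNzRingType.

Definition border_ord k m (i : 'I_k) (a : 'I_m.+1) : 'I_(k + m) :=
  if unlift ord0 a is Some a' then rshift k a' else lshift m i.

Definition bordered k m (A : 'M[quat C]_(k + m)) (i j : 'I_k) : 'M[quat C]_m.+1 :=
  \matrix_(a, b) A (border_ord i a) (border_ord j b).

Definition bordered_qdet k m (A : 'M[quat C]_(k + m)) : 'M[quat C]_k :=
  \matrix_(i, j) qdet ord0 (bordered A i j).

Lemma qdet_bordered k m (A : 'M[quat C]_(k + m.+1)) i j :
  qdet ord0 (bordered A i j) =
    A (lshift _ i) (lshift _ j) * Qdet (drsubmx A) -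
    \sum_l A (lshift _ i) (rshift _ l) *
       qdet l (colrep (drsubmx A) l (fun p => A (rshift _ p) (lshift _ j))).
Proof.
rewrite -[bordered A i j](colrep_id _ ord0) qdet_colrep mxE /border_ord unlift_none.
have -> : minor ord0 (bordered A i j) = drsubmx A.
  by apply/matrixP => p q; rewrite !mxE /border_ord !liftK.
congr (_ - _); apply: eq_bigr => l _; rewrite mxE /border_ord liftK unlift_none.
congr (_ * qdet _ _); apply/matrixP => p q; rewrite !mxE /border_ord /=.
by case: ifP => // _; rewrite mxE /border_ord liftK unlift_none.
Qed.

Lemma qdet_scalar1 n (k : 'I_n.+1) : qdet k 1%:M = 1 :> quat C.
Proof.
elim: n k => [|n IH] k; first by rewrite qdet1 mxE.
rewrite -[1%:M](colrep_id _ k) qdet_colrep mxE eqxx mul1r.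
have -> : minor k 1%:M = 1%:M :> 'M[quat C]_n.+1.
  by apply/matrixP => i j; rewrite !mxE (inj_eq (@lift_inj _ k)).
rewrite [Qdet _]IH big1 ?subr0 // => l _.
by rewrite mxE eq_sym lift_eqF mul0r.
Qed.

Lemma qdetZ n (k : 'I_n.+1) (c : C) (M : 'M[quat C]_n.+1) :
  qdet k (map_mx ( *:%R c) M) = c ^+ n.+1 *: qdet k M.
Proof.
elim: n k M => [|n IH] k M; first by rewrite !qdet1 mxE expr1.
rewrite /= scaler_sumr; apply: eq_bigr => l _.
rewrite !mxE -scalerAr exprS -scalerA -scalerAl; congr (_ *: _).
rewrite scalerAr -IH; congr (_ * qdet _ _).
by apply/matrixP => i j; rewrite !mxE.
Qed.

End Bordered.

Lemma map_bordered_qdet (C D : comNzRingType) (f : {rmorphism C -> D}) k m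
    (A : 'M[quat C]_(k + m)) :
  map_mx (mapq f) (bordered_qdet A) = bordered_qdet (map_mx (mapq f) A).
Proof.
apply/matrixP => i j; rewrite !mxE map_qdet; congr qdet.
by apply/matrixP => a b; rewrite !mxE.
Qed.

Section BorderedRegular.
Variable F : fieldType.
Hypothesis two : 2%:R != 0 :> F.

(** The block arises by deleting the first [k] indices one at a time, so it is one of the nested
    minors. *)
Lemma drsubmx_regular k m (A : 'M[quat F]_(k + m)) :
  selfadj A -> regular A -> selfadj (drsubmx A) /\ regular (drsubmx A).
Proof.
move=> sA rA; split; first by move=> i j; rewrite !mxE.
elim: k A rA {sA} => [|k IH] A rA.
  rewrite (_ : drsubmx A = A) //.
  by apply/matrixP => i j; rewrite !mxE; congr (A _ _); exact: val_inj.
rewrite (_ : drsubmx A =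
  drsubmx (minor (lshift m ord0) A : 'M[quat F]_(k + m))); last first.
  by apply/matrixP => p q; rewrite !mxE !lift_rshift.
by apply: IH; exact: rA.2.
Qed.

(** Expansion along the border row leaves determinants of the block with one column replaced by the
    border column. Cramer's rule makes them [d] times the entries of [W c], and the Schur complement
    appears. *)
Lemma bordered_qdet_schur k m (A : 'M[quat F]_(k + m.+1)) W d :
  cramer_inverse (drsubmx A) W d ->
  bordered_qdet A = map_mx ( *:%R d) (schur A W).
Proof.
move=> hW; apply/matrixP => i j; rewrite !mxE qdet_bordered.
rewrite [Qdet _](cramer_qdet _ hW) scalar_mulC -scalerAl mul1r scalerBr.
congr (_ - _); rewrite scaler_sumr.
have [_ _ h _] := hW; under eq_bigr => l _ do rewrite h -scalerAr mulr_sumr scaler_sumr.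
rewrite exchange_big /=; apply: eq_bigr => q _.
rewrite !mxE mulr_suml scaler_sumr; apply: eq_bigr => l _.
by rewrite !mxE mulrA.
Qed.

(** Scaling a matrix of size [k.+1] by [d] gives the factor [d ^+ k.+1]; one power is absorbed by
    the relation between [Qdet A] and the Schur complement. *)
Lemma regular_bordered k m (A : 'M[quat F]_(k.+1 + m.+1)) :
  selfadj A -> regular A ->
  Qdet (bordered_qdet A) = q0 (Qdet (drsubmx A)) ^+ k *: Qdet A
  /\ selfadj (bordered_qdet A).
Proof.
move=> sA rA; have [sX rX] := drsubmx_regular sA rA.
have [[W d] /= hW] := regular_cramer two sX rX.
have d0 : d != 0.
  by apply: contra (rX.1 ord0) => /eqP d0; rewrite (cramer_qdet _ hW) d0 scale0r.
have [_ QA] := regular_schur two sA rA d0 hW.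
rewrite (bordered_qdet_schur hW) [Qdet (drsubmx A)](cramer_qdet _ hW) q0A; split.
  by rewrite [LHS]qdetZ [Qdet A]QA scalerA -exprSr.
move=> i j; rewrite !mxE adjqZ; congr (_ *: _).
have sS : selfadj (schur A W) by apply: schur_selfadj => //; case: hW.
by have := sS i j; rewrite !mxE.
Qed.

End BorderedRegular.

(* Deforming [A] to the identity: [(1 - 'X) 1 + 'X A] has, as a matrix over the
   field of fractions of [{poly F}], nonzero minors since they are [1] at 0. *)
Lemma regular_deformation (F : fieldType) n (A : 'M[quat F]_n) :
  2%:R != 0 :> F -> selfadj A ->
  exists At : 'M[quat {poly F}]_n,
  [/\ selfadj At, regular (map_mx (mapq (@tofrac {poly F})) At) &
      map_mx (mapq (horner_eval (1 : F))) At = A].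
Proof.
move=> two.
pose At m (B : 'M[quat F]_m) : 'M[quat {poly F}]_m :=
  \matrix_(i, j) ((1 - 'X) *: (i == j)%:R + 'X *: mapq (@polyC F) (B i j)).
have e0 m (B : 'M[quat F]_m) : map_mx (mapq (horner_eval (0 : F))) (At m B) = 1%:M.
  apply/matrixP => i j; rewrite !mxE mapqD !mapqZ mapq_natr.
  by rewrite /= /horner_eval !hornerE scale0r subr0 addr0 scale1r.
have e1 m (B : 'M[quat F]_m) : map_mx (mapq (horner_eval (1 : F))) (At m B) = B.
  apply/matrixP => i j; rewrite !mxE mapqD !mapqZ mapq_natr.
  rewrite /= /horner_eval !hornerE subrr scale0r add0r scale1r.
  by apply: quatP; rewrite /= /horner_eval hornerC.
move=> sA; exists (At n A); split => //.
- move=> i j; rewrite !mxE adjqD !adjqZ sA mapq_adj [j == i]eq_sym.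
  by congr (_ *: _ + _); case: (i == j); rewrite ?adjq0 // -[1]scale1r adjqA.
- elim: n A {sA} => [|n IH] A //=; split => k.
    rewrite -map_qdet; apply/eqP => h.
    have /(mapq_inj _) : mapq (@tofrac {poly F}) (qdet k (At _ A)) = mapq (@tofrac {poly F}) 0.
      by rewrite h rmorph0.
    move=> /(_ _)/(congr1 (mapq (horner_eval (0 : F)))).
    rewrite map_qdet e0 qdet_scalar1 rmorph0 => h0.
    have /eqP := oner_neq0 (quat F); apply; apply: h0.
    by move=> p q /eqP; rewrite tofrac_eq => /eqP.
  (* The deformation of a minor is the minor of the deformation, so the induction hypothesis
     applies. *)
  rewrite (_ : minor k _ = map_mx (mapq (@tofrac {poly F})) (At _ (minor k A))) //.
  by apply/matrixP => i j; rewrite !mxE (inj_eq (@lift_inj _ k)).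
Qed.

Section Palm.
Variable F : fieldType.
Hypothesis two : 2%:R != 0 :> F.

(** Both properties hold over the fractions, descend to polynomials because the embedding is
    injective, and are then evaluated at 1. The determinant of the block may vanish here. *)
Lemma bordered_qdetP k m (A : 'M[quat F]_(k.+1 + m.+1)) :
  selfadj A ->
  Qdet (bordered_qdet A) = q0 (Qdet (drsubmx A)) ^+ k *: Qdet A
  /\ selfadj (bordered_qdet A).
Proof.
move=> sA; have [At [sAt rAt e1]] := regular_deformation two sA.
have tI : injective (@tofrac {poly F}).
  by move=> p q /eqP; rewrite tofrac_eq => /eqP.
have two' : 2%:R != 0 :> {fraction {poly F}}.
  rewrite -(rmorph_nat (@tofrac {poly F})) tofrac_eq0 -polyC_natr polyC_eq0.
  exact: two.
have sf : selfadj (map_mx (mapq (@tofrac {poly F})) At).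
  by move=> i j; rewrite !mxE -mapq_adj -sAt.
have [Q S] := regular_bordered two' sf rAt.
have dr (D : comNzRingType) (g : {rmorphism {poly F} -> D}) :
    q0 (Qdet (drsubmx (map_mx (mapq g) At))) = g (q0 (Qdet (drsubmx At))).
  rewrite -[RHS]/(q0 (mapq g _)) map_qdet; congr (q0 (qdet _ _)).
  by apply/matrixP => i j; rewrite !mxE.
have QP : Qdet (bordered_qdet At) = q0 (Qdet (drsubmx At)) ^+ k *: Qdet At.
  apply: (mapq_inj tI); rewrite mapqZ !map_qdet map_bordered_qdet.
  by rewrite [LHS]Q dr rmorphXn.
have SP : selfadj (bordered_qdet At).
  move=> i j; apply: (mapq_inj tI); have := S i j.
  by rewrite -map_bordered_qdet !mxE mapq_adj.
rewrite -e1 -map_bordered_qdet; split.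
  by rewrite dr -rmorphXn /Qdet -!map_qdet -mapqZ -QP.
by move=> i j; rewrite [LHS]mxE SP mapq_adj [in RHS]mxE.
Qed.

Lemma kernel_mx_selfadj (E : Type) (K : E -> E -> quat F) n (t : n.-tuple E) :
  selfadjoint_kernel K -> selfadj (kernel_mx K t t).
Proof. by move=> sK i j; rewrite !mxE. Qed.

Lemma bordered_kernel (E : Type) (K : E -> E -> quat F) k m (y : k.-tuple E)
    (x : m.-tuple E) i j :
  bordered (kernel_mx K (cat_tuple y x) (cat_tuple y x)) i j =
  kernel_mx K [tuple of tnth y i :: x] [tuple of tnth y j :: x].
Proof.
have E1 p a : tnth (cat_tuple y x) (border_ord p a) =
    tnth [tuple of tnth y p :: x] a.
  rewrite /border_ord; case: unliftP => [b|] ->.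
    by rewrite tnth_rshift tnthS.
  by rewrite tnth_lshift tnth0.
by apply/matrixP => a b; rewrite !mxE !E1.
Qed.

Lemma drsubmx_kernel (E : Type) (K : E -> E -> quat F) k m (y : k.-tuple E)
    (x : m.-tuple E) :
  drsubmx (kernel_mx K (cat_tuple y x) (cat_tuple y x)) = kernel_mx K x x.
Proof. by apply/matrixP => a b; rewrite !mxE !tnth_rshift. Qed.

Lemma palm_kernelE (E : Type) (K : E -> E -> quat F) k m (y : k.-tuple E)
    (x : m.+1.-tuple E) i j :
  palm_kernel K x (tnth y i) (tnth y j) = (q0 (Qdet (kernel_mx K x x)))^-1 *:
    bordered_qdet (kernel_mx K (cat_tuple y x) (cat_tuple y x)) i j.
Proof. by rewrite mxE bordered_kernel. Qed.

Lemma palm_kernel_selfadj (E : Type) (K : E -> E -> quat F) m (x : m.+1.-tuple E) :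
  selfadjoint_kernel K -> selfadjoint_kernel (palm_kernel K x).
Proof.
(* The two values to compare are opposite entries of the bordered matrix on the points [y] and
   [z]. *)
move=> sK y z; pose t := [tuple y; z].
have [_ S] := bordered_qdetP (kernel_mx_selfadj (cat_tuple t x) sK).
have ty : tnth t ord0 = y by [].
have tz : tnth t (lift ord0 ord0) = z by [].
rewrite -ty -tz !palm_kernelE adjqZ; congr (_ *: _); exact: S.
Qed.

(** Dividing a matrix of size [k.+1] by [r] contributes [r] to the power [-(k+1)], and the bordered
    identity contributes [r ^+ k]. *)
Lemma palm_kernel_qdet (E : Type) (K : E -> E -> quat F) k m
    (y : k.+1.-tuple E) (x : m.+1.-tuple E) (r : F) :
  selfadjoint_kernel K -> Qdet (kernel_mx K x x) = r%:A -> r != 0 ->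
  Qdet (kernel_mx (palm_kernel K x) y y) =
    r^-1 *: Qdet (kernel_mx K (cat_tuple y x) (cat_tuple y x)).
Proof.
move=> sK xr r0.
have [Q _] := bordered_qdetP (kernel_mx_selfadj (cat_tuple y x) sK).
move: Q; rewrite drsubmx_kernel xr q0A => Q.
transitivity (Qdet (map_mx ( *:%R r^-1)
  (bordered_qdet (kernel_mx K (cat_tuple y x) (cat_tuple y x))))).
  by congr qdet; apply/matrixP => i j; rewrite [LHS]mxE palm_kernelE xr q0A [RHS]mxE.
rewrite [LHS]qdetZ [qdet _ _]Q scalerA; congr (_ *: _).
by rewrite exprS -mulrA -exprMn mulVf // expr1n mulr1.
Qed.

Lemma qdet_repeated (E : Type) (K : E -> E -> quat F) (x : E) :
  Qdet (kernel_mx K [tuple x; x] [tuple x; x]) = 0.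
Proof.
have: forall a, tnth [tuple x; x] a = x.
  by case=> [[|[|]]// ?]; rewrite (tnth_nth x).
move: [tuple x; x] => t tE.
rewrite /Qdet -[kernel_mx _ _ _](colrep_id _ ord0) qdet_colrep big_ord1.
rewrite [Qdet _]qdet1 qdet1.
by rewrite !mxE eqxx /= mxE !tE subrr.
Qed.

End Palm.

(** * Separating cells *)

Section Codes.
Context d (T : measurableType d) (V : (set T)^nat).
Hypothesis mV : forall n, measurable (V n).
Hypothesis genV : (@measurable d T) = <<s range V >>.
Hypothesis sepV : forall x y, (forall n, V n x <-> V n y) -> x = y.

(** The fibres of [code N] are the cells: the atoms of the algebra generated by the first [N] sets.
    They are finitely many, refine as [N] grows, and separate points in the limit. *)
Definition code N (x : T) : N.-tuple bool := [tuple x \in V i | i < N].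

Definition codes N k (q : k.-tuple T) : k.-tuple (N.-tuple bool) :=
  map_tuple (code N) q.

Definition cell N (c : N.-tuple bool) : set T := [set x | code N x = c].

Definition level N k (w : k.-tuple (N.-tuple bool)) : set (k.-tuple T) :=
  [set q | codes N q = w].

Definition pow k (B : set T) : set (k.-tuple T) :=
  [set q | forall i, B (tnth q i)].

(** An empty [z] serves for moment measures of a process; [z] will be the conditioning tuple [x] for
    Palm measures. *)
Definition separated N k m (z : m.-tuple T) : set (k.-tuple T) :=
  [set q | uniq (codes N q ++ codes N z)].

Lemma tnth_codes N k (q : k.-tuple T) i : tnth (codes N q) i = code N (tnth q i).
Proof. by rewrite tnth_map. Qed.

Lemma levelE N k (w : k.-tuple (N.-tuple bool)) (q : k.-tuple T) :
  level w q <-> forall i, cell (tnth w i) (tnth q i).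
Proof.
split=> [<- i|h]; first by rewrite tnth_codes.
by apply: eq_from_tnth => i; rewrite tnth_codes h.
Qed.

Lemma code_mono N M x y : (N <= M)%N -> code M x = code M y -> code N x = code N y.
Proof.
move=> NM h; apply: eq_from_tnth => i.
have := congr1 (fun t => tnth t (widen_ord NM i)) h.
by rewrite !tnth_mktuple.
Qed.

Lemma codes_mono N M k (p q : k.-tuple T) :
  (N <= M)%N -> codes M p = codes M q -> codes N p = codes N q.
Proof.
move=> NM h; apply: eq_from_tnth => i; rewrite !tnth_codes.
by apply: (code_mono NM); rewrite -!tnth_codes h.
Qed.

Lemma measurable_cell N (c : N.-tuple bool) : measurable (cell c).
Proof.
have -> : cell c = \bigcap_(i in [set: 'I_N]) [set x | (x \in V i) = tnth c i].
  apply/seteqP; split=> [x <- i _ /=|x h]; first by rewrite tnth_mktuple.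
  by apply: eq_from_tnth => i; rewrite tnth_mktuple; exact: h.
apply: fin_bigcap_measurable => // i _; case: (tnth c i).
  have -> : [set x | (x \in V i) = true] = V i.
    by apply/seteqP; split=> x; [exact: set_mem|exact: mem_set].
  exact: mV.
have -> : [set x | (x \in V i) = false] = ~` V i.
  apply/seteqP; split=> x /= h; first by move/negbT: h; rewrite notin_setE.
  by apply/negbTE; rewrite notin_setE.
exact/measurableC/mV.
Qed.

Lemma measurable_pow k (B : set T) : measurable B -> measurable (@pow k B).
Proof.
move=> mB; have -> : @pow k B = \bigcap_(i in [set: 'I_k]) (@tnth _ T ^~ i @^-1` B).
  by apply/seteqP; split=> [q h i _|q h i]; apply: h.
apply: fin_bigcap_measurable => // i _; rewrite -[X in measurable X]setTI.
exact: measurable_tnth.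
Qed.

Lemma measurable_level N k (w : k.-tuple (N.-tuple bool)) : measurable (level w).
Proof.
have -> : level w =
    \bigcap_(i in [set: 'I_k]) (@tnth _ T ^~ i @^-1` cell (tnth w i)).
  by apply/seteqP; split=> [q /levelE h i _|q h]; [exact: h|apply/levelE => i; exact: h].
apply: fin_bigcap_measurable => // i _; rewrite -[X in measurable X]setTI.
by apply: measurable_tnth => //; exact: measurable_cell.
Qed.

Lemma codes_finite_measurable N k (P : {pred k.-tuple (N.-tuple bool)}) :
  measurable [set q : k.-tuple T | P (codes N q)].
Proof.
have -> : [set q : k.-tuple T | P (codes N q)] = \bigcup_(w in [set w | P w]) level w.
  by apply/seteqP; split=> [q h|q [w /= h wq]]; [exists (codes N q)|rewrite wq].
by apply: fin_bigcup_measurable => // w _; exact: measurable_level.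
Qed.

Lemma measurable_separated N k m (z : m.-tuple T) :
  measurable (separated N z : set (k.-tuple T)).
Proof. exact: (codes_finite_measurable (fun w => uniq (w ++ codes N z))). Qed.

(** Levels of any two depths are nested or disjoint; adding the empty set makes them a pi-system. *)
Definition levels k : set (set (k.-tuple T)) :=
  [set A | A = set0 \/ exists N w, A = @level N k w].

Lemma level_nested N M k (w : k.-tuple (N.-tuple bool)) v : (N <= M)%N ->
  level w `&` level v = @level M k v \/ level w `&` level v = set0.
Proof.
move=> NM; have [[q [wq vq]]|h] := pselect (level w `&` level v !=set0); last first.
  by right; apply/eqP/negPn/negP => /set0P.
left; apply/setIidr => p vp; rewrite /level /= -wq.
by apply: (codes_mono NM); rewrite vp vq.
Qed.

Lemma levels_setI k : setI_closed (@levels k).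
Proof.
move=> A B [->|[N [w ->]]]; first by rewrite set0I; left.
move=> [->|[M [v ->]]]; first by rewrite setI0; left.
have [NM|MN] := leqP N M.
  by have [->|->] := level_nested w v NM; [right; exists M, v|left].
rewrite setIC.
by have [->|->] := level_nested v w (ltnW MN); [right; exists N, w|left].
Qed.

Lemma tuple_measurableE k : (@measurable _ (k.-tuple T)) `<=` <<s @levels k >>.
Proof.
have key (i : 'I_k) (A : set T) : measurable A ->
    <<s @levels k >> (@tnth _ T ^~ i @^-1` A).
  rewrite genV.
  suff: <<s range V >> `<=`
      [set A | <<s @levels k >> (@tnth _ T ^~ i @^-1` A)] by apply.
  apply: smallest_sub.
    split=> [|B hB|F hF] /=.
    - by rewrite preimage_set0; exact: sigma_algebra0.
    - by rewrite setTD preimage_setC; exact: sigma_algebraC.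
    - by rewrite preimage_bigcup; exact: sigma_algebra_bigcup.
  move=> _ [n _ <-] /=.
  (* Membership in [V n] is the last bit of a code of depth [n.+1]. *)
  have -> : @tnth _ T ^~ i @^-1` V n =
      \bigcup_(w in [set w : k.-tuple (n.+1.-tuple bool) | tnth (tnth w i) ord_max]) level w.
    have E q : tnth (tnth (codes n.+1 q) i) ord_max = (tnth q i \in V n).
      by rewrite tnth_codes tnth_mktuple.
    apply/seteqP; split=> [q /= /mem_set h|q [w /= h wq]].
      by exists (codes n.+1 q) => //=; rewrite E.
    by rewrite -wq E inE in h.
  apply: (@fin_bigcup_measurable _ (g_sigma_algebraType (@levels k))) => //.
  by move=> w _; apply: sub_sigma_algebra; right; exists n.+1, w.
apply: smallest_sub; first exact: smallest_sigma_algebra.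
rewrite -bigcup_seq => A [i _ [B mB <-]].
by rewrite setTI; exact: key.
Qed.

Lemma level_dynkin k (D : set (set (k.-tuple T))) :
  dynkin D -> (forall N w, D (@level N k w)) -> measurable `<=` D.
Proof.
move=> dD hD; apply: subset_trans (@tuple_measurableE k) _.
rewrite -setI_closed_g_dynkin_g_sigma_algebra; last exact: levels_setI.
apply: smallest_sub => // A [->|[N [w ->//]]].
by rewrite -setCT; case: dD => DT DC _; exact: DC.
Qed.

Lemma level0 k (w : k.-tuple (0.-tuple bool)) : level w = setT.
Proof.
apply/seteqP; split=> // q _; apply: eq_from_tnth => i.
by rewrite [LHS]tuple0 [RHS]tuple0.
Qed.

Lemma separated_mono N M k m (z : m.-tuple T) (q : k.-tuple T) :
  (N <= M)%N -> separated N z q -> separated M z q.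
Proof.
move=> NM; rewrite /separated /= -!map_cat => /(uniqP (code N point)) u.
apply/(uniqP (code M point)) => i j; rewrite !inE !size_map => si sj.
rewrite !(nth_map point) // => e; apply: u; rewrite ?inE ?size_map //.
by rewrite !(nth_map point) //; apply: code_mono e.
Qed.

(** Belonging to [level w] or to [separated N0 z] depends only on the codes of depth [maxn N N0], so
    a level of that depth lies inside both or misses one of them. *)
Lemma separated_level k n (z : n.-tuple T) B N N0 (w : k.-tuple (N.-tuple bool))
    (v : k.-tuple ((maxn N N0).-tuple bool)) :
  let S := level w `&` (pow B `&` separated N0 z) in
  S `&` level v = set0 \/
  uniq (v ++ codes (maxn N N0) z) /\ S `&` level v = level v `&` pow B.
Proof.
move=> S; have [[q [[wq [Bq sq]] vq]]|no] := pselect (S `&` level v !=set0); last first.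
  by left; apply/eqP/negPn/negP => /set0P.
right; split.
  by rewrite -vq; exact: separated_mono (leq_maxr N N0) sq.
apply/seteqP; split=> [p [[_ [Bp _]] vp]//|p [vp Bp]].
have E M : (M <= maxn N N0)%N -> codes M p = codes M q.
  by move=> ?; apply: (codes_mono (M := maxn N N0)) => //; rewrite vp vq.
split=> //; split; first by rewrite /level /= (E _ (leq_maxl _ _)).
by split=> //; rewrite /separated /mkset (E _ (leq_maxr _ _)).
Qed.

Section Measures.
Context (R : realType).

Lemma levels_unique k (m1 m2 : {measure set (k.-tuple T) -> \bar R}) :
  (forall N w, m1 (@level N k w) = m2 (level w)) -> (m1 setT < +oo)%E ->
  forall A, measurable A -> m1 A = m2 A.
Proof.
move=> h m1oo A mA.
apply: (g_sigma_algebra_measure_unique (@levels k) _ (fun=> setT)).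
- move=> B [->|[N [w ->]]]; [exact: measurable0|exact: measurable_level].
- by move=> _; right; exists 0, [tuple of nseq k [tuple]]; rewrite level0.
- by rewrite bigcup_const //; exists 0.
- exact: levels_setI.
- by move=> B [->|[N [w ->]]] //; rewrite !measure0.
- by [].
- exact: tuple_measurableE.
Qed.

Lemma measure_levels N k (m : {measure set (k.-tuple T) -> \bar R}) S :
  measurable S ->
  m S = (\sum_(w \in [set: k.-tuple (N.-tuple bool)]) m (S `&` level w))%E.
Proof.
move=> mS.
rewrite -measure_fin_bigcup //.
- congr (m _); apply/seteqP; split=> [q Sq|q [w _ []]//].
  by exists (codes N q).
- exact: finite_finset.
- by move=> v w _ _ [q [[_ <-] [_ <-]]].
- by move=> w _; apply: measurableI => //; exact: measurable_level.
Qed.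

(** Cut a level to depth at least [N0]: within the separated tuples, only pieces to which the
    hypothesis applies survive. The restricted measures thus agree on a generating pi-system, and
    finiteness on [pow B] gives uniqueness. *)
Lemma separated_unique k n (z : n.-tuple T) B N0
    (m1 m2 : {measure set (k.-tuple T) -> \bar R}) :
  measurable B -> (m1 (pow B) < +oo)%E ->
  (forall N (w : k.-tuple (N.-tuple bool)), uniq (w ++ codes N z) ->
    m1 (level w `&` pow B) = m2 (level w `&` pow B)) ->
  forall A, measurable A ->
    m1 (A `&` (pow B `&` separated N0 z)) = m2 (A `&` (pow B `&` separated N0 z)).
Proof.
move=> mB m1oo h A mA.
have mD : measurable (pow B `&` separated N0 z : set (k.-tuple T)).
  by apply: measurableI; [exact: measurable_pow|exact: measurable_separated].
apply: (levels_unique (m1 := mrestr m1 mD) (m2 := mrestr m2 mD)) => //=; last first.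
  rewrite /mrestr; apply: le_lt_trans m1oo; apply: le_measure; rewrite ?inE.
  - by rewrite setTI.
  - exact: measurable_pow.
  - by move=> q [_ []].
move=> N w; rewrite /mrestr.
set S := _ `&` _; have mS : measurable S.
  by apply: measurableI => //; exact: measurable_level.
rewrite (measure_levels (maxn N N0) m1 mS) (measure_levels (maxn N N0) m2 mS).
apply: eq_fsbigr => v _.
by have [->|[u ->]] := separated_level z B w v; [rewrite !measure0|exact: h].
Qed.

End Measures.

(** Finitely many distinct points are told apart by finitely many of the sets [V n], and greater
    depth keeps them apart. *)
Lemma separated_limit k m (z : m.-tuple T) (q : k.-tuple T) :
  uniq (q ++ z) -> exists N, separated N z q.
Proof.
move=> u.
have sep (s : seq T) : uniq s -> exists N, uniq (map (code N) s).
  elim: s => [|x s IH] /=; first by exists 0.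
  move=> /andP[xs /IH[N uN]].
  have [M hM] : exists M, code M x \notin map (code M) s.
    elim: s xs {IH uN} => [|y s IH]; first by exists 0.
    rewrite inE negb_or => /andP[xy /IH[M hM]].
    have [n hn] : exists n, (x \in V n) != (y \in V n).
      apply: contrapT => hn; move/eqP: xy; apply; apply: sepV => n.
      have [e|e] := eqVneq (x \in V n) (y \in V n); last by case: hn; exists n.
      by rewrite -[V n x]in_setE e in_setE.
    exists (maxn M n.+1); rewrite inE negb_or; apply/andP; split.
      apply: contra hn => /eqP e; have := code_mono (leq_maxr M n.+1) e.
      by move=> /(congr1 (fun t => tnth t ord_max)); rewrite !tnth_mktuple => ->.
    apply: contra hM => /mapP[y' y's e]; apply/mapP; exists y' => //.
    by apply: code_mono e; exact: leq_maxl.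
  exists (maxn N M); apply/andP; split.
    apply: contra hM => /mapP[y ys e]; apply/mapP; exists y => //.
    by apply: code_mono e; exact: leq_maxr.
  move/(uniqP (code N x)): uN => u'; apply/(uniqP (code (maxn N M) x)) => i j.
  rewrite !inE !size_map => si sj; rewrite !(nth_map x) // => e.
  apply: u'; rewrite ?inE ?size_map // !(nth_map x) //.
  by apply: code_mono e; exact: leq_maxl.
by have [N uN] := sep _ u; exists N; rewrite /separated /= -map_cat.
Qed.

Lemma separated_uniq N k m (z : m.-tuple T) (q : k.-tuple T) :
  separated N z q -> uniq (q ++ z).
Proof. by rewrite /separated /= -map_cat; exact: map_uniq. Qed.

Lemma uniq_bigcup k m (z : m.-tuple T) :
  [set q : k.-tuple T | uniq (q ++ z)] = \bigcup_N separated N z.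
Proof.
apply/seteqP; split=> [q /separated_limit[N h]|q [N _ h]]; first by exists N.
exact: separated_uniq h.
Qed.

Lemma measurable_uniq k m (z : m.-tuple T) :
  measurable [set q : k.-tuple T | uniq (q ++ z)].
Proof.
by rewrite uniq_bigcup; apply: bigcup_measurable => N _; exact: measurable_separated.
Qed.

(** The separated tuples increase with the depth to those without collision; continuity from below
    removes the depth. *)
Lemma separated_unique_uniq (R : realType) k n (z : n.-tuple T) B
    (m1 m2 : {measure set (k.-tuple T) -> \bar R}) :
  measurable B -> (m1 (pow B) < +oo)%E ->
  (forall N (w : k.-tuple (N.-tuple bool)), uniq (w ++ codes N z) ->
    m1 (level w `&` pow B) = m2 (level w `&` pow B)) ->
  forall A, measurable A ->
    m1 (A `&` (pow B `&` [set q : k.-tuple T | uniq (q ++ z)])) =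
    m2 (A `&` (pow B `&` [set q : k.-tuple T | uniq (q ++ z)])).
Proof.
move=> mB m1oo h A mA. rewrite uniq_bigcup !setI_bigcupr.
have c (m : {measure set (k.-tuple T) -> \bar R}) :
    m (A `&` (pow B `&` separated N z)) @[N --> \oo] -->
    m (\bigcup_N (A `&` (pow B `&` separated N z))).
  have mS N : measurable (A `&` (pow B `&` separated N z : set (k.-tuple T))).
    apply: measurableI => //.
    by apply: measurableI; [exact: measurable_pow|exact: measurable_separated].
  apply: nondecreasing_cvg_mu => //; first exact: bigcup_measurable.
  move=> N M NM; apply/subsetPset => q [Aq [Bq sq]].
  by split=> //; split=> //; exact: separated_mono sq.
have c1 := c m1; rewrite (_ : (fun N => _) = fun N => m2 (A `&` (pow B `&` separated N z)))
  in c1; last by apply/funext => N; exact: separated_unique.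
by rewrite -(cvg_lim _ c1) // -(cvg_lim _ (c m2)).
Qed.

Lemma measure_exhaust (R : realType) k (B : (set T)^nat)
    (m1 m2 : {measure set (k.-tuple T) -> \bar R}) A :
  (forall n, measurable (B n)) -> (forall n p, (n <= p)%N -> B n `<=` B p) ->
  (forall x, exists n, B n x) -> measurable A ->
  (forall n, m1 (A `&` pow (B n)) = m2 (A `&` pow (B n))) -> m1 A = m2 A.
Proof.
move=> mB B_mono B_cover mA h.
have cov : A = \bigcup_n (A `&` pow (B n)).
  apply/seteqP; split=> [q Aq|q [n _ []//]].
  have /choice[f hf] : forall i : 'I_k, exists n, B n (tnth q i) by move=> i; exact: B_cover.
  exists (\max_i f i)%N => //; split=> // i; apply: B_mono (hf i).
  exact: leq_bigmax.
have c (m : {measure set (k.-tuple T) -> \bar R}) :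
    m (A `&` pow (B n)) @[n --> \oo] --> m A.
  rewrite [in X in _ --> X]cov; apply: nondecreasing_cvg_mu.
  - by move=> n; apply: measurableI => //; exact: measurable_pow.
  - by apply: bigcup_measurable => n _; apply: measurableI => //; exact: measurable_pow.
  - by move=> n p np; apply/subsetPset => q [Aq Bq]; split=> // i; exact: B_mono (Bq i).
have c1 := c m1; rewrite (_ : (fun n => _) = fun n => m2 (A `&` pow (B n))) in c1;
  last exact/funext.
by rewrite -(cvg_lim _ c1) // -(cvg_lim _ (c m2)).
Qed.

End Codes.

(** * Factorial measures of configurations *)

Section FactorialMeasure.
Context (R : realType) (T : choiceType).
Implicit Types (p A : set T).

Definition distinct_tuples p k : set (k.-tuple T) :=
  [set q : k.-tuple T | uniq q /\ forall i, p (tnth q i)].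

Arguments distinct_tuples p k : clear implicits.

(** Counting measure on the tuples of distinct points of [p]. It turns falling factorials of counts
    into values of a measure; its mean is the factorial moment measure. *)
Definition fact_measure p k (S : set (k.-tuple T)) : \bar R :=
  \esum_(q in S `&` distinct_tuples p k) 1%E.

Definition card_in p A : nat := #|` fset_set (A `&` p)|.

Lemma fact_measure_ge0 p k (S : set (k.-tuple T)) : (0 <= fact_measure p S)%E.
Proof. by apply: esum_ge0 => *; exact: lee01. Qed.

Lemma fact_measure0 p k : fact_measure p (set0 : set (k.-tuple T)) = 0%E.
Proof. by rewrite /fact_measure set0I esum_set0. Qed.

Lemma fact_measure_bigcup p k (F : (set (k.-tuple T))^nat) : trivIset setT F ->
  fact_measure p (\bigcup_n F n) = (\sum_(0 <= n <oo) fact_measure p (F n))%E.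
Proof.
move=> tF; rewrite /fact_measure setI_bigcupl nneseries_sum_bigcup //.
by apply/trivIsetP => i j _ _ ij; rewrite setIACA (iffLR trivIsetP tF) // set0I.
Qed.

Lemma fact_measureU p k (A B : set (k.-tuple T)) : A `&` B = set0 ->
  fact_measure p (A `|` B) = (fact_measure p A + fact_measure p B)%E.
Proof.
move=> AB; rewrite /fact_measure (esumID A); last by move=> *; exact: lee01.
congr (_ + _)%E; congr (esum _ _); apply/seteqP; split=> q.
- by move=> [[_ pq] Aq].
- by move=> [Aq pq]; split=> //; split=> //; left.
- by move=> [[[Aq|Bq] pq] nAq].
- move=> [Bq pq]; split; first by split=> //; right.
  by move=> Aq; have : (A `&` B) q by []; rewrite AB.
Qed.

Lemma le_fact_measure p k (A B : set (k.-tuple T)) : A `<=` B ->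
  (fact_measure p A <= fact_measure p B)%E.
Proof.
move=> AB; rewrite -(setDUK AB) fact_measureU ?setDIK //.
by rewrite leeDl // fact_measure_ge0.
Qed.

Lemma esum_card (s : seq T) : uniq s ->
  \esum_(x in [set` s]) (1%E : \bar R) = (size s)%:R%:E.
Proof.
move=> us; rewrite esum_fset; [|exact: finite_seq|by move=> *; exact: lee01].
by rewrite -fsbig_seq // sumEFin -sum1_size natr_sum.
Qed.

Lemma esum_scale (U : choiceType) (D : set U) (c : nat) :
  \esum_(q in D) (c%:R%:E : \bar R) = (c%:R%:E * \esum_(q in D) 1%E)%E.
Proof.
transitivity (\esum_(q in D) (\sum_(j < c) (1%E : \bar R))%E).
  by apply: eq_esum => q _; rewrite sumEFin sumr_const card_ord.
rewrite esum_sum; last by move=> *; exact: lee01.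
set x := esum _ _; have x0 : (0 <= x)%E by apply: esum_ge0 => *; exact: lee01.
elim: c => [|c IH]; first by rewrite big_ord0 mul0e.
by rewrite big_ord_recr /= IH -natr1 EFinD ge0_muleDl ?mul1e // lee_fin ler0n.
Qed.

Section Labels.
Variables (p : set T) (I : eqType) (A : I -> set T).
Hypothesis finA : forall i, finite_set (A i `&` p).
Hypothesis disjA : forall i j x, A i x -> A j x -> i = j.

Definition label_rect (s : seq I) k : set (k.-tuple T) :=
  [set q | forall a : 'I_k, nth set0 (map A s) a (tnth q a)].

Arguments label_rect s k : clear implicits.

(** Points are chosen from the last label to the first: one labelled [i] avoids those already taken
    in [A i], as many as [i] occurs later. Truncated subtraction is harmless, as a factor 0 occurs
    before a difference could become negative. *)
Fixpoint arrangements (s : seq I) : nat :=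
  if s is i :: s' then (card_in p (A i) - count_mem i s') * arrangements s'
  else 1.

(** By disjointness the coordinates of [q] lying in [A i] are exactly those labelled [i], so the
    number of excluded points depends on the labels alone. *)
Lemma card_avoiding k (s : seq I) (q : k.-tuple T) i :
  size s = k -> label_rect s k q -> distinct_tuples p k q ->
  \esum_(x in A i `&` p `&` [set x | x \notin q]) (1%E : \bar R) =
  (card_in p (A i) - count_mem i s)%:R%:E.
Proof.
move=> sk qs [uq pq]; set F := fset_set (A i `&` p).
have FE x : (x \in F) = (x \in A i `&` p) by rewrite in_fset_set.
have -> : A i `&` p `&` [set x | x \notin q] =
    [set` [seq x <- enum_fset F | x \notin q]].
  apply/seteqP; split=> x /=; rewrite mem_filter FE => h.
    by case: h => h ->; rewrite mem_set.
  by case/andP: h => xq /set_mem.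
rewrite esum_card; last by rewrite filter_uniq.
congr (_%:R%:E); rewrite size_filter.
have -> : card_in p (A i) = (count (mem q) F + count (predC (mem q)) F)%N.
  by rewrite count_predC.
suff -> : count_mem i s = count (mem q) F by rewrite addKn.
have -> : count (mem q) F = count (mem F) q.
  rewrite -!size_filter; apply: perm_size; apply: uniq_perm.
  - exact: filter_uniq.
  - exact: filter_uniq.
  - by move=> x; rewrite !mem_filter /= andbC.
have ss : size s == k by rewrite sk.
have -> : s = [seq tnth (Tuple ss) a | a <- enum 'I_k] by rewrite map_tnth_enum.
rewrite -(map_tnth_enum q).
rewrite !count_map; apply: eq_count => a /=; rewrite FE.
have Aa : A (tnth (Tuple ss) a) (tnth q a).
  have := qs a; rewrite (nth_map i) ?sk // => h.
  by rewrite (tnth_nth i).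
apply/eqP/idP => [<-|]; first by rewrite mem_set //; split.
by move=> /set_mem[Ai _]; exact: disjA Aa Ai.
Qed.

(** A tuple [x :: q] of distinct points is a tuple [q] together with some [x] outside it; the number
    of choices of [x] is the same for all [q], so the sum factors. *)
Lemma fact_measure_label_rect (s : seq I) k : size s = k ->
  fact_measure p (label_rect s k) = (arrangements s)%:R%:E.
Proof.
elim: s k => [|i s IH] [|k] //=.
  move=> _; have -> : label_rect [::] 0 = [set [tuple]].
    by apply/seteqP; split=> [q _|q _ []//]; exact: tuple0.
  rewrite /fact_measure (_ : _ `&` _ = [set [tuple]]) ?esum_set1 //.
  by apply/seteqP; split=> [q [] //|q ->]; split=> //; split=> // -[].
move=> [sk]; rewrite /fact_measure.
pose J (q : k.-tuple T) := A i `&` p `&` [set x | x \notin q].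
pose e (u : k.-tuple T * T) : k.+1.-tuple T := [tuple of u.2 :: u.1].
rewrite (@reindex_esum _ _ _ ((label_rect s k `&` distinct_tuples p k) `*`` J) _ e).
  rewrite -(@esum_esum _ _ _ _ J (fun _ _ => 1%E)); last by move=> *; exact: lee01.
  under eq_esum => q [qs pq] do rewrite (card_avoiding i sk qs pq).
  by rewrite esum_scale [esum _ _](IH _ sk) -EFinM -natrM.
split.
- move=> [q x] /= [[qs [uq pq]] [[Ax px] xq]]; split.
    by move=> a; case: (unliftP ord0 a) => [b ->|->]; rewrite ?tnthS ?tnth0 //; exact: qs.
  split=> [|a]; first by rewrite /= xq.
  by case: (unliftP ord0 a) => [b ->|->]; rewrite ?tnthS ?tnth0.
- by move=> [q x] [q' x'] _ _ [-> /val_inj ->].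
- move=> q [qs [uq pq]]; case/tupleP: q qs uq pq => x q qs uq pq.
  exists (q, x) => //=; move: uq => /= /andP[xq uq].
  split; [split|split].
  + by move=> a; have := qs (lift ord0 a); rewrite tnthS.
  + by split=> // a; have := pq (lift ord0 a); rewrite tnthS.
  + by split; [exact: (qs ord0)|exact: (pq ord0)].
  + by [].
Qed.

Lemma arrangements_flatten (l : I -> nat) (s : seq I) : uniq s ->
  arrangements (flatten [seq nseq (l i) i | i <- s]) =
  (\prod_(i <- s) (card_in p (A i)) ^_ (l i))%N.
Proof.
elim: s => [|i s IH] /=; first by rewrite big_nil.
move=> /andP[si us]; rewrite big_cons -IH //; set t := flatten _.
have ti : i \notin t.
  apply: contra si => /flattenP[_ /mapP[j js ->]].
  by rewrite mem_nseq => /andP[_ /eqP ->].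
elim: (l i) => [|n IHn] /=; first by rewrite mul1n.
(* In front of [n] labels [i] followed by [t], which has none, the new factor is
   [card_in p (A i) - n]: the last factor of the falling factorial of order [n.+1]. *)
rewrite IHn count_cat count_nseq /= eqxx mul1n (count_memPn ti) addn0.
by rewrite ffactnSr mulnA [(_ * _ ^_ n)%N]mulnC.
Qed.

End Labels.

(** The measure of a product does not factor in general, since the two blocks may share a point; the
    first hypothesis excludes this. *)
Lemma fact_measure_cat p k m (S : set (k.-tuple T)) (D : set (m.-tuple T)) a :
  (forall y x, S y -> D x -> uniq y -> uniq x -> uniq (y ++ x)) ->
  fact_measure p S = a%:R%:E ->
  fact_measure p [set q : (k + m).-tuple T | exists y x,
    [/\ S y, D x & q = cat_tuple y x]] = (a%:R%:E * fact_measure p D)%E.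
Proof.
move=> SD pS; rewrite /fact_measure.
pose e (u : m.-tuple T * k.-tuple T) := cat_tuple u.2 u.1.
rewrite (@reindex_esum _ _ _ ((D `&` distinct_tuples p m) `*``
  (fun=> S `&` distinct_tuples p k)) _ e).
  rewrite -(@esum_esum _ _ _ _ (fun=> _) (fun _ _ => 1%E)); last by move=> *; exact: lee01.
  under eq_esum => q _ do rewrite [esum _ _]pS.
  exact: esum_scale.
split.
- move=> [x y] /= [[Dx [ux px]] [Sy [uy py]]]; split; first by exists y, x.
  split=> [|i]; first exact: SD.
  by case: (split_ordP i) => j ->; rewrite ?tnth_lshift ?tnth_rshift.
- move=> [x y] [x' y'] _ _ /(congr1 val) /= /eqP; rewrite eqseq_cat ?size_tuple //.
  by move=> /andP[/eqP/val_inj -> /eqP/val_inj ->].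
- move=> q [[y [x [Sy Dx ->]]] [u pq]]; exists (x, y) => //=.
  move: u; rewrite /= cat_uniq => /and3P[uy _ ux].
  split; split=> //; split=> // i.
    by have := pq (rshift _ i); rewrite tnth_rshift.
  by have := pq (lshift _ i); rewrite tnth_lshift.
Qed.

End FactorialMeasure.

(** * Configurations in a proper metric space *)

Section ProperSpace.
Context (R : realType) (E : pmetricType R).
Hypothesis hE : proper_space E.

Lemma mdist_continuous (c : E) : continuous (mdist c : E -> R).
Proof.
move=> x; apply/cvgrPdist_lt => e e0; near=> y.
have xy : mdist x y < e.
  have : ball x e y by near: y; exact: nbhsx_ballx.
  by rewrite ballEmdist.
have h1 := metric_triangle c x y; have h2 := metric_triangle c y x.
rewrite (metric_sym y x) in h2.
by rewrite ltr_norml; apply/andP; split; lra.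
Unshelve. all: by end_near. Qed.

Lemma ball_open_metric (c : E) (r : R) : open (ball c r).
Proof.
have -> : ball c r = mdist c @^-1` [set t | t < r].
  by rewrite ballEmdist.
by apply: open_comp => [x _|]; [exact: mdist_continuous|exact: open_lt].
Qed.

Lemma ball_mbounded (c : E) (r : R) : mbounded (ball c r).
Proof.
exists (r + r) => x y; rewrite !ballEmdist /= => cx cy.
have := metric_triangle x c y; rewrite (metric_sym x c); lra.
Qed.

Lemma mbounded_sub (A B : set E) : A `<=` B -> mbounded B -> mbounded A.
Proof. by move=> AB [M hM]; exists M => x y /AB Bx /AB By; exact: hM. Qed.

Lemma ball_measurable (c : E) (r : R) : measurable (ball c r : set (borel E)).
Proof. by apply: sub_sigma_algebra; exact: ball_open_metric. Qed.

Definition exhaustion n : set (borel E) := ball (point : E) n.+1%:R.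

Lemma exhaustion_measurable n : measurable (exhaustion n).
Proof. exact: ball_measurable. Qed.

Lemma exhaustion_mbounded n : mbounded (exhaustion n : set E).
Proof. exact: ball_mbounded. Qed.

Lemma exhaustion_mono n m : (n <= m)%N -> exhaustion n `<=` exhaustion m.
Proof. by move=> nm; apply: le_ball; rewrite ler_nat ltnS. Qed.

Lemma exhaustion_mboundedP (A : set E) : mbounded A -> exists n, A `<=` exhaustion n.
Proof.
move=> [M hM]; have [[a Aa]|no] := pselect (A !=set0); last first.
  by exists 0 => x Ax; case: no; exists x.
exists (Num.truncn (mdist (point : E) a + Num.max M 0)) => x Ax.
rewrite /exhaustion ballEmdist /=.
have h := metric_triangle (point : E) a x; have h' := hM _ _ Aa Ax.
apply: le_lt_trans h _; apply: le_lt_trans (truncnS_gt _).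
by rewrite lerD2l le_max h'.
Qed.

Lemma exhaustion_cover x : exists n, exhaustion n x.
Proof.
have [n h] := @exhaustion_mboundedP [set x] ltac:(by exists 0 => ? ? -> ->; rewrite mdistxx).
by exists n; exact: h.
Qed.

Lemma countable_ball_basis : exists V : (set E)^nat,
  (forall n, open (V n)) /\
  (forall n, exists c r, V n = ball c r) /\
  forall (U : set E) x, open U -> U x -> exists n, V n x /\ V n `<=` U.
Proof.
have [_ _ [[D cD dD] _] _] := hE.
have /countable_injP[f fI] := cD.
pose d n := xget (point : E) [set x | D x /\ f x = n].
have dE x : D x -> d (f x) = x.
  move=> Dx; rewrite /d; case: xgetP => [y -> [Dy /fI]|/(_ x)]; last by case.
  by apply; rewrite inE.
(* Integers that code no pair decode to [(0, 0)], so that every index still yields a ball. *)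
pose dec (n : nat) : nat * nat := odflt (0, 0)%N (@choice.unpickle _ n).
exists (fun n => ball (d (dec n).1) ((dec n).2.+1%:R^-1)); split; [|split].
- by move=> n; exact: ball_open_metric.
- by move=> n; exists (d (dec n).1), ((dec n).2.+1%:R^-1).
move=> U x oU Ux; have /nbhs_ballP[e /= e0 xeU] : nbhs x U by exact: open_nbhs_nbhs.
(* Then [j.+1] exceeds [2 / e], that is [s < e / 2]: a ball of radius [s] about a point within [s]
   of [x] stays within [e] of [x]. *)
pose j := Num.truncn (2 / e); pose s : R := j.+1%:R^-1.
have s0 : 0 < s by rewrite invr_gt0.
have se : s < e / 2.
  rewrite /s -[e / 2]invrK ltf_pV2 ?posrE ?invr_gt0 ?divr_gt0 //.
  by rewrite invf_div; exact: truncnS_gt.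
have [y [xy Dy]] : (ball x s `&` D) !=set0.
  by apply: dD; [exists x; exact: ballxx|exact: ball_open_metric].
exists (choice.pickle (f y, j)); rewrite /dec choice.pickleK /= dE // -/s; split.
  exact: ball_sym.
move=> z yz; apply: xeU; move: xy yz; rewrite !ballEmdist /= => xy yz.
have := metric_triangle x y z; lra.
Qed.

Lemma borel_countable_basis : exists V : (set (borel E))^nat,
  [/\ forall n, measurable (V n), forall n, exists c r, V n = ball (c : E) r,
   (@measurable _ (borel E)) = <<s range V >> &
   forall x y, (forall n, V n x <-> V n y) -> x = y].
Proof.
have [V [oV [bV hV]]] := countable_ball_basis; exists V; split.
- by move=> n; apply: sub_sigma_algebra; exact: oV.
- by [].
- apply/seteqP; split; last first.
    apply: smallest_sub; first exact: smallest_sigma_algebra.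
    by move=> _ [n _ <-]; apply: sub_sigma_algebra; exact: oV.
  apply: smallest_sub; first exact: smallest_sigma_algebra.
  move=> U oU; have -> : U = \bigcup_(n in [set n | V n `<=` U]) V n.
    apply/seteqP; split=> [x Ux|x [n /= h Vx]]; last exact: h.
    by have [n [Vx VU]] := hV U x oU Ux; exists n.
  apply: (@bigcup_measurable _ (g_sigma_algebraType (range V))) => n _.
  by apply: sub_sigma_algebra; exists n.
- move=> x y h; apply/eqP; rewrite -[_ == _]negbK -(@mdist_gt0 _ E); apply/negP => xy.
  have bx : ball (x : E) (mdist (x : E) y) x by exact: ballxx.
  have [n [Vx VU]] := hV _ _ (ball_open_metric _ _) bx.
  by have := VU _ (iffLR (h n) Vx); rewrite ballEmdist /= ltxx.
Qed.

(* Tends to the indicator of the ball [ball c r] as [n] grows. *)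
Definition bump (n : nat) (c : E) (r : R) (x : E) : R :=
  let h := n%:R * (r - mdist c x + `|r - mdist c x|) in
  (1 + h - `|1 - h|) / 2.

Lemma bump_continuous n c r : continuous (bump n c r).
Proof.
move=> x; rewrite /bump.
have cr : (fun y => r - mdist c y) @ x --> r - mdist c x.
  by apply: cvgB; [exact: cvg_cst|exact: mdist_continuous].
have ch : (fun y => n%:R * (r - mdist c y + `|r - mdist c y|)) @ x -->
    n%:R * (r - mdist c x + `|r - mdist c x|).
  by apply: cvgM; [exact: cvg_cst|apply: cvgD => //; exact: cvg_norm].
apply: cvgM; last exact: cvg_cst.
apply: cvgB; first by apply: cvgD => //; exact: cvg_cst.
by apply: cvg_norm; apply: cvgB => //; exact: cvg_cst.
Qed.

Lemma bump_out n c r x : ~ ball c r x -> bump n c r x = 0.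
Proof.
rewrite ballEmdist /= => /negP; rewrite -leNgt => rd; rewrite /bump.
rewrite ler0_norm ?subr_le0 // subrr mulr0 subr0 normr1 addr0 subrr mul0r.
by [].
Qed.

Lemma bump_in c r x : ball c r x -> \forall n \near \oo, bump n c r x = 1.
Proof.
rewrite ballEmdist /= => rd; have t0 : 0 < r - mdist c x by rewrite subr_gt0.
near=> n; rewrite /bump gtr0_norm //; set t := r - _ in t0 *.
(* [bump] is the minimum of 1 and [h], with [h] equal to [n] times [t + t] when [t] is positive. *)
have h1 : 1 <= n%:R * (t + t).
  have tt0 : 0 < t + t by rewrite addr_gt0.
  rewrite -ler_pdivrMr //; apply: ltW.
  apply: lt_le_trans (truncnS_gt _) _; rewrite ler_nat.
  by near: n; exact: nbhs_infty_ge.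
by rewrite ler0_norm ?subr_le0 //; field.
Unshelve. all: by end_near. Qed.

Definition bumps n (s : seq (E * R)) (x : E) : R := \prod_(b <- s) bump n b.1 b.2 x.

(** Finite intersections of balls form a pi-system generating the Borel sets. A nonempty list gives
    a bounded set, so that the corresponding [bumps] have compact support. *)
Definition ball_inter (s : seq (E * R)) : set E :=
  [set x | forall b, b \in s -> ball b.1 b.2 x].

Lemma bumps_continuous n s : continuous (bumps n s).
Proof.
move=> x; elim: s => [|b s IH].
  have -> : bumps n [::] = cst 1 by apply/funext => y; rewrite /bumps big_nil.
  exact: cvg_cst.
have -> : bumps n (b :: s) = fun y => bump n b.1 b.2 y * bumps n s y.
  by apply/funext => y; rewrite /bumps big_cons.
by apply: cvgM => //; exact: bump_continuous.
Qed.

Lemma bumps_out n s x : ~ ball_inter s x -> bumps n s x = 0.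
Proof.
move=> h; have /existsNP[b /not_implyP[bs nb]] := h.
apply/eqP; rewrite prodf_seq_eq0; apply/hasP; exists b => //=.
by rewrite bump_out.
Qed.

Lemma bumps_in s x : ball_inter s x -> \forall n \near \oo, bumps n s x = 1.
Proof.
rewrite /bumps; elim: s => [|b s IH] h; first by near=> n; rewrite big_nil.
have h1 := bump_in (h b (mem_head _ _)).
have h2 : \forall n \near \oo, \prod_(b <- s) bump n b.1 b.2 x = 1.
  by apply: IH => b' bs; apply: h; rewrite inE bs orbT.
by apply: filterS2 h1 h2 => n e1 e2; rewrite big_cons e1 e2 mulr1.
Unshelve. all: by end_near. Qed.

Lemma ball_inter_mbounded b s : mbounded (ball_inter (b :: s)).
Proof.
apply: mbounded_sub (ball_mbounded b.1 b.2) => x; apply; exact: mem_head.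
Qed.

Lemma bumps_compact n b s : compactly_supported (bumps n (b :: s)).
Proof.
have [_ _ _ hb] := hE; rewrite /compactly_supported -precompactE.
apply: hb; apply: mbounded_sub (@ball_inter_mbounded b s) => x /= /eqP h.
by apply: contrapT => nb; apply: h; exact: bumps_out.
Qed.

Lemma conf_sum_measurable (f : E -> R) : continuous f -> compactly_supported f ->
  measurable_fun [set: borel (conf E)] (conf_sum f : borel (conf E) -> R).
Proof.
move=> cf sf; apply: (measurability _ (RGenOpens.measurableE R)).
move=> _ [_ [a [b ->]] <-]; rewrite setTI; apply: sub_sigma_algebra.
set A := _ @^-1` _.
exists [set A]; last by rewrite bigcup_set1.
move=> _ ->; apply: (finI_from1 (i := (f, `]a, b[%classic : set R))
  (fun fV : (E -> R) * set R => conf_sum fV.1 @^-1` fV.2)).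
by split=> //; exact: interval_open.
Qed.

(** Sums of the continuous functions [bumps] are vaguely continuous. A configuration has finitely
    many points in the set, on all of which [bumps] is 1 for large [n], so the sums are eventually
    equal to the count. *)
Lemma count_in_ball_inter b s :
  measurable_fun [set: borel (conf E)]
    (fun X : borel (conf E) => (count_in (ball_inter (b :: s)) X)%:R : R).
Proof.
apply: (@measurable_fun_cvg _ (borel (conf E)) R setT
  (fun n X => conf_sum (bumps n (b :: s)) X)).
  move=> n; apply: conf_sum_measurable; first exact: bumps_continuous.
  exact: bumps_compact.
move=> X _.
set A := ball_inter (b :: s).
have finA := mult_locfin X (@ball_inter_mbounded b s); rewrite -/A in finA.
pose F := fset_set (A `&` [set x | X x != 0%N]).
have h : \forall n \near \oo, forall x, x \in F -> bumps n (b :: s) x = 1.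
  apply: (@filter_bigI _ _ F (fun x => [set n | bumps n (b :: s) x = 1])) => x.
  by rewrite in_fset_set // inE => -[Ax _]; exact: bumps_in.
apply: cvg_near_cst; apply: filterS h => n h.
have -> : count_in A X = (\sum_(x \in A `&` [set x | X x != 0%N]) X x)%N.
  apply/esym/fsbig_widen => [x []//|x [/= Ax]].
  by move=> /not_andP[//|/negP/negPn/eqP].
have -> : conf_sum (bumps n (b :: s)) X =
    \sum_(x \in A `&` [set x | X x != 0%N]) (bumps n (b :: s) x *+ X x).
  apply/esym/fsbig_widen => // x [_ /not_andP[nA|/negP/negPn/eqP /= e]] /=.
    by rewrite bumps_out ?mul0rn.
  by rewrite e.
rewrite !fsbig_finite // natr_sum !big_seq; apply: eq_bigr => x xF.
by rewrite h.
Qed.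

End ProperSpace.
Arguments exhaustion {R} E n.

(** * Measurability of the counts *)

Section Counting.
Context (R : realType) (E : pmetricType R).
Hypothesis hE : proper_space E.

Definition support (X : conf E) : set (borel E) := [set x | X x != 0%N].

Definition simple_conf (X : conf E) := forall x, (X x <= 1)%N.

Lemma count_in_esum (X : conf E) (A : set E) : mbounded A ->
  \esum_(x in A) ((X x)%:R%:E : \bar R) = (count_in A X)%:R%:E.
Proof.
move=> bA; have finA := mult_locfin X bA.
transitivity (\esum_(x in A `&` [set x | X x != 0%N]) ((X x)%:R%:E : \bar R)).
  rewrite [RHS]esum_mkcondr; apply: eq_esum => x Ax.
  case: ifPn => //; rewrite notin_setE => /negP/negPn/eqP ->.
  by [].
rewrite esum_fset; [|exact: finA|by move=> i _; rewrite lee_fin ler0n].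
have -> : count_in A X = (\sum_(x \in A `&` [set x | X x != 0%N]) X x)%N.
  apply/esym/fsbig_widen => [x []//|x [/= Ax]].
  by move=> /not_andP[//|/negP/negPn/eqP].
by rewrite !fsbig_finite // sumEFin natr_sum.
Qed.

Lemma count_in_le (X : conf E) (A B : set E) :
  mbounded B -> A `<=` B -> (count_in A X <= count_in B X)%N.
Proof.
move=> bB AB; rewrite -(ler_nat R) -lee_fin -!count_in_esum //; last exact: mbounded_sub bB.
rewrite (esumID A B); last by move=> * /=; rewrite lee_fin ler0n.
rewrite (_ : B `&` A = A); last by apply/setIidPr.
by rewrite leeDl // esum_ge0 // => *; rewrite lee_fin ler0n.
Qed.

Lemma count_in_point (X : conf E) (A : set E) x :
  mbounded A -> A x -> (X x <= count_in A X)%N.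
Proof.
move=> bA Ax; apply: leq_trans (count_in_le _ (A := [set x]) bA _); last by move=> _ ->.
rewrite -(ler_nat R) -lee_fin -count_in_esum; last by apply: mbounded_sub bA => _ ->.
by rewrite esum_set1 // lee_fin ler0n.
Qed.

Lemma count_in_card (X : conf E) (A : set E) : mbounded A -> simple_conf X ->
  count_in A X = card_in (support X) A.
Proof.
move=> bA sX; have finA := mult_locfin X bA; apply/eqP.
rewrite -(eqr_nat R) -eqe -count_in_esum //; apply/eqP.
transitivity (\esum_(x in A `&` support X) (1%E : \bar R)).
  rewrite [RHS]esum_mkcondr; apply: eq_esum => x Ax.
  case: ifPn; first by rewrite inE /support /=; have := sX x; case: (X x) => [|[|]].
  by rewrite notin_setE => /negP/negPn/eqP ->.
rewrite /card_in -(esum_card R (fset_uniq (fset_set (A `&` support X)))).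
by congr esum; apply/seteqP; split=> x /=; rewrite in_fset_set // inE.
Qed.

Lemma count_in_conf_add (X : conf E) k (q : k.-tuple E) (A : set E) : mbounded A ->
  count_in A (conf_add X q) = (count_in A X + \sum_(i < k) (tnth q i \in A))%N.
Proof.
move=> bA; apply/eqP; rewrite -(eqr_nat R) -eqe natrD EFinD -!count_in_esum //.
apply/eqP => /=.
under eq_esum => x _ do rewrite natrD EFinD.
rewrite esumD; [|by move=> * /=; rewrite lee_fin ler0n..].
congr (_ + _)%E.
transitivity (\esum_(x in A) (\sum_(i < k) (x == tnth q i)%:R%:E : \bar R)%E).
  apply: eq_esum => x _; rewrite sumEFin -natr_sum; congr (_%:R%:E).
  rewrite -sum1_count big_tuple big_mkcond.
  by apply: eq_bigr => i _; rewrite /= eq_sym; case: eqP.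
rewrite esum_sum; last by move=> * /=; rewrite lee_fin ler0n.
rewrite natr_sum -sumEFin; apply: eq_bigr => i _.
case: (boolP (tnth q i \in A)) => [/set_mem|/negP] qA; last first.
  by rewrite esum1 // => x Ax; case: eqP => // e; case: qA; rewrite -e inE.
transitivity (\esum_(x in A) if x \in [set tnth q i] then (1%E : \bar R) else 0%E).
  by apply: eq_esum => x _; rewrite in_set1; case: eqP.
rewrite -esum_mkcondr (_ : A `&` _ = [set tnth q i]) ?esum_set1 //.
by apply/seteqP; split=> [x []//|_ ->].
Qed.

Lemma count_in_measurable (A : set (borel E)) : measurable A -> mbounded (A : set E) ->
  measurable_fun [set: borel (conf E)]
    (fun X : borel (conf E) => (count_in A X)%:R%:E : \bar R).
Proof.
move=> mA bA.
(* A Dynkin class contains the whole space and complements, where counts may be infinite; truncating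
   by balls keeps every count finite. *)
suff : forall n, measurable_fun [set: borel (conf E)]
    (fun X : borel (conf E) => (count_in (A `&` exhaustion E n) X)%:R%:E : \bar R).
  have [n An] := exhaustion_mboundedP bA.
  by move/(_ n); rewrite (setIidl An).
move=> {bA}.
have bI (B : set (borel E)) n : mbounded (B `&` exhaustion E n : set E).
  apply: mbounded_sub (@exhaustion_mbounded R E n); exact: subIsetr.
pose G : set (set (borel E)) := [set ball_inter s | s in [set: seq (E * R)]].
pose D : set (set (borel E)) := [set A | forall n, measurable_fun [set: borel (conf E)]
    (fun X : borel (conf E) => (count_in (A `&` exhaustion E n) X)%:R%:E : \bar R)].
have GI : setI_closed G.
  move=> _ _ [s _ <-] [t _ <-]; exists (s ++ t) => //.
  apply/seteqP; split=> [x h|x [h1 h2] b].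
    by split=> b bs; apply: h; rewrite mem_cat bs ?orbT.
  by rewrite mem_cat => /orP[]; [exact: h1|exact: h2].
have GD s : D (ball_inter s).
  move=> n; have := count_in_ball_inter hE (point, n.+1%:R) s.
  rewrite (_ : ball_inter (_ :: s) = ball_inter s `&` exhaustion E n); last first.
    apply/seteqP; split=> [x h|x [h1 h2] b].
      by split; [move=> b bs; apply: h; rewrite inE bs orbT|exact: h (mem_head _ _)].
    by rewrite inE => /orP[/eqP ->|]; [exact: h2|exact: h1].
  by move=> h; apply/measurable_EFinP.
have dD : dynkin D.
  split.
  - have := GD [::]; rewrite (_ : ball_inter _ = setT) //.
    by apply/seteqP.
  - move=> B DB n.
    have := GD [::] n; rewrite (_ : ball_inter _ = setT); last exact/seteqP.
    rewrite setTI => DT; have {}DB := DB n.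
    rewrite (_ : (fun X => _) = (fun X : borel (conf E) =>
      (count_in (exhaustion E n) X)%:R%:E - (count_in (B `&` exhaustion E n) X)%:R%:E)%E).
      exact: emeasurable_funB.
    apply/funext => X; rewrite -!count_in_esum //; last exact: exhaustion_mbounded.
    rewrite [X in (X - _)%E](esumID B); last by move=> * /=; rewrite lee_fin ler0n.
    rewrite [exhaustion E n `&` B]setIC [exhaustion E n `&` ~` B]setIC.
    rewrite (@count_in_esum X (B `&` exhaustion E n)) //.
    by rewrite addeAC subee ?add0e.
  - move=> F tF DF n.
    rewrite (_ : (fun X => _) = (fun X : borel (conf E) =>
      (\sum_(0 <= k <oo) (count_in (F k `&` exhaustion E n) X)%:R%:E)%E)).
      apply: ge0_emeasurable_sum => [k X _ _|k _]; first by rewrite lee_fin ler0n.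
      exact: DF.
    apply/funext => X; rewrite -count_in_esum // setI_bigcupl.
    rewrite nneseries_sum_bigcup; first by apply: eq_eseriesr => k _; rewrite count_in_esum.
      apply/trivIsetP => i j _ _ ij.
      by rewrite setIACA (iffLR trivIsetP tF) // set0I.
    by move=> x; rewrite lee_fin ler0n.
have [V [_ bV gV _]] := borel_countable_basis hE.
suff : measurable `<=` D by apply.
rewrite gV.
apply: (@subset_trans _ <<s G >>).
  apply: smallest_sub; first exact: smallest_sigma_algebra.
  move=> _ [n _ <-]; have [c [r ->]] := bV n; apply: sub_sigma_algebra.
  exists [:: (c, r)] => //; apply/seteqP; split=> [x h|x h b].
    by apply: (h (c, r)); exact: mem_head.
  by rewrite inE => /eqP ->.
rewrite -setI_closed_g_dynkin_g_sigma_algebra //.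
by apply: smallest_sub => // _ [s _ <-].
Qed.

Lemma count_in_measurableR (A : set (borel E)) : measurable A -> mbounded (A : set E) ->
  measurable_fun [set: borel (conf E)]
    (fun X : borel (conf E) => (count_in A X)%:R : R).
Proof. by move=> mA bA; apply/measurable_EFinP; exact: count_in_measurable. Qed.

End Counting.

Section PhiMeasure.
Context (R : realType) d (T : measurableType d) (p : set T) (k : nat).

Lemma fact_measure_sigma_additive :
  semi_sigma_additive (@fact_measure R T p k : set (k.-tuple T) -> \bar R).
Proof.
move=> F mF tF mUF; rewrite fact_measure_bigcup //.
by apply: is_cvg_ereal_nneg_natsum => n _; exact: fact_measure_ge0.
Qed.

HB.instance Definition _ := isMeasure.Build _ (k.-tuple T) R (@fact_measure R T p k)
  (@fact_measure0 R T p k) (@fact_measure_ge0 R T p k) fact_measure_sigma_additive.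

End PhiMeasure.

Section Density.
Context (R : realType) d (T : measurableType d) (mu : {measure set T -> \bar R}).
Variable rho : T -> R.
Hypothesis mrho : measurable_fun setT rho.
Hypothesis rho0 : forall x, 0 <= rho x.

Definition density_measure of measurable_fun setT rho & (forall x, 0 <= rho x) :=
  fun S : set T => (\int[mu]_(x in S) (rho x)%:E)%E.

Let dens := density_measure mrho rho0.

Let dens0 : dens set0 = 0%E.
Proof. by rewrite /dens /density_measure integral_set0. Qed.

Let dens_ge0 S : (0 <= dens S)%E.
Proof. by apply: integral_ge0 => x _; rewrite lee_fin. Qed.

Let dens_sigma_additive : semi_sigma_additive dens.
Proof.
move=> F mF tF mUF; rewrite /dens /density_measure ge0_integral_bigcup //.
- by apply: is_cvg_ereal_nneg_natsum => n _; exact: dens_ge0.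
- by apply/measurable_EFinP; apply: measurable_funS mrho.
- by move=> x _; rewrite lee_fin.
Qed.

HB.instance Definition _ := isMeasure.Build _ _ _ dens
  dens0 dens_ge0 dens_sigma_additive.

End Density.

(** * Simple configurations and measurability of their factorial measures *)

Section Simple.
Context (R : realType) (E : pmetricType R).
Hypothesis hE : proper_space E.
Local Notation T := (borel E).
Variable V : (set T)^nat.
Hypothesis mV : forall n, measurable (V n).
Hypothesis genV : (@measurable _ T) = <<s range V >>.
Hypothesis sepV : forall x y, (forall n, V n x <-> V n y) -> x = y.

Local Notation cell := (cell V).
Local Notation code := (code V).
Local Notation codes := (codes V).
Local Notation level := (level V).
Local Notation B_ := (exhaustion E).

Lemma sub_exhaustion_mbounded (A : set T) n : mbounded (A `&` B_ n : set E).
Proof.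
by apply: mbounded_sub (@exhaustion_mbounded R E n); exact: subIsetr.
Qed.

(** The finitely many points in a ball lie in different cells at some depth. This writes simplicity
    with countably many counts, hence its measurability. *)
Lemma simple_confP (X : conf E) : simple_conf X <->
  forall n, exists N, forall c : N.-tuple bool,
    (count_in (cell c `&` B_ n) X <= 1)%N.
Proof.
split=> [sX n|h x]; last first.
  have [n Bx] := exhaustion_cover (x : E); have [N hN] := h n.
  apply: leq_trans (hN (code N x)).
  by apply: count_in_point; [exact: sub_exhaustion_mbounded|split].
have finB := mult_locfin X (@exhaustion_mbounded R E n).
set F := fset_set (B_ n `&` support X).
have [N hN] := separated_limit sepV (z := [tuple] : 0.-tuple T)
  (q := in_tuple (enum_fset F)) ltac:(by rewrite cats0 fset_uniq).
exists N => c; rewrite count_in_card //; last exact: sub_exhaustion_mbounded.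
rewrite /card_in.
have fC : finite_set (cell c `&` B_ n `&` support X).
  by apply: sub_finite_set finB => x [[_ Bx] sx].
have us := fset_uniq (fset_set (cell c `&` B_ n `&` support X)).
have sub x : x \in enum_fset (fset_set (cell c `&` B_ n `&` support X)) ->
    x \in enum_fset F /\ code N x = c.
  by rewrite !in_fset_set // !inE => -[[cx Bx] sx].
move: us sub; case: (enum_fset _) => [|x [|y s]] //= /andP[+ _] sub.
rewrite inE negb_or => /andP[/eqP xy _]; exfalso; apply: xy.
have [xF cx] := sub x (mem_head _ _).
have [yF cy] : y \in enum_fset F /\ code N y = c by apply: sub; rewrite !inE eqxx orbT.
move: hN; rewrite /separated /= cats0 => /(uniqP c) u.
rewrite -(nth_index x xF) -(nth_index x yF); congr nth.
by apply: u; rewrite ?inE ?size_map ?index_mem // !(nth_map x) ?index_mem // !nth_index // cx cy.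
Qed.

Definition simple_set : set (borel (conf E)) := [set X | simple_conf X].

Lemma measurable_count_le (A : set T) : measurable A -> mbounded (A : set E) ->
  measurable [set X : borel (conf E) | (count_in A X <= 1)%N].
Proof.
move=> mA bA.
have -> : [set X : borel (conf E) | (count_in A X <= 1)%N] =
    [set: borel (conf E)] `&` (fun X => (count_in A X)%:R : R) @^-1` `]-oo, 1]%classic.
  by rewrite setTI; apply/seteqP; split=> X /=; rewrite in_itv /= -(ler_nat R).
by apply: count_in_measurableR => //; exact: measurable_itv.
Qed.

Lemma measurable_simple_set : measurable simple_set.
Proof.
have -> : simple_set = \bigcap_n \bigcup_N \bigcap_(c in [set: N.-tuple bool])
    [set X : borel (conf E) | (count_in (cell c `&` B_ n) X <= 1)%N].
  apply/seteqP; split=> [X /simple_confP h n _|X h].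
    by have [N hN] := h n; exists N => // c _; exact: hN.
  by apply/simple_confP => n; have [N _ hN] := h n Logic.I; exists N => c; exact: hN.
apply: bigcap_measurable; first by exists 0.
move=> n _; apply: bigcup_measurable => N _.
apply: fin_bigcap_measurable => [|c _]; first exact: finite_finset.
apply: measurable_count_le; last exact: sub_exhaustion_mbounded.
by apply: measurableI; [exact: measurable_cell|exact: exhaustion_measurable].
Qed.

Lemma measurable_simple_add k :
  measurable [set u : borel (conf E) * k.-tuple T | simple_conf (conf_add u.1 u.2)].
Proof.
have -> : [set u : borel (conf E) * k.-tuple T | simple_conf (conf_add u.1 u.2)] =
  \bigcap_n \bigcup_N \bigcap_(c in [set: N.-tuple bool])
    [set u : borel (conf E) * k.-tuple T |
      (count_in (cell c `&` B_ n) (conf_add u.1 u.2) <= 1)%N].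
  apply/seteqP; split=> [X /simple_confP h n _|X h].
    by have [N hN] := h n; exists N => // c _; exact: hN.
  by apply/simple_confP => n; have [N _ hN] := h n Logic.I; exists N => c; exact: hN.
apply: bigcap_measurable; first by exists 0.
move=> n _; apply: bigcup_measurable => N _.
apply: fin_bigcap_measurable => [|c _]; first exact: finite_finset.
set A := _ `&` _.
have mA : measurable A.
  by apply: measurableI; [exact: measurable_cell|exact: exhaustion_measurable].
have bA : mbounded (A : set E) by exact: sub_exhaustion_mbounded.
pose f (u : borel (conf E) * k.-tuple T) : R :=
  (count_in A u.1)%:R + \sum_(i < k) \1_A (tnth u.2 i).
have mf : measurable_fun setT f.
  apply: measurable_funD.
    exact: measurableT_comp (count_in_measurableR hE mA bA) measurable_fst.
  apply: measurable_sum => i.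
  exact: measurableT_comp (measurable_indic mA)
    (measurableT_comp (measurable_tnth i) measurable_snd).
have -> : [set u : borel (conf E) * k.-tuple T |
      (count_in A (conf_add u.1 u.2) <= 1)%N] = setT `&` f @^-1` `]-oo, 1]%classic.
  have fE u : f u = (count_in A (conf_add u.1 u.2))%:R.
    by rewrite count_in_conf_add // natrD [X in _ + X]natr_sum.
  by rewrite setTI; apply/seteqP; split=> u /=; rewrite in_itv /= fE -(ler_nat R).
by apply: mf => //; exact: measurable_itv.
Qed.

Lemma fact_measure_rect (X : conf E) j (A : 'I_j -> set T) (l : 'I_j -> nat) k :
  simple_conf X -> (forall i, mbounded (A i : set E)) -> trivIset setT A ->
  (\sum_(i < j) l i)%N = k ->
  fact_measure R (support X) (rect A l : set (k.-tuple T)) =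
  ((\prod_(i < j) (count_in (A i) X) ^_ (l i))%N%:R)%:E.
Proof.
move=> sX bA tA lk.
have finA i : finite_set (A i `&` support X) by exact: mult_locfin.
have dA i i' x : A i x -> A i' x -> i = i' by move=> Ax Ax'; apply: tA => //; exists x.
(* Labels are indices rather than sets: several of the sets may be empty, hence equal. *)
pose s := flatten [seq nseq (l i) i | i <- enum 'I_j].
have sE : flatten [seq nseq (l i) (A i) | i <- enum 'I_j] = map A s.
  rewrite map_flatten -map_comp; congr flatten; apply: eq_map => i /=.
  by rewrite map_nseq.
have ss : size s = k.
  rewrite -lk size_flatten /shape -map_comp sumnE big_map big_enum /=.
  by apply: eq_bigr => i _; rewrite size_nseq.
have -> : rect A l = @label_rect _ _ A s k by rewrite /rect /label_rect sE.
rewrite (fact_measure_label_rect R finA dA ss) arrangements_flatten ?enum_uniq // big_enum /=.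
by congr (_%:R%:E); apply: eq_bigr => i _; rewrite count_in_card.
Qed.

Lemma rect_pow (B : set T) k :
  rect (fun _ : 'I_1 => B) (fun=> k) = pow B :> set (k.-tuple T).
Proof.
rewrite /rect /pow (_ : flatten _ = nseq k B); last first.
  by rewrite enum_ordSl /= enum_ord0 /= cats0.
by apply/seteqP; split=> q h i; have := h i; rewrite nth_nseq ltn_ord.
Qed.

Lemma rect_level N k (w : k.-tuple (N.-tuple bool)) (B : set T) :
  rect (fun i => cell (tnth w i) `&` B) (fun=> 1%N) = level w `&` pow B.
Proof.
rewrite /rect (flatten_map1 (fun i => cell (tnth w i) `&` B)).
have nthE (i : 'I_k) : nth set0 [seq cell (tnth w i) `&` B | i <- enum 'I_k] i =
    cell (tnth w i) `&` B.
  by rewrite (nth_map i) ?size_enum_ord // nth_ord_enum.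
apply/seteqP; split=> [q h|q [/levelE h hB] i]; last by rewrite nthE.
by split; [apply/levelE => i|move=> i]; have := h i; rewrite nthE => -[].
Qed.

Lemma trivIset_cells N k (w : k.-tuple (N.-tuple bool)) (B : set T) :
  uniq w -> trivIset setT (fun i => cell (tnth w i) `&` B).
Proof.
move=> /tuple_uniqP wI i j _ _ [x [[ci _] [cj _]]].
by apply: wI; rewrite -ci -cj.
Qed.

Lemma fact_measure_level (X : conf E) N k (w : k.-tuple (N.-tuple bool)) (B : set T) :
  simple_conf X -> mbounded (B : set E) -> uniq w ->
  fact_measure R (support X) (level w `&` pow B) =
  ((\prod_(i < k) count_in (cell (tnth w i) `&` B) X)%N%:R)%:E.
Proof.
move=> sX bB uw; rewrite -rect_level fact_measure_rect //.
- by congr (_%:R%:E); apply: eq_bigr => i _; rewrite ffactn1.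
- by move=> i; apply: mbounded_sub bB; exact: subIsetr.
- exact: trivIset_cells.
- by rewrite sum1_card card_ord.
Qed.

Lemma fact_measure_pow (X : conf E) (B : set T) k : simple_conf X -> mbounded (B : set E) ->
  fact_measure R (support X) (pow B : set (k.-tuple T)) = ((count_in B X) ^_ k)%:R%:E.
Proof.
move=> sX bB; rewrite -rect_pow fact_measure_rect ?big_ord1 //.
by move=> i i' _ _ _; rewrite !ord1.
Qed.

(** On a level with distinct cells the factorial measure is a product of counts, and a Dynkin
    argument extends this. Truncation by [C n] makes the values finite, as complements require, and
    lets any level be cut into such levels; the truncation is then removed by a limit. *)
Lemma measurable_fact_measure k (S : set (k.-tuple T)) : measurable S ->
  measurable_fun simple_set (fun X : borel (conf E) => fact_measure R (support X) S).
Proof.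
have msim := measurable_simple_set.
pose z : 0.-tuple T := [tuple].
pose C n : set (k.-tuple T) := pow (B_ n) `&` separated V n z.
have mC n : measurable (C n).
  apply: measurableI; last exact: measurable_separated.
  by apply: measurable_pow; exact: exhaustion_measurable.
have phiC (X : borel (conf E)) n (A : set (k.-tuple T)) : simple_set X ->
    fact_measure R (support X) (A `&` C n) \is a fin_num.
  move=> sX; rewrite ge0_fin_numE ?fact_measure_ge0 //.
  apply: (@le_lt_trans _ _ (fact_measure R (support X) (pow (B_ n) : set (k.-tuple T)))).
    by apply: le_fact_measure => q [_ []].
  by rewrite fact_measure_pow ?ltry //; exact: exhaustion_mbounded.
have step n A : measurable A ->
    measurable_fun simple_set (fun X : borel (conf E) => fact_measure R (support X) (A `&` C n)).
  pose D : set (set (k.-tuple T)) := [set A | measurable_fun simple_set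
    (fun X : borel (conf E) => fact_measure R (support X) (A `&` C n))].
  suff : measurable `<=` D by apply.
  have DL N (w : k.-tuple (N.-tuple bool)) : D (level w).
    rewrite /D /=.
    have mS : measurable (level w `&` C n).
      by apply: measurableI => //; exact: measurable_level.
    rewrite (_ : (fun X => _) = (fun X : borel (conf E) =>
      \sum_(v \in [set: k.-tuple ((maxn N n).-tuple bool)])
        fact_measure R (support X) (level w `&` C n `&` level v))%E); last first.
      by apply/funext => X; rewrite -(measure_levels mV).
    apply: emeasurable_fsum => [|v]; first exact: finite_finset.
    have [e|[u e]] := separated_level V z (B_ n) w v; rewrite e.
      rewrite (_ : (fun X => _) = cst 0%E); first exact: measurable_cst.
      by apply/funext => X; rewrite fact_measure0.
    have uv : uniq v by move: u; rewrite cat_uniq => /and3P[].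
    apply: (eq_measurable_fun (fun X : borel (conf E) =>
      ((\prod_(i < k) (count_in (cell (tnth v i) `&` B_ n) X)%:R)%R)%:E)).
      move=> X /set_mem sX; rewrite fact_measure_level ?natr_prod //.
      exact: exhaustion_mbounded.
    apply/measurable_EFinP; apply: measurable_funTS; apply: measurable_prod => i _.
    apply: count_in_measurableR => //; last exact: sub_exhaustion_mbounded.
    by apply: measurableI; [exact: measurable_cell|exact: exhaustion_measurable].
  apply: (level_dynkin genV) => //; split.
  - by have := DL _ [tuple of nseq k ([tuple] : 0.-tuple bool)]; rewrite level0.
  - move=> A' DA.
    have DT : D setT.
      by have := DL _ [tuple of nseq k ([tuple] : 0.-tuple bool)]; rewrite level0.
    apply: (eq_measurable_fun (fun X : borel (conf E) =>
      fact_measure R (support X) (setT `&` C n) - fact_measure R (support X) (A' `&` C n))%E).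
      move=> X /set_mem sX.
      rewrite (_ : setT `&` C n = (A' `&` C n) `|` (~` A' `&` C n)); last first.
        by rewrite -setIUl setUv.
      rewrite fact_measureU; last by rewrite setIACA setICr set0I.
      by rewrite addeAC subee ?add0e //; exact: phiC.
    exact: emeasurable_funB.
  - move=> F tF DF; rewrite /D /=.
    rewrite (_ : (fun X => _) = (fun X : borel (conf E) =>
      \sum_(0 <= j <oo) fact_measure R (support X) (F j `&` C n))%E).
      by apply: ge0_emeasurable_sum => [j X _ _|j _]; [exact: fact_measure_ge0|exact: DF].
    apply/funext => X; rewrite setI_bigcupl fact_measure_bigcup //.
    by apply/trivIsetP => i j _ _ ij; rewrite setIACA (iffLR trivIsetP tF) // set0I.
move=> mS.
apply: (emeasurable_fun_cvg (fun n (X : borel (conf E)) => fact_measure R (support X) (S `&` C n))).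
  by move=> n; exact: step.
move=> X sX.
have -> : fact_measure R (support X) S = fact_measure R (support X) (\bigcup_n (S `&` C n)).
  rewrite /fact_measure; congr esum; apply/seteqP; split=> q [Sq [u pq]]; split=> //; last first.
    by case: Sq => n _ [].
  have uq : uniq (q ++ z) by rewrite cats0.
  have [N hN] := separated_limit sepV uq.
  have /choice[f hf] : forall i : 'I_k, exists n, B_ n (tnth q i).
    by move=> i; exact: exhaustion_cover.
  exists (maxn N (\max_i f i)) => //; split=> //; split.
    move=> i; apply: exhaustion_mono (hf i).
    by apply: leq_trans (leq_maxr _ _); exact: leq_bigmax.
  by apply: separated_mono hN; exact: leq_maxl.
apply: nondecreasing_cvg_mu.
- by move=> n; exact: measurableI.
- by apply: bigcup_measurable => n _; exact: measurableI.
- move=> n m nm; apply/subsetPset => q [Sq [Bq sq]]; split=> //; split.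
    by move=> i; apply: exhaustion_mono (Bq i).
  exact: separated_mono sq.
Qed.

End Simple.

(** * Moment measures and correlation functions *)

Section MeanMeasure.
Context (R : realType) (E : pmetricType R).
Hypothesis hE : proper_space E.
Local Notation T := (borel E).
Local Notation B_ := (exhaustion E).
Local Notation simple := (@simple_set R E).

Lemma simple_set_measurable : measurable simple.
Proof.
by have [V [mV _ genV sepV]] := borel_countable_basis hE; exact: measurable_simple_set mV sepV.
Qed.

Lemma fact_measure_measurable k (S : set (k.-tuple T)) : measurable S ->
  measurable_fun simple (fun X : borel (conf E) => fact_measure R (support X) S).
Proof.
have [V [mV _ genV sepV]] := borel_countable_basis hE.
exact: measurable_fact_measure mV genV sepV _ _.
Qed.

Lemma measurable_fun_nat d (U : measurableType d) (f : U -> nat) (g : nat -> R) :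
  measurable_fun setT (fun x => (f x)%:R : R) -> measurable_fun setT (g \o f).
Proof.
move=> mf _ Y mY; rewrite setTI.
have -> : (g \o f) @^-1` Y = \bigcup_(n in [set n | Y (g n)])
    (setT `&` (fun x => (f x)%:R : R) @^-1` [set n%:R]).
  apply/seteqP; split=> [x h|x [n /= h [_ /eqP]]]; first by exists (f x).
  by rewrite eqr_nat => /eqP e; rewrite /= e.
by apply: bigcup_measurable => n _; apply: mf => //; exact: measurable_set1.
Qed.

Lemma ffact_count_measurable (A : set T) l : measurable A -> mbounded (A : set E) ->
  measurable_fun [set: borel (conf E)]
    (fun X : borel (conf E) => (count_in A X ^_ l)%:R : R).
Proof.
move=> mA bA.
exact: (measurable_fun_nat (fun n => (n ^_ l)%:R) (count_in_measurableR hE mA bA)).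
Qed.

Definition almost_simple (P : point_process E) := P (~` simple) = 0%E.

Section Process.
Variable P : point_process E.

Lemma integral_simple (f : borel (conf E) -> \bar R) : almost_simple P ->
  measurable_fun setT f -> (forall X, 0 <= f X)%E ->
  (\int[P]_X f X = \int[P]_(X in simple) f X)%E.
Proof.
move=> sP mf f0; rewrite (ge0_negligible_integral (N := ~` simple)) //.
- by rewrite setTD setCK.
- by apply: measurableC; exact: simple_set_measurable.
Qed.

Section Measure.
Variable k : nat.

(* The factorial moment measure only when [P] is almost surely simple: multiple
   points would require counting tuples with repetitions. *)
Definition moment_measure of proper_space E := fun S : set (k.-tuple T) =>
  (\int[P]_(X in simple) fact_measure R (support X) S)%E.

Let mm := moment_measure hE.

Let mm0 : mm set0 = 0%E.
Proof. by rewrite /mm /moment_measure integral0_eq // => X _; rewrite fact_measure0. Qed.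

Let mm_ge0 S : (0 <= mm S)%E.
Proof. by apply: integral_ge0 => X _; exact: fact_measure_ge0. Qed.

Let mm_sigma_additive : semi_sigma_additive mm.
Proof.
move=> F mF tF mUF; rewrite /mm /moment_measure.
under eq_integral => X _ do rewrite fact_measure_bigcup //.
rewrite integral_nneseries.
- by apply: is_cvg_ereal_nneg_natsum => n _; exact: mm_ge0.
- exact: simple_set_measurable.
- by move=> n; exact: fact_measure_measurable.
- by move=> n X _; exact: fact_measure_ge0.
Qed.

HB.instance Definition _ := isMeasure.Build _ _ _ mm mm0 mm_ge0 mm_sigma_additive.

Lemma moment_measure_uniq (S : set (k.-tuple T)) :
  moment_measure hE (S `&` [set q : k.-tuple T | uniq q]) = moment_measure hE S.
Proof.
apply: eq_integral => X _; rewrite /fact_measure; congr esum.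
by apply/seteqP; split=> q; [move=> [[Sq _] h]|move=> [Sq [u pq]]].
Qed.

End Measure.

Lemma moment_measure_rect k j (A : 'I_j -> set T) (l : 'I_j -> nat) :
  almost_simple P ->
  (forall i, measurable (A i)) -> (forall i, mbounded (A i : set E)) ->
  trivIset setT A -> (\sum_(i < j) l i)%N = k ->
  moment_measure hE (rect A l : set (k.-tuple T)) =
  (\int[P]_X ((\prod_(i < j) (count_in (A i) X) ^_ (l i))%N%:R)%:E)%E.
Proof.
move=> sP mA bA tA lk; rewrite integral_simple //.
- by apply: eq_integral => X /set_mem sX; rewrite fact_measure_rect.
- apply/measurable_EFinP; under eq_fun do rewrite natr_prod.
  by apply: measurable_prod => i _; exact: ffact_count_measurable.
Qed.

Variable mu : {sigma_finite_measure set T -> \bar R}.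

(** Cells give equality off the diagonals only. But the total masses of [pow (B_ n)] also agree, by
    the moment identity with a single set, and the moment measure has no mass on the diagonals;
    being finite on [pow (B_ n)], the density measure has none either. *)
Lemma moment_measure_correlation k (rho : k.+1.-tuple T -> R) :
  almost_simple P -> correlation_function mu P rho ->
  forall S, measurable S ->
    moment_measure hE S = (\int[power_measure mu k.+1]_(x in S) (rho x)%:E)%E.
Proof.
move=> sP [mrho rho0 frho mom] S mS.
have [V [mV _ genV sepV]] := borel_countable_basis hE.
pose m1 : {measure set (k.+1.-tuple T) -> \bar R} :=
  density_measure (power_measure mu k.+1) mrho rho0.
pose m2 : {measure set (k.+1.-tuple T) -> \bar R} := moment_measure hE.
pose z : 0.-tuple T := [tuple].
have mB n : measurable (B_ n) by exact: exhaustion_measurable.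
have bB n : mbounded (B_ n : set E) by exact: exhaustion_mbounded.
have fin n : (m1 (pow (B_ n)) < +oo)%E by exact: frho.
have mpow n : measurable (pow (B_ n) : set (k.+1.-tuple T)) by exact: measurable_pow.
have agree n N (w : k.+1.-tuple (N.-tuple bool)) : uniq (w ++ codes V N z) ->
    m1 (level V w `&` pow (B_ n)) = m2 (level V w `&` pow (B_ n)).
  rewrite cat_uniq => /and3P[uw _ _].
  have mA i : measurable (cell V (tnth w i) `&` B_ n).
    by apply: measurableI => //; exact: measurable_cell.
  have bA i : mbounded (cell V (tnth w i) `&` B_ n : set E).
    exact: sub_exhaustion_mbounded.
  have tA : trivIset setT (fun i => cell V (tnth w i) `&` B_ n) by exact: trivIset_cells.
  have l1 : (\sum_(i < k.+1) 1 = k.+1)%N by rewrite sum1_card card_ord.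
  rewrite -rect_level [LHS]mom // /m2 /= moment_measure_rect //.
pose uq : set (k.+1.-tuple T) := [set q | uniq (q ++ z)].
have muq : measurable uq by exact: measurable_uniq.
have uqE : uq = [set q : k.+1.-tuple T | uniq q].
  by apply/seteqP; split=> q; rewrite /uq /= cats0.
have key n A : measurable A ->
    m1 (A `&` (pow (B_ n) `&` uq)) = m2 (A `&` (pow (B_ n) `&` uq)).
  by move=> mA; apply: (separated_unique_uniq mV genV sepV (mB n) (fin n) (agree n)).
have m2uq (A : set (k.+1.-tuple T)) : m2 (A `&` uq) = m2 A.
  by rewrite uqE; exact: moment_measure_uniq.
have tot n : m2 (pow (B_ n)) = m1 (pow (B_ n)).
  rewrite -rect_pow [RHS]mom //=.
  - by rewrite moment_measure_rect ?big_ord1 // => i i' _ _ _; rewrite !ord1.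
  - by move=> i i' _ _ _; rewrite !ord1.
  - by rewrite big_ord1.
have diag n : m1 (pow (B_ n) `\` uq) = 0%E.
  have mfin : m1 (pow (B_ n)) \is a fin_num by rewrite ge0_fin_numE ?measure_ge0.
  rewrite (measureD (mpow n) muq (fin n)) [X in (_ - X)%E](_ : _ = m1 (pow (B_ n))).
    by rewrite subee.
  by have := key n setT measurableT; rewrite !setTI => k1; rewrite [LHS]k1 m2uq tot.
apply: (measure_exhaust (m1 := m2) (m2 := m1) mB) => //.
- exact: exhaustion_mono.
- exact: exhaustion_cover.
move=> n; have mSB : measurable (S `&` pow (B_ n)) by exact: measurableI.
rewrite [RHS](measureDI m1 mSB muq) [X in (X + _)%E](_ : _ = 0%E) ?add0e.
  by rewrite -setIA [RHS]key // setIA m2uq.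
apply: (subset_measure0 _ _ _ (diag n)); [exact: measurableD|exact: measurableD|].
by move=> q [[_ Bq] uq']; split.
Qed.

Lemma correlation_diagonal k (rho : k.+1.-tuple T -> R) :
  almost_simple P -> correlation_function mu P rho ->
  (\int[power_measure mu k.+1]_(x in [set q : k.+1.-tuple T | ~~ uniq q])
     (rho x)%:E = 0)%E.
Proof.
move=> sP cP; have [V [mV _ genV sepV]] := borel_countable_basis hE.
rewrite -(moment_measure_correlation sP cP).
  rewrite -moment_measure_uniq (_ : _ `&` _ = set0) ?measure0 //.
  by rewrite -subset0 => q [/= /negP].
rewrite (_ : [set _ | _] = ~` [set q : k.+1.-tuple T | uniq (q ++ ([tuple] : 0.-tuple T))]).
  by apply: measurableC; exact: measurable_uniq.
by apply/seteqP; split=> q /=; rewrite cats0 => /negP.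
Qed.

Lemma moment_correlation_function k (rho : k.-tuple T -> R) :
  almost_simple P -> measurable_fun setT rho -> (forall x, 0 <= rho x) ->
  (forall n, (\int[power_measure mu k]_(x in pow (B_ n)) (rho x)%:E < +oo)%E) ->
  (forall S, measurable S ->
    moment_measure hE S = (\int[power_measure mu k]_(x in S) (rho x)%:E)%E) ->
  correlation_function mu P rho.
Proof.
move=> sP mrho rho0 fin mom; split => //.
  move=> B mB bB; have [n Bn] := exhaustion_mboundedP bB.
  apply: le_lt_trans (fin n); apply: ge0_subset_integral => //.
  - exact: measurable_pow.
  - by apply: measurable_pow; exact: exhaustion_measurable.
  - by apply/measurable_EFinP; exact: measurable_funTS.
  - by move=> x _; rewrite lee_fin.
  - by move=> q h p; exact: Bn.
move=> j A l mA bA tA l0 lk.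
rewrite -mom ?moment_measure_rect //.
rewrite /rect; set s := flatten _; rewrite (_ : [set _ | _] =
  \bigcap_(p in [set: 'I_k]) (@tnth _ T ^~ p @^-1` nth set0 s p)); last first.
  by apply/seteqP; split=> [q h p _|q h p]; apply: h.
apply: fin_bigcap_measurable => [|p _]; first exact: finite_finset.
rewrite -[X in measurable X]setTI; apply: measurable_tnth => //.
have [sp|sp] := ltnP p (size s); last by rewrite nth_default.
have /flattenP[_ /mapP[i _ ->]] := mem_nth set0 sp.
by rewrite mem_nseq => /andP[_ /eqP ->].
Qed.

End Process.
End MeanMeasure.

Section AlmostEverywhere.
Context d (U : measurableType d) (R : realType) (mu : {measure set U -> \bar R}).
Implicit Types P Q S : U -> Prop.

Lemma ae_imp P Q : (forall x, P x -> Q x) ->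
  {ae mu, forall x, P x} -> {ae mu, forall x, Q x}.
Proof. by move=> PQ; apply: filterS. Qed.

Lemma ae_and P Q : {ae mu, forall x, P x} -> {ae mu, forall x, Q x} ->
  {ae mu, forall x, P x /\ Q x}.
Proof. by move=> aP aQ; apply: filterS2 aP aQ. Qed.

End AlmostEverywhere.

(** * Almost sure simplicity of a Pfaffian process *)

Section Simplicity.
Context (R : realType) (E : pmetricType R).
Hypothesis hE : proper_space E.
Local Notation T := (borel E).
Local Notation B_ := (exhaustion E).
Local Notation simple := (@simple_set R E).
Variables (mu : {sigma_finite_measure set T -> \bar R}) (P : point_process E).

(** If [X] has a multiple point in a ball, then at every depth some cell has at least two points
    there. The probability of this at depth [N] is at most the mean number of ordered pairs in a
    common cell, which is [m1 (D N)], and the sets [D N] decrease to a part of the diagonal. *)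
Lemma diagonal_simple (rho : 2.-tuple T -> R) : correlation_function mu P rho ->
  (\int[power_measure mu 2]_(x in [set q : 2.-tuple T | ~~ uniq q]) (rho x)%:E = 0)%E ->
  almost_simple P.
Proof.
move=> [mrho rho0 frho mom] diag.
have [V [mV _ genV sepV]] := borel_countable_basis hE.
pose A n N (c : N.-tuple bool) : set T := cell V c `&` B_ n.
have mA n N (c : N.-tuple bool) : measurable (A n N c).
  by apply: measurableI; [exact: measurable_cell|exact: exhaustion_measurable].
have bA n N (c : N.-tuple bool) : mbounded (A n N c : set E) by exact: sub_exhaustion_mbounded.
pose F n N : set (borel (conf E)) :=
  \bigcup_(c in [set: N.-tuple bool]) ~` [set X : borel (conf E) | (count_in (A n N c) X <= 1)%N].
have mF n N : measurable (F n N).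
  apply: fin_bigcup_measurable => [|c _]; first exact: finite_finset.
  by apply: measurableC; exact: measurable_count_le.
have mNS n : measurable (\bigcap_N F n N) by exact: bigcapT_measurable.
suff Ph n : P (\bigcap_N F n N) = 0%E.
  rewrite /almost_simple (_ : ~` simple = \bigcup_n \bigcap_N F n N).
    have mU : measurable (\bigcup_n \bigcap_N F n N) by exact: bigcup_measurable.
    apply/(negligibleP _ mU); apply: negligible_bigcup => n.
    by apply/(negligibleP _ (mNS n)); exact: Ph.
  apply/seteqP; split=> [X sX|X [n _ h] /(simple_confP sepV)/(_ n)[N hN]].
    apply: contrapT => h; apply: sX; apply/(simple_confP sepV) => n.
    apply: contrapT => hn; apply: h; exists n => // N _.
    apply: contrapT => hN; apply: hn; exists N => c.
    by apply: contrapT => hc; apply: hN; exists c => //; exact: hc.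
  by have [c _] := h N Logic.I; apply; exact: hN.
pose m1 : {measure set (2.-tuple T) -> \bar R} :=
  density_measure (power_measure mu 2) mrho rho0.
pose D N : set (2.-tuple T) := \bigcup_(c in [set: N.-tuple bool]) pow (A n N c).
have mpow N (c : N.-tuple bool) : measurable (pow (A n N c) : set (2.-tuple T)).
  exact: measurable_pow.
have mD N : measurable (D N).
  by apply: fin_bigcup_measurable => [|c _]; first exact: finite_finset.
have PD N : (P (F n N) <= m1 (D N))%E.
  pose f c (X : borel (conf E)) : \bar R := ((count_in (A n N c) X ^_ 2)%:R)%:E.
  have mf c : measurable_fun setT (f c).
    by apply/measurable_EFinP; exact: ffact_count_measurable.
  have f0 c X : (0 <= f c X)%E by rewrite lee_fin ler0n.
  have -> : m1 (D N) = (\int[P]_X \sum_(c \in [set: N.-tuple bool]) f c X)%E.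
    rewrite ge0_integral_fsum //; last exact: finite_finset.
    rewrite /D measure_fin_bigcup //; last first.
      move=> c c' _ _ [q [h1 h2]].
      by have [<- _] := h1 ord0; have [<- _] := h2 ord0.
      exact: finite_finset.
    apply: eq_fsbigr => c _; rewrite -rect_pow [LHS]mom ?big_ord1 //.
      by apply: eq_integral => X _; rewrite big_ord1.
    by move=> i i' _ _ _; rewrite !ord1.
  have -> : P (F n N) = (\int[P]_X (\1_(F n N) X)%:E)%E by rewrite integral_indic // setIT.
  apply: ge0_le_integral => //.
  - by apply/measurable_EFinP; exact: measurable_indic.
  - by apply: emeasurable_fsum => //; exact: finite_finset.
  move=> X _; rewrite indicE; case: (boolP (X \in F n N)); last first.
    by move=> _; apply: fsume_ge0 => c _; exact: f0.
  move=> /set_mem[c _ /= /negP]; rewrite -ltnNge => c2.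
  rewrite (fsbigD1 c) //=.
  apply: (@le_trans _ _ (f c X)); last by rewrite leeDl // fsume_ge0.
  rewrite lee_fin ler1n ffact_gt0 //.
have lim0 : m1 (\bigcap_N D N) = 0%E.
  have mdiag : measurable [set q : 2.-tuple T | ~~ uniq q].
    rewrite (_ : [set _ | _] = ~` [set q : 2.-tuple T | uniq (q ++ ([tuple] : 0.-tuple T))]).
      by apply: measurableC; exact: measurable_uniq.
    by apply/seteqP; split=> q /=; rewrite cats0 => /negP.
  have diag1 : m1 [set q : 2.-tuple T | ~~ uniq q] = 0%E by exact: diag.
  apply: (subset_measure0 _ _ _ diag1) => //; first exact: bigcapT_measurable.
  move=> q h; apply/negP => uq.
  have uq' : uniq (q ++ ([tuple] : 0.-tuple T)) by rewrite cats0.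
  have [N] := separated_limit sepV uq'; rewrite /separated /= cats0.
  have [c _ hc] := h N Logic.I.
  move=> /(tuple_uniqP (codes V N q)) /(_ ord0 (lift ord0 ord0)).
  rewrite !tnth_codes.
  by have [-> _] := hc ord0; have [-> _] := hc (lift ord0 ord0) => /(_ erefl).
have cD : m1 \o D @ \oo --> m1 (\bigcap_N D N).
  apply: nonincreasing_cvg_mu => //.
  - apply: (@le_lt_trans _ _ (m1 (pow (B_ n)))); last first.
      by apply: frho; [exact: exhaustion_measurable|exact: exhaustion_mbounded].
    apply: le_measure; rewrite ?inE //.
      by apply: measurable_pow; exact: exhaustion_measurable.
    by move=> q [c _ h] i; have [] := h i.
  - exact: bigcapT_measurable.
  - apply/nonincreasing_seqP => N; apply/subsetPset => q [c _ h].
    exists (code V N (tnth q ord0)) => // i; have [ci Bi] := h i; split=> //.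
    have [c0 _] := h ord0.
    by apply: (code_mono (leqnSn N)); rewrite ci c0.
apply/eqP; rewrite eq_le measure_ge0 andbT -lim0 -(cvg_lim _ cD) //.
apply: lime_ge; first by apply/cvg_ex; exists (m1 (\bigcap_N D N)).
near=> N; apply: le_trans (PD N); apply: le_measure; rewrite ?inE //.
by move=> X h; exact: h.
Unshelve. all: by end_near. Qed.

(** On the diagonal the determinant of order 2 is [K a a * K a a - K a a * K a a], so the two-point
    function vanishes there almost everywhere. *)
Lemma pfaffian_simple (K : E -> E -> quat R[i]) :
  pfaffian_process mu P K -> almost_simple P.
Proof.
move=> [_ /(_ 1)[rho crho ae]]; have [mrho rho0 _ _] := crho.
apply: (diagonal_simple crho).
set D := [set _ | _].
have mD : measurable D.
  have [V [mV _ genV sepV]] := borel_countable_basis hE.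
  rewrite (_ : D = ~` [set q : 2.-tuple T | uniq (q ++ ([tuple] : 0.-tuple T))]).
    by apply: measurableC; exact: measurable_uniq.
  by apply/seteqP; split=> q /=; rewrite /D /= cats0 => /negP.
rewrite (ge0_ae_eq_integral (g := cst 0%E)) ?integral0 //.
- by apply/measurable_EFinP; exact: measurable_funTS.
- by move=> x _; rewrite lee_fin.
apply: ae_imp ae => x xr Dx; congr (_%:E); move: xr.
have [a [b ab]] : exists a b, x = [tuple a; b].
  exists (tnth x ord0), (tnth x (lift ord0 ord0)).
  apply: eq_from_tnth => i; case: (unliftP ord0 i) => [j|] -> //; by rewrite ord1.
move: Dx; rewrite /D ab /= inE andbT negbK => /eqP ->.
rewrite qdet_repeated => /(congr1 (@q0 _)) /=; rewrite mulr1 => /esym.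
by move=> /(congr1 (@complex.Re R)) /= ->.
Qed.

End Simplicity.

(** * Disintegration *)

Section SigmaFiniteAlias.
Context d (U : measurableType d) (R : realType) (m : {measure set U -> \bar R}).

(** A copy of [m] carrying the sigma-finite structure, so that Tonelli's theorem applies to
    [power_measure], which is typed as a mere measure. *)
Definition sigma_finite_alias of sigma_finite setT m : set U -> \bar R := m.

Variable hm : sigma_finite setT m.
Let a := sigma_finite_alias hm.

HB.instance Definition _ := isMeasure.Build _ _ _ a
  (measure0 m) (measure_ge0 m) (measure_semi_sigma_additive (s := m)).
HB.instance Definition _ := Measure_isSigmaFinite.Build _ _ _ a hm.

End SigmaFiniteAlias.

Section PowerCat.
Context d (T : measurableType d) (R : realType).
Variable mu : {sigma_finite_measure set T -> \bar R}.
Local Notation pm := (power_measure mu).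

Lemma measurable_cat d' (U : measurableType d') k m
    (f : U -> k.-tuple T) (g : U -> m.-tuple T) :
  measurable_fun setT f -> measurable_fun setT g ->
  measurable_fun setT (fun u => cat_tuple (f u) (g u)).
Proof.
move=> mf mg; apply/measurable_fun_tnthP => i.
case: (split_ordP i) => j ->.
  rewrite (_ : _ \o _ = (fun u => tnth (f u) j)); last first.
    by apply/funext => u /=; rewrite tnth_lshift.
  exact: measurableT_comp (measurable_tnth j) mf.
rewrite (_ : _ \o _ = (fun u => tnth (g u) j)); last first.
  by apply/funext => u /=; rewrite tnth_rshift.
exact: measurableT_comp (measurable_tnth j) mg.
Qed.

Lemma power_measure_pow k (B : set T) : measurable B ->
  (mu B < +oo)%E -> (pm k (pow B) < +oo)%E.
Proof.
move=> mB Boo; elim: k => [|k IH].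
  by rewrite /= diracE; case: (_ \in _); rewrite ltry.
rewrite [X in (X < _)%E](_ : _ = (pm k \x mu)%E (pow B `*` B)); last first.
  rewrite /= /consr_measure /pushforward; congr (product_measure1 _ _ _).
  apply/seteqP; split=> [[q x] h|[q x] [hq hx] i] /=.
    by split=> [i|]; [have := h (lift ord0 i); rewrite tnthS|have := h ord0].
  by case: (unliftP ord0 i) => [j|] ->; rewrite ?tnthS ?tnth0.
rewrite product_measure1E //; last exact: measurable_pow.
by apply: lte_mul_pinfty => //; rewrite ge0_fin_numE.
Qed.

Lemma power_measure_sigma_finite k : sigma_finite setT (pm k).
Proof.
have [F FT mF] := sigma_finiteT mu.
pose G n := \big[setU/set0]_(i < n.+1) F i.
have mG n : measurable (G n) by apply: bigsetU_measurable => i _; exact: (mF i).1.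
exists (fun n => pow (G n)) => [|n]; last first.
  split; first exact: measurable_pow.
  apply: power_measure_pow => //.
  apply: (@le_lt_trans _ _ (\sum_(i < n.+1) mu (F i))%E).
    by rewrite /G; apply: Boole_inequality => i _; exact: (mF i).1.
  by apply: lte_sum_pinfty => i _; exact: (mF i).2.
apply/seteqP; split=> // q _.
have /choice[f hf] : forall i : 'I_k, exists n, F n (tnth q i).
  move=> i; have : setT (tnth q i) by [].
  by rewrite FT => -[n _ h]; exists n.
exists (\max_i f i)%N => // i; rewrite /G -bigcup_mkord; exists (f i) => //=.
by rewrite ltnS; exact: leq_bigmax.
Qed.

Lemma power_measure_succ k (f : k.+1.-tuple T -> \bar R) :
  measurable_fun setT f -> (forall q, 0 <= f q)%E ->
  measurable_fun setT (fun q => \int[mu]_x f (tuple_consr (q, x)))%E /\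
  (\int[pm k.+1]_q f q = \int[pm k]_q \int[mu]_x f (tuple_consr (q, x)))%E.
Proof.
move=> mf f0.
have mc : measurable_fun setT (f \o @tuple_consr d T k).
  exact: measurableT_comp mf (@measurable_tuple_consr d T k).
split; first exact: measurable_fun_fubini_tonelli_F mc (fun z => f0 _).
transitivity (\int[(pm k \x mu)%E]_z (f \o @tuple_consr d T k) z)%E.
  rewrite -[RHS](ge0_integral_pushforward (@measurable_tuple_consr d T k)
    (pm k \x mu)%E measurableT mf) //.
exact: (fubini_tonelli1 (m1 := sigma_finite_alias (power_measure_sigma_finite k)) _ mc
  (fun z => f0 _)).
Qed.

(** The construction adds each coordinate in front, so the induction peels off the points of [y] and
    leaves the block [x] last. *)
Lemma power_measure_cat k m (f : (k + m).-tuple T -> \bar R) :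
  measurable_fun setT f -> (forall q, 0 <= f q)%E ->
  measurable_fun setT (fun x : m.-tuple T => \int[pm k]_y f (cat_tuple y x))%E /\
  (\int[pm (k + m)%N]_q f q = \int[pm m]_x \int[pm k]_y f (cat_tuple y x))%E.
Proof.
elim: k f => [|k IH] f mf f0.
  have E x : (\int[pm 0]_y f (cat_tuple y x) = f x)%E.
    rewrite /= integral_dirac //.
      by rewrite diracT mul1e; congr f; exact: val_inj.
    apply: measurableT_comp mf _; apply: measurable_cat => //; exact: measurable_id.
  under eq_fun do rewrite E.
  by split=> //; apply: eq_integral => x _; rewrite E.
have [mg Eg] := power_measure_succ mf f0.
have [mh Eh] := IH _ mg (fun q => integral_ge0 _ (fun x _ => f0 _)).
have E x : (\int[pm k.+1]_y f (cat_tuple y x) =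
    \int[pm k]_y \int[mu]_h f (tuple_consr (cat_tuple y x, h)))%E.
  have mfx : measurable_fun setT (fun y : k.+1.-tuple T => f (cat_tuple y x)).
    apply: measurableT_comp mf _; apply: measurable_cat => //; exact: measurable_cst.
  have [_ ->] := power_measure_succ mfx (fun q => f0 _).
  apply: eq_integral => y _; apply: eq_integral => h _; congr f.
  exact: val_inj.
split; first by apply: eq_measurable_fun mh => x _; exact/esym/E.
by rewrite [LHS]Eg [LHS]Eh; apply: eq_integral => x _; exact/esym/E.
Qed.

End PowerCat.

Section Integration.
Import HBNNSimple.
Context d (U : measurableType d) (R : realType).

Lemma density_integral (m nu : {measure set U -> \bar R}) (rho : U -> R) f :
  measurable_fun setT rho -> (forall x, 0 <= rho x) ->
  (forall A, measurable A -> nu A = \int[m]_(x in A) (rho x)%:E)%E ->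
  measurable_fun setT f -> (forall x, 0 <= f x)%E ->
  (\int[nu]_x f x = \int[m]_x (f x * (rho x)%:E))%E.
Proof.
move=> mrho rho0 nuE mf f0.
pose g := nnsfun_approx measurableT mf.
have gE x : f x = limn (fun n => (g n x)%:E).
  by apply/esym/cvg_lim => //; exact: cvg_nnsfun_approx.
have g0 n x : (0 <= (g n x)%:E)%E by rewrite lee_fin.
have ndg x : {homo (fun n => (g n x)%:E) : a b / (a <= b)%N >-> (a <= b)%E}.
  by move=> a b ab; rewrite lee_fin; exact/lefP/nd_nnsfun_approx.
have mg n : measurable_fun setT (fun x => (g n x)%:E) by exact/measurable_EFinP.
have mE : measurable_fun setT (fun x => (rho x)%:E) by exact/measurable_EFinP.
have -> : (\int[nu]_x f x = limn (fun n => \int[nu]_x (g n x)%:E))%E.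
  by rewrite -monotone_convergence //; apply: eq_integral => x _; exact: gE.
have -> : (\int[m]_x (f x * (rho x)%:E) =
    limn (fun n => \int[m]_x ((g n x)%:E * (rho x)%:E)))%E.
  rewrite -monotone_convergence //.
  - apply: eq_integral => x _; apply/esym/cvg_lim => //.
    rewrite gE; apply: cvgeZr => //.
    by apply: ereal_nondecreasing_is_cvgn => a b; exact: ndg.
  - by move=> n; exact: emeasurable_funM.
  - by move=> n x _; rewrite mule_ge0 // lee_fin.
  - by move=> x _ a b ab; rewrite lee_wpmul2r ?lee_fin //; have := ndg x _ _ ab; rewrite lee_fin.
congr (limn _); apply/funext => n.
(* A negative value [y] is not taken by [g n], so its indicator vanishes. *)
have pos y x : (0 <= y%:E * (\1_(g n @^-1` [set y]) x)%:E)%E.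
  have [y0|y0] := leP 0 y; first by rewrite lee_fin mulr_ge0.
  rewrite indicE memNset ?mule0 // => /= gx.
  by have := g0 n x; rewrite gx lee_fin leNgt y0.
rewrite integralT_nnsfun sintegralE.
transitivity (\int[m]_x (\sum_(y \in range (g n))
    ((y%:E * (\1_(g n @^-1` [set y]) x)%:E) * (rho x)%:E)))%E; last first.
  apply: eq_integral => x _; rewrite fimfunE.
  rewrite !fsbig_finite // -sumEFin ge0_sume_distrl // => y _.
  exact: pos.
rewrite ge0_integral_fsum //; last 2 first.
- move=> y; apply: emeasurable_funM => //; apply: emeasurable_funM; first exact: measurable_cst.
  by apply/measurable_EFinP; exact: measurable_indic.
- by move=> y x _; rewrite mule_ge0 ?lee_fin //; exact: pos.
apply: eq_fsbigr => y /set_mem[t _ ty].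
have y0 : 0 <= y by rewrite -ty.
have mA : measurable (g n @^-1` [set y]) by exact: measurable_sfunP.
under eq_integral do rewrite -muleA.
rewrite ge0_integralZl ?lee_fin //.
- congr (_ * _)%E; rewrite nuE // integral_mkcond; apply: eq_integral => x _.
  by rewrite patchE indicE; case: (x \in _); rewrite ?mul1e ?mul0e.
- by apply: emeasurable_funM => //; apply/measurable_EFinP; exact: measurable_indic.
- by move=> x _; rewrite mule_ge0 ?lee_fin.
Qed.

(** Monotonicity through simple functions below the integrand, with measurability of [g] only: it
    will serve for the sum over tuples in the Palm formula, as a function of [X]. *)
Lemma integral_ge0_eq0 (m : {measure set U -> \bar R}) (f g : U -> \bar R) :
  (forall x, 0 <= f x)%E -> (forall x, f x <= g x)%E ->
  measurable_fun setT g -> (\int[m]_x g x = 0)%E -> (\int[m]_x f x = 0)%E.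
Proof.
move=> f0 fg mg g0; have g0' x : (0 <= g x)%E by exact: le_trans (fg x).
apply/eqP; rewrite eq_le integral_ge0 // andbT -g0.
rewrite !ge0_integralTE //; apply: le_ereal_sup => _ [h hf <-]; exists h => //=.
by move=> x; exact: le_trans (hf x) (fg x).
Qed.

Lemma integral_eq0_ae (m : {measure set U -> \bar R}) f :
  measurable_fun setT f -> (forall x, 0 <= f x)%E -> (\int[m]_x f x = 0)%E ->
  {ae m, forall x, f x = 0%E}.
Proof.
move=> mf f0 If; have : ae_eq m setT f (cst 0%E).
  apply/ae_eq_integral_abs => //; rewrite -[RHS]If; apply: eq_integral => x _.
  by rewrite gee0_abs.
by apply: ae_imp => x; apply.
Qed.

Lemma integral_lty_ae (m : {measure set U -> \bar R}) f :
  measurable_fun setT f -> (forall x, 0 <= f x)%E -> (\int[m]_x f x < +oo)%E ->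
  {ae m, forall x, (f x < +oo)%E}.
Proof.
move=> mf f0 If; have fi : m.-integrable setT f.
  apply/integrableP; split => //; apply: le_lt_trans If.
  by rewrite le_eqVlt; apply/orP; left; apply/eqP; apply: eq_integral => x _; rewrite gee0_abs.
by apply: ae_imp (integrable_ae measurableT fi) => x /(_ Logic.I); rewrite ge0_fin_numE.
Qed.

End Integration.

Lemma ae_eq_tuple d (T : measurableType d) (R : realType) k
    (m : {measure set (k.-tuple T) -> \bar R}) (B : (set T)^nat) (D : set (k.-tuple T))
    (f g : k.-tuple T -> \bar R) :
  (forall n, measurable (B n)) -> (forall n p, (n <= p)%N -> B n `<=` B p) ->
  (forall x, exists n, B n x) -> measurable D ->
  measurable_fun setT f -> measurable_fun setT g -> (forall x, 0 <= f x)%E ->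
  (forall n, \int[m]_(x in D `&` pow (B n)) f x < +oo)%E ->
  (forall S, measurable S -> S `<=` D -> \int[m]_(x in S) f x = \int[m]_(x in S) g x)%E ->
  {ae m, forall x, D x -> f x = g x}.
Proof.
move=> mB B_mono B_cover mD mf mg f0 fin fg.
have mDB n : measurable (D `&` pow (B n)).
  by apply: measurableI => //; exact: measurable_pow.
have h n : {ae m, forall x, (D `&` pow (B n)) x -> f x = g x}.
  apply: integral_ae_eq => //; last 2 first.
  - exact: measurable_funTS.
  - by move=> S SD mS; apply: fg => // x /SD[].
  apply/integrableP; split; first exact: measurable_funTS.
  apply: le_lt_trans (fin n); rewrite le_eqVlt; apply/orP; left; apply/eqP.
  by apply: eq_integral => x _; rewrite gee0_abs.
apply: ae_imp (ae_foralln h) => q hq Dq.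
have /choice[F hF] : forall i : 'I_k, exists n, B n (tnth q i) by move=> i; exact: B_cover.
apply: (hq (\max_i F i)%N); split=> // i; apply: B_mono (hF i).
exact: leq_bigmax.
Qed.

Section Sections.
Context d (T : measurableType d) (R : realType).
Variable mu : {sigma_finite_measure set T -> \bar R}.
Local Notation pm := (power_measure mu).

Lemma measurable_cat_section k m (f : (k + m).-tuple T -> \bar R) (x : m.-tuple T) :
  measurable_fun setT f -> measurable_fun setT (fun y : k.-tuple T => f (cat_tuple y x)).
Proof.
move=> mf; apply: measurableT_comp mf _; apply: measurable_cat => //; exact: measurable_cst.
Qed.

Lemma section_eq0 k m (f : (k + m).-tuple T -> \bar R) :
  measurable_fun setT f -> (forall q, 0 <= f q)%E ->
  (\int[pm (k + m)%N]_q f q = 0)%E ->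
  {ae pm m, forall x, (\int[pm k]_y f (cat_tuple y x) = 0)%E}.
Proof.
move=> mf f0; have [mg ->] := power_measure_cat mu mf f0.
by apply: integral_eq0_ae => // x; apply: integral_ge0.
Qed.

Lemma section_ae k m (Q : (k + m).-tuple T -> Prop) :
  {ae pm (k + m)%N, forall q, Q q} ->
  {ae pm m, forall x, {ae pm k, forall y, Q (cat_tuple y x)}}.
Proof.
move=> [N [mN N0 QN]].
have mf : measurable_fun setT (fun q => (\1_N q)%:E : \bar R).
  by apply/measurable_EFinP; exact: measurable_indic.
have f0 q : (0 <= (\1_N q)%:E :> \bar R)%E by rewrite lee_fin.
have If : (\int[pm (k + m)%N]_q (\1_N q)%:E = 0)%E by rewrite integral_indic // setIT.
apply: ae_imp (section_eq0 mf f0 If) => x Ix.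
have := integral_eq0_ae (measurable_cat_section x mf) (fun y => f0 _) Ix.
apply: ae_imp => y; rewrite indicE => -[] Ny; apply: contrapT => nQ.
by move: Ny; rewrite mem_set; [move/eqP; rewrite oner_eq0|exact: QN].
Qed.

End Sections.

(** * Palm measures *)

Section PalmKernel.
Context (R : realType) (E : pmetricType R) (k : nat).
Local Notation T := (borel E).

(** The measurability proof is an argument, so that the kernel structure can be attached to the
    function and integrals be measurable in [q]. *)
Definition palm_transition (Palm : k.-tuple T -> point_process E)
    of (forall A, measurable A -> measurable_fun setT (Palm ^~ A)) :
  k.-tuple T -> {measure set (borel (conf E)) -> \bar R} := fun q => Palm q.

Variables (Palm : k.-tuple T -> point_process E).
Hypothesis mPalm : forall A, measurable A -> measurable_fun setT (Palm ^~ A).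
Let l := palm_transition mPalm.

HB.instance Definition _ := isKernel.Build _ _ _ _ _ l mPalm.

Let l_prob q : l q setT = 1%E. Proof. exact: probability_setT. Qed.

HB.instance Definition _ := Kernel_isProbability.Build _ _ _ _ _ l l_prob.

Lemma measurable_palm_integral (f : k.-tuple T * borel (conf E) -> \bar R) :
  measurable_fun setT f -> (forall z, 0 <= f z)%E ->
  measurable_fun setT (fun q => \int[Palm q]_X f (q, X))%E.
Proof. by move=> mf f0; exact: (measurable_fun_integral_finite_kernel f l f0 mf). Qed.

End PalmKernel.

Section Campbell.
Context (R : realType) (E : pmetricType R).
Hypothesis hE : proper_space E.
Local Notation T := (borel E).
Local Notation B_ := (exhaustion E).
Local Notation simple := (@simple_set R E).
Variables (mu : {sigma_finite_measure set T -> \bar R}) (P : point_process E).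
Hypothesis sP : almost_simple P.
Variables (m : nat) (lambda : {measure set (m.+1.-tuple T) -> \bar R}).
Variable Palm : m.+1.-tuple T -> point_process E.
Hypothesis hPalm : palm_measures P lambda Palm.
Local Notation pm := (power_measure mu).

Definition simple_add k : set (borel (conf E) * k.-tuple T) :=
  [set u | simple_conf (conf_add u.1 u.2)].

Lemma simple_add_measurable k : measurable (@simple_add k).
Proof.
by have [V [mV _ genV sepV]] := borel_countable_basis hE; exact: measurable_simple_add mV sepV k.
Qed.

Lemma simple_add_section k (q : k.-tuple T) :
  measurable [set X : borel (conf E) | simple_conf (conf_add X q)].
Proof.
rewrite -[X in measurable X]setTI.
have mp : measurable_fun [set: borel (conf E)] (fun X : borel (conf E) => (X, q)).
  by apply/measurable_fun_pairP; split; [exact: measurable_id|exact: measurable_cst].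
exact: mp measurableT _ (@simple_add_measurable k).
Qed.

(** Palm formula for the indicator of non-simple configurations: the left-hand side is null as [P]
    is almost surely simple. *)
Lemma palm_simple : {ae lambda, forall q,
  Palm q [set X : borel (conf E) | ~ simple_conf (conf_add X q)] = 0%E}.
Proof.
have msim : measurable (~` simple) by apply: measurableC; exact: simple_set_measurable.
pose u (z : borel (conf E) * m.+1.-tuple T) : R := \1_(~` simple) z.1.
have mu' : measurable_fun setT u.
  exact: measurableT_comp (measurable_indic msim) measurable_fst.
have u0 z : 0 <= u z by [].
have := hPalm.2 u mu' u0.
(* A measurable bound for the sum over tuples, infinite on the null event. *)
pose g (X : borel (conf E)) : \bar R := ((\1_(~` simple) X)%:E * +oo)%E.
have mg : measurable_fun setT g.
  apply: emeasurable_funM; last exact: measurable_cst.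
  by apply/measurable_EFinP; exact: measurable_indic.
have Ig : (\int[P]_X g X = 0)%E.
  rewrite integral_simple // => [|X]; last by rewrite mule_ge0 ?lee_fin ?leey.
  by apply: integral0_eq => X sX; rewrite /g indicE memNset ?mul0e.
rewrite (integral_ge0_eq0 _ _ mg Ig); first last.
- move=> X; rewrite /g /u /= indicE; case: (boolP (X \in _)) => h.
    by rewrite mul1e leey.
  by rewrite mul0e esum1.
- by move=> X; apply: esum_ge0 => q _; rewrite lee_fin; exact: u0.
move=> /esym I0; pose v (z : m.+1.-tuple T * borel (conf E)) : \bar R :=
  (\1_(~` @simple_add m.+1) (z.2, z.1))%:E.
have mv : measurable_fun setT v.
  apply/measurable_EFinP; apply: measurableT_comp.
    by apply: measurable_indic; apply: measurableC; exact: simple_add_measurable.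
  by apply/measurable_fun_pairP; split; [exact: measurable_snd|exact: measurable_fst].
have v0 z : (0 <= v z)%E by rewrite lee_fin.
have mF := measurable_palm_integral hPalm.1 mv v0.
have F0 q : (0 <= \int[Palm q]_X v (q, X))%E by apply: integral_ge0.
have Iv : (\int[lambda]_q \int[Palm q]_X v (q, X) = 0)%E.
  by rewrite -[RHS]I0; apply: eq_integral => q _; apply: eq_integral => X _.
apply: ae_imp (integral_eq0_ae mF F0 Iv) => q <-.
rewrite -[X in Palm q X]setIT -integral_indic //; last first.
  by apply: measurableC; exact: simple_add_section.
Qed.

Definition cat_set k n (A : set (k.-tuple T)) (S : set (n.-tuple T)) : set ((k + n).-tuple T) :=
  [set q | exists y x, [/\ A y, S x & q = cat_tuple y x]].

Lemma cat_setP k n (A : set (k.-tuple T)) (S : set (n.-tuple T)) y x :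
  cat_set A S (cat_tuple y x) <-> A y /\ S x.
Proof.
split=> [[y' [x' [Ay Sx]]]|[Ay Sx]]; last by exists y, x.
move=> /(congr1 val) /= /eqP; rewrite eqseq_cat ?size_tuple //.
by move=> /andP[/eqP/val_inj -> /eqP/val_inj ->].
Qed.

Lemma measurable_cat_set k n (A : set (k.-tuple T)) (S : set (n.-tuple T)) :
  measurable A -> measurable S -> measurable (cat_set A S).
Proof.
move=> mA mS.
pose t (q : (k + n).-tuple T) : k.-tuple T := [tuple tnth q (lshift n i) | i < k].
pose s (q : (k + n).-tuple T) : n.-tuple T := [tuple tnth q (rshift k i) | i < n].
have mt : measurable_fun setT t.
  apply/measurable_fun_tnthP => i; rewrite (_ : _ \o _ = tnth (T := T) ^~ (lshift n i)).
    exact: measurable_tnth.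
  by apply/funext => q /=; rewrite tnth_mktuple.
have ms : measurable_fun setT s.
  apply/measurable_fun_tnthP => i; rewrite (_ : _ \o _ = tnth (T := T) ^~ (rshift k i)).
    exact: measurable_tnth.
  by apply/funext => q /=; rewrite tnth_mktuple.
have qE q : q = cat_tuple (t q) (s q).
  apply: eq_from_tnth => i; case: (split_ordP i) => j ->.
    by rewrite tnth_lshift tnth_mktuple.
  by rewrite tnth_rshift tnth_mktuple.
have -> : cat_set A S = (setT `&` t @^-1` A) `&` (setT `&` s @^-1` S).
  rewrite !setTI; apply/seteqP; split=> q; first by rewrite {1}(qE q) => /cat_setP.
  by move=> h; rewrite (qE q); apply/cat_setP.
by apply: measurableI; [exact: mt|exact: ms].
Qed.

Section Integral.
Variables (k n : nat) (r : (k + n).-tuple T -> R).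
Hypothesis mr : measurable_fun setT r.
Hypothesis r0 : forall q, 0 <= r q.

Definition partial_integral (A : set (k.-tuple T)) (x : n.-tuple T) : \bar R :=
  (\int[pm k]_(y in A) (r (cat_tuple y x))%:E)%E.

Lemma partial_integralP (A : set (k.-tuple T)) : measurable A ->
  measurable_fun setT (partial_integral A) /\
  forall S, measurable S ->
  (\int[pm n]_(x in S) partial_integral A x = \int[pm (k + n)%N]_(q in cat_set A S) (r q)%:E)%E.
Proof.
move=> mA.
have key S : measurable S ->
    measurable_fun setT (partial_integral A \_ S) /\
    (\int[pm n]_x (partial_integral A \_ S) x =
     \int[pm (k + n)%N]_(q in cat_set A S) (r q)%:E)%E.
  move=> mS; have mC := measurable_cat_set mA mS.
  have mf : measurable_fun setT ((fun q => (r q)%:E : \bar R) \_ (cat_set A S)).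
    by apply/(measurable_restrictT _ mC); apply: measurable_funTS; exact/measurable_EFinP.
  have f0 q : (0 <= ((fun q => (r q)%:E : \bar R) \_ (cat_set A S)) q)%E.
    by rewrite patchE; case: ifP => // _; rewrite lee_fin.
  have [mg Ig] := power_measure_cat mu mf f0.
  have gE x : (\int[pm k]_y ((fun q => (r q)%:E : \bar R) \_ (cat_set A S)) (cat_tuple y x) =
      (partial_integral A \_ S) x)%E.
    rewrite patchE; case: (boolP (x \in S)) => xS.
      rewrite /partial_integral [RHS]integral_mkcond; apply: eq_integral => y _.
      rewrite !patchE; congr (if _ then _ else _); apply/idP/idP => /set_mem.
        by move=> /cat_setP[Ay _]; exact: mem_set.
      by move=> Ay; apply/mem_set/cat_setP; split=> //; exact: set_mem.
    apply: integral0_eq => y _; rewrite patchE memNset // => /cat_setP[_ Sx].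
    by move/negP: xS; apply; exact: mem_set.
  split; first by apply: eq_measurable_fun mg => x _; exact: gE.
  by rewrite [RHS]integral_mkcond [RHS]Ig;  apply: eq_integral => x _; rewrite gE.
split; first by have [+ _] := key setT measurableT; rewrite patch_setT.
by move=> S mS; rewrite integral_mkcond (key S mS).2.
Qed.

End Integral.

End Campbell.

Section PalmCells.
Context (R : realType) (E : pmetricType R).
Hypothesis hE : proper_space E.
Local Notation T := (borel E).
Local Notation B_ := (exhaustion E).
Local Notation simple := (@simple_set R E).
Variables (mu : {sigma_finite_measure set T -> \bar R}) (P : point_process E).
Hypothesis sP : almost_simple P.
Local Notation pm := (power_measure mu).
Variables (m : nat) (lambda : {measure set (m.+1.-tuple T) -> \bar R}).
Variable rho : m.+1.-tuple T -> R.
Hypothesis mrho : measurable_fun setT rho.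
Hypothesis rho0 : forall x, 0 <= rho x.
Hypothesis lambdaE : forall A, measurable A ->
  lambda A = (\int[pm m.+1]_(x in A) (rho x)%:E)%E.
Variable Palm : m.+1.-tuple T -> point_process E.
Hypothesis hPalm : palm_measures P lambda Palm.
Variables (k : nat) (r : (k.+1 + m.+1).-tuple T -> R).
Hypothesis cr : correlation_function mu P r.

Lemma partial_integral_lty (A : set (k.+1.-tuple T)) (S : set (m.+1.-tuple T)) n p :
  measurable A -> measurable S -> A `<=` pow (B_ n) -> S `<=` pow (B_ p) ->
  (\int[pm m.+1]_(x in S) partial_integral mu r A x < +oo)%E.
Proof.
move=> mA mS An Sp; have [mr r0 fr _] := cr.
have mB : measurable (B_ (maxn n p)) by exact: exhaustion_measurable.
rewrite (partial_integralP mu mr r0 mA).2 //.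
apply: le_lt_trans (fr _ mB (exhaustion_mbounded E _)).
apply: ge0_subset_integral => //.
- exact: measurable_cat_set.
- exact: measurable_pow mB.
- by apply: measurable_funTS; exact/measurable_EFinP.
- by move=> q _; rewrite lee_fin.
move=> q [y [x [/An By /Sp Bx ->]]] i /=; case: (split_ordP i) => j ->.
  by rewrite tnth_lshift; apply: exhaustion_mono (By j); exact: leq_maxl.
by rewrite tnth_rshift; apply: exhaustion_mono (Bx j); exact: leq_maxr.
Qed.

Variable V : (set T)^nat.
Hypothesis mV : forall n, measurable (V n).

Section Cells.
Variables (N n : nat) (w : k.+1.-tuple (N.-tuple bool)).

Definition cells_count (X : borel (conf E)) : nat :=
  (\prod_(i < k.+1) count_in (cell V (tnth w i) `&` B_ n) X)%N.

(** The indicator is what the restriction to simple configurations in [moment_measure] becomes once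
    the Palm formula has replaced [X] by [conf_add X x]. *)
Definition cells_palm (z : m.+1.-tuple T * borel (conf E)) : R :=
  (cells_count z.2)%:R * \1_(@simple_add R E m.+1) (z.2, z.1).

Let A : set (k.+1.-tuple T) := level V w `&` pow (B_ n).
Let D : set (m.+1.-tuple T) := [set x | uniq (w ++ codes V N x)].

Let bC i : mbounded (cell V (tnth w i) `&` B_ n : set E).
Proof. exact: sub_exhaustion_mbounded. Qed.

Lemma cells_count_measurable : measurable_fun setT (fun X => (cells_count X)%:R : R).
Proof.
under eq_fun do rewrite natr_prod.
apply: measurable_prod => i _; apply: count_in_measurableR => //.
by apply: measurableI; [exact: measurable_cell|exact: exhaustion_measurable].
Qed.

Lemma cells_palm_measurable : measurable_fun setT cells_palm.
Proof.
apply: measurable_funM.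
  exact: measurableT_comp cells_count_measurable measurable_snd.
apply: measurableT_comp; first by apply: measurable_indic; exact: simple_add_measurable.
by apply/measurable_fun_pairP; split; [exact: measurable_snd|exact: measurable_fst].
Qed.

Lemma cells_palm_ge0 z : 0 <= cells_palm z.
Proof. by rewrite mulr_ge0. Qed.

Lemma cells_count_conf_add (X : conf E) (x : m.+1.-tuple T) : D x ->
  cells_count (conf_add X x) = cells_count X.
Proof.
rewrite /D /= cat_uniq => /and3P[_ /hasPn h _].
apply: eq_bigr => i _; rewrite count_in_conf_add // big1 ?addn0 // => j _.
rewrite memNset // => -[cij _].
have : tnth (codes V N x) j \in codes V N x by exact: mem_tnth.
by move=> /h; rewrite tnth_codes cij mem_tnth.
Qed.

(** Both sides are the moment measure of order k+m+2 of the product of [A] and [S]: the left one by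
    Tonelli, the right one by the Palm formula. For the latter, no point of [S] lies in the cells,
    so the factorial measure of the product is a sum over tuples in [S] of a count that ignores the
    added points. *)
Lemma cells_campbell (S : set (m.+1.-tuple T)) : measurable S -> S `<=` D -> uniq w ->
  (\int[pm m.+1]_(x in S) partial_integral mu r A x =
   \int[pm m.+1]_(x in S) ((\int[Palm x]_X (cells_palm (x, X))%:E) * (rho x)%:E))%E.
Proof.
move=> mS SD uw.
have [mr r0 _ _] := cr.
have mA : measurable A.
  apply: measurableI; first exact: measurable_level.
  by apply: measurable_pow; exact: exhaustion_measurable.
have mC := measurable_cat_set mA mS.
rewrite (partial_integralP mu mr r0 mA).2 //.
rewrite -(moment_measure_correlation hE (k := k + m.+1) sP cr mC).
pose u (z : borel (conf E) * m.+1.-tuple T) : R :=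
  (cells_count z.1)%:R * \1_simple z.1 * \1_S z.2.
have mu' : measurable_fun setT u.
  apply: measurable_funM; first apply: measurable_funM.
  - exact: measurableT_comp cells_count_measurable measurable_fst.
  - apply: measurableT_comp measurable_fst; apply: measurable_indic.
    exact: simple_set_measurable.
  - exact: measurableT_comp (measurable_indic mS) measurable_snd.
have u0 z : 0 <= u z by rewrite !mulr_ge0.
transitivity (\int[P]_X \esum_(q in distinct_points X m.+1) (u (X, q))%:E)%E.
  rewrite /moment_measure integral_mkcond; apply: eq_integral => X _.
  rewrite patchE /u /= indicE; case: (boolP (X \in simple)) => [/set_mem sX|_]; last first.
    by rewrite esum1 // => q _; rewrite mulr0 mul0r.
  have pA := fact_measure_level V sX (exhaustion_mbounded E n) uw.
  rewrite (@fact_measure_cat R T (support X) k.+1 m.+1 A S (cells_count X)) //; last first.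
    move=> y x [Ay _] Sx uy ux; have := SD _ Sx; rewrite /D /= -Ay -map_cat.
    exact: map_uniq.
  rewrite -esum_scale setIC esum_mkcondr; apply: eq_esum => q _.
  by rewrite /= mulr1 indicE; case: (q \in S); rewrite ?mulr1 ?mulr0.
rewrite (hPalm.2 u mu' u0).
pose g x : \bar R := (\int[Palm x]_X (cells_palm (x, X))%:E)%E.
have mg : measurable_fun setT g.
  apply: (measurable_palm_integral hPalm.1 (f := EFin \o cells_palm)).
    by apply/measurable_EFinP; exact: cells_palm_measurable.
  by move=> z; rewrite lee_fin cells_palm_ge0.
have g0 x : (0 <= g x)%E.
  by apply: integral_ge0 => X _; rewrite lee_fin cells_palm_ge0.
have gS0 x : (0 <= (g \_ S) x)%E by rewrite patchE; case: ifP.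
have mgS : measurable_fun setT (g \_ S).
  by apply/(measurable_restrictT _ mS); exact: measurable_funTS.
transitivity (\int[lambda]_x (g \_ S) x)%E.
  apply: eq_integral => x _; rewrite patchE; case: (boolP (x \in S)) => xS.
    apply: eq_integral => X _; congr (_%:E); rewrite /u /cells_palm /=.
    rewrite cells_count_conf_add; last by apply: SD; exact: set_mem.
    by rewrite !indicE xS mulr1.
  by apply: integral0_eq => X _; rewrite /u /= [\1_S x]indicE (negbTE xS) mulr0.
rewrite (density_integral mrho rho0 lambdaE mgS gS0) [RHS]integral_mkcond.
by apply: eq_integral => x _; rewrite !patchE; case: ifP => // _; rewrite mul0e.
Qed.

Lemma palm_cells : {ae pm m.+1, forall x, uniq (w ++ codes V N x) ->
  partial_integral mu r A x =
  ((\int[Palm x]_X (cells_palm (x, X))%:E) * (rho x)%:E)%E}.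
Proof.
have [uw|nuw] := boolP (uniq w); last first.
  by apply: aeW => x; rewrite cat_uniq (negbTE nuw).
have [mr r0 _ _] := cr.
have mA : measurable A.
  apply: measurableI; first exact: measurable_level.
  by apply: measurable_pow; exact: exhaustion_measurable.
have [mpi _] := partial_integralP mu mr r0 mA.
have mD : measurable D by exact: (codes_finite_measurable mV (fun v => uniq (w ++ v))).
have mB p : measurable (B_ p) by exact: exhaustion_measurable.
apply: (ae_eq_tuple (B := B_) (D := D)) => //.
- exact: exhaustion_mono.
- exact: exhaustion_cover.
- apply: emeasurable_funM; last exact/measurable_EFinP.
  apply: (measurable_palm_integral hPalm.1 (f := EFin \o cells_palm)).
    by apply/measurable_EFinP; exact: cells_palm_measurable.
  by move=> z; rewrite lee_fin cells_palm_ge0.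
- by move=> x; apply: integral_ge0 => y _; rewrite lee_fin.
- move=> p; apply: (partial_integral_lty (n := n) (p := p)) => //.
  + by apply: measurableI => //; exact: measurable_pow.
  + exact: subIsetr.
- by move=> S mS SD; exact: cells_campbell.
Qed.

End Cells.
End PalmCells.

(** * The Palm measure at one fixed tuple *)

Section PalmCorrelation.
Context (R : realType) (E : pmetricType R).
Hypothesis hE : proper_space E.
Local Notation T := (borel E).
Local Notation B_ := (exhaustion E).
Local Notation simple := (@simple_set R E).
Variable mu : {sigma_finite_measure set T -> \bar R}.
Local Notation pm := (power_measure mu).
Variables (m : nat) (x : m.+1.-tuple T) (Q : point_process E).

Definition collision : set (borel (conf E)) := [set X | ~ simple_conf (conf_add X x)].

Hypothesis Q0 : Q collision = 0%E.

Lemma collision_measurable : measurable collision.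
Proof. by apply: measurableC; exact: simple_add_section. Qed.

Lemma palm_almost_simple : almost_simple Q.
Proof.
apply: (subset_measure0 _ _ _ Q0).
- by apply: measurableC; exact: simple_set_measurable.
- exact: collision_measurable.
by move=> X nX sX; apply: nX => z; apply: leq_trans (sX z); exact: leq_addr.
Qed.

(** If adding [x] keeps [X] simple, then [x] has no repetition and avoids [X], so distinct points of
    [X] cannot collide with [x]. *)
Lemma moment_measure_collision k :
  moment_measure Q hE [set y : k.-tuple T | ~~ uniq (y ++ x)] = 0%E.
Proof.
have [V [mV _ genV sepV]] := borel_countable_basis hE.
have muq : measurable [set y : k.-tuple T | ~~ uniq (y ++ x)].
  rewrite (_ : [set _ | _] = ~` [set y : k.-tuple T | uniq (y ++ x)]).
    by apply: measurableC; exact: measurable_uniq.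
  by apply/seteqP; split=> y /= /negP.
rewrite /moment_measure (ge0_negligible_integral collision_measurable) //.
- apply: integral0_eq => X [_ nX]; rewrite /fact_measure (_ : _ `&` _ = set0) ?esum_set0 //.
  rewrite -subset0 => y [/negP nu [uy Xy]]; apply: nu.
  have sX : simple_conf (conf_add X x) by exact: contrapT.
  have cx z : (X z + count_mem z x <= 1)%N by exact: sX.
  have ux : uniq x.
    apply: count_mem_uniq => z; case: (boolP (z \in x)) => [|/count_memPn //].
    rewrite -has_pred1 has_count => zx; apply/eqP; rewrite eqn_leq zx andbT.
    exact: leq_trans (leq_addl _ _) (cx z).
  rewrite cat_uniq uy ux andbT /=; apply/hasPn => z zx; apply/negP => /tnthP[i zi].
  have := Xy i; rewrite /support /= -zi -lt0n => Xz; move: zx.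
  by rewrite -has_pred1 has_count => /(leq_add Xz)/leq_trans/(_ (cx z)).
- exact: simple_set_measurable.
- exact: fact_measure_measurable.
Qed.

Variables (k : nat) (r : (k.+1 + m.+1).-tuple T -> R) (c : R).
Hypothesis c0 : 0 < c.
Hypothesis mr : measurable_fun setT r.
Hypothesis r0 : forall q, 0 <= r q.
Hypothesis fin : forall n, (partial_integral mu r (pow (B_ n)) x < +oo)%E.
Hypothesis diag :
  partial_integral mu r [set y : k.+1.-tuple T | ~~ uniq (y ++ x)] x = 0%E.
Variable V : (set T)^nat.
Hypothesis mV : forall n, measurable (V n).
Hypothesis genV : (@measurable _ T) = <<s range V >>.
Hypothesis sepV : forall x y, (forall n, V n x <-> V n y) -> x = y.
Hypothesis cells : forall N n (w : k.+1.-tuple (N.-tuple bool)), uniq (w ++ codes V N x) ->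
  partial_integral mu r (level V w `&` pow (B_ n)) x =
  ((\int[Q]_X (cells_palm V n w (x, X))%:E) * c%:E)%E.

(** The density measure and the moment measure of [Q] agree on cells free of points of [x], hence
    off the collisions; both vanish on collisions, by [diag] and by [moment_measure_collision]. *)
Lemma palm_correlation :
  correlation_function mu Q (fun y : k.+1.-tuple T => r (cat_tuple y x) / c).
Proof.
have mrx : measurable_fun setT (fun y : k.+1.-tuple T => r (cat_tuple y x)).
  apply/measurable_EFinP; apply: (measurable_cat_section (f := EFin \o r)).
  exact/measurable_EFinP.
have mrc : measurable_fun setT (fun y : k.+1.-tuple T => r (cat_tuple y x) / c).
  by apply: measurable_funM => //; exact: measurable_cst.
have rc0 (y : k.+1.-tuple T) : 0 <= r (cat_tuple y x) / c by rewrite divr_ge0 // ltW.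
have IE (S : set (k.+1.-tuple T)) : measurable S ->
    (\int[pm k.+1]_(y in S) (r (cat_tuple y x) / c)%:E =
     partial_integral mu r S x * (c^-1)%:E)%E.
  move=> mS; rewrite /partial_integral; under eq_integral do rewrite EFinM.
  rewrite ge0_integralZr //.
  - by apply: measurable_funTS; exact/measurable_EFinP.
  - by move=> y _; rewrite lee_fin.
  - by rewrite lee_fin invr_ge0 ltW.
have sQ := palm_almost_simple.
have mB n : measurable (B_ n) by exact: exhaustion_measurable.
have mpow n : measurable (pow (B_ n) : set (k.+1.-tuple T)) by exact: measurable_pow.
have finc n : (\int[pm k.+1]_(y in pow (B_ n)) (r (cat_tuple y x) / c)%:E < +oo)%E.
  by rewrite IE // muleC lte_mul_pinfty ?lee_fin ?invr_ge0 ?ltW //; exact: fin.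
pose m1 : {measure set (k.+1.-tuple T) -> \bar R} := density_measure (pm k.+1) mrc rc0.
pose m2 : {measure set (k.+1.-tuple T) -> \bar R} := moment_measure Q hE.
have fin1 n : (m1 (pow (B_ n)) < +oo)%E by exact: finc.
apply: (moment_correlation_function (hE := hE)) => // S mS.
pose uq : set (k.+1.-tuple T) := [set y | uniq (y ++ x)].
have muq : measurable uq by exact: measurable_uniq.
have uqC : ~` uq = [set y : k.+1.-tuple T | ~~ uniq (y ++ x)].
  by apply/seteqP; split=> y /= /negP.
have agree n N (w : k.+1.-tuple (N.-tuple bool)) : uniq (w ++ codes V N x) ->
    m1 (level V w `&` pow (B_ n)) = m2 (level V w `&` pow (B_ n)).
  move=> uwx; have uw : uniq w by move: uwx; rewrite cat_uniq => /and3P[].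
  have mA i : measurable (cell V (tnth w i) `&` B_ n).
    by apply: measurableI => //; exact: measurable_cell.
  have bA i : mbounded (cell V (tnth w i) `&` B_ n : set E).
    exact: sub_exhaustion_mbounded.
  have tA : trivIset setT (fun i => cell V (tnth w i) `&` B_ n) by exact: trivIset_cells.
  have l1 : (\sum_(i < k.+1) 1 = k.+1)%N by rewrite sum1_card card_ord.
  rewrite [LHS]IE; last by apply: measurableI => //; exact: measurable_level.
  rewrite (cells n uwx) -muleA -EFinM mulfV ?gt_eqF // mule1.
  rewrite -rect_level /m2 /= moment_measure_rect //.
  have mW := cells_count_measurable hE mV n w.
  have mc : measurable_fun setT (fun X => (cells_palm V n w (x, X))%:E).
    apply/measurable_EFinP; apply: measurableT_comp (cells_palm_measurable hE mV n w) _.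
    by apply/measurable_fun_pairP; split; [exact: measurable_cst|exact: measurable_id].
  under [RHS]eq_integral => X _ do under eq_bigr => i _ do rewrite ffactn1.
  (* Off the null event [collision] the indicator in [cells_palm] is 1, leaving the product of
     counts. *)
  have drop (f : borel (conf E) -> \bar R) : measurable_fun setT f ->
      (forall X, 0 <= f X)%E -> (\int[Q]_X f X = \int[Q]_(X in ~` collision) f X)%E.
    move=> mf f0; rewrite (ge0_negligible_integral (N := collision)) // ?setTD //.
    exact: collision_measurable.
  rewrite [RHS]drop //; last exact/measurable_EFinP.
  rewrite drop // => [|X]; last by rewrite lee_fin cells_palm_ge0.
  apply: eq_integral => X /set_mem nX; congr (_%:E).
  by rewrite /cells_palm /= indicE mem_set ?mulr1 //; exact: contrapT.
have key n A : measurable A ->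
    m1 (A `&` (pow (B_ n) `&` uq)) = m2 (A `&` (pow (B_ n) `&` uq)).
  by move=> mA; apply: (separated_unique_uniq mV genV sepV (mB n) (fin1 n) (agree n)).
have m10 : m1 (~` uq) = 0%E by rewrite [LHS]IE ?uqC ?diag ?mul0e // -uqC; exact: measurableC.
have m20 : m2 (~` uq) = 0%E by rewrite uqC; exact: moment_measure_collision.
have drop (m' : {measure set (k.+1.-tuple T) -> \bar R}) A : m' (~` uq) = 0%E ->
    measurable A -> m' A = m' (A `&` uq).
  move=> m0 mA; rewrite (measureDI m' mA muq) [X in (X + _)%E](_ : _ = 0%E) ?add0e //.
  apply: (subset_measure0 _ _ _ m0); [exact: measurableD|exact: measurableC|].
  by move=> y [].
apply: (measure_exhaust (m1 := m2) (m2 := m1) mB) => //.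
- exact: exhaustion_mono.
- exact: exhaustion_cover.
move=> n; have mSB : measurable (S `&` pow (B_ n)) by exact: measurableI.
by rewrite (drop m1) // (drop m2) // -!setIA key.
Qed.

End PalmCorrelation.

(** * From a fixed tuple to almost every tuple *)

Section AlmostEveryPoint.
Context (R : realType) (E : pmetricType R).
Hypothesis hE : proper_space E.
Local Notation T := (borel E).
Local Notation B_ := (exhaustion E).
Variables (mu : {sigma_finite_measure set T -> \bar R}) (P : point_process E).
Hypothesis sP : almost_simple P.
Local Notation pm := (power_measure mu).

(** The density of [lambda] and the function equal to the determinant are two versions of one
    correlation function; this reconciles them. *)
Lemma correlation_unique k (rho rho' : k.+1.-tuple T -> R) :
  correlation_function mu P rho -> correlation_function mu P rho' ->
  {ae pm k.+1, forall x, rho x = rho' x}.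
Proof.
move=> c c'; have [mr r0 fr _] := c; have [mr' _ _ _] := c'.
have : {ae pm k.+1, forall x, [set: k.+1.-tuple T] x -> (rho x)%:E = (rho' x)%:E :> \bar R}.
  apply: (ae_eq_tuple (B := B_)) => //; try exact/measurable_EFinP.
  - exact: exhaustion_measurable.
  - exact: exhaustion_mono.
  - exact: exhaustion_cover.
  - move=> n; rewrite setTI; apply: fr; first exact: exhaustion_measurable.
    exact: exhaustion_mbounded.
  - move=> S mS _; rewrite -(moment_measure_correlation hE sP c) //.
    exact: moment_measure_correlation.
by apply: ae_imp => x /(_ Logic.I)[].
Qed.

Section Density.
Variables (m : nat) (lambda : {measure set (m.-tuple T) -> \bar R}) (rho : m.-tuple T -> R).
Hypothesis mrho : measurable_fun setT rho.
Hypothesis rho0 : forall x, 0 <= rho x.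
Hypothesis lambdaE : forall A, measurable A ->
  lambda A = (\int[pm m]_(x in A) (rho x)%:E)%E.

Lemma density_ae (Q : m.-tuple T -> Prop) :
  {ae pm m, forall x, Q x} -> {ae lambda, forall x, Q x}.
Proof.
move=> [N [mN N0 QN]]; exists N; split => //; rewrite lambdaE // null_set_integral //.
by apply: measurable_funTS; exact/measurable_EFinP.
Qed.

Lemma density_ae_gt0 : {ae lambda, forall x, 0 < rho x}.
Proof.
have mN : measurable (rho @^-1` [set 0]).
  by rewrite -[X in measurable X]setTI; exact: mrho.
exists (rho @^-1` [set 0]); split=> //.
  by rewrite lambdaE // integral0_eq // => x /= ->.
by move=> x /= /negP; rewrite -leNgt => h; apply/eqP; rewrite eq_le h rho0.
Qed.

End Density.

Section Sections.
Variables (k m : nat) (r : (k.+1 + m.+1).-tuple T -> R).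
Hypothesis cr : correlation_function mu P r.

Lemma partial_integral_lty_ae : {ae pm m.+1, forall x, forall n,
  (partial_integral mu r (pow (B_ n)) x < +oo)%E}.
Proof.
have [mr r0 _ _] := cr.
have mpow l n : measurable (pow (B_ n) : set (l.-tuple T)).
  by apply: measurable_pow; exact: exhaustion_measurable.
have mpi n := (partial_integralP mu mr r0 (mpow _ n)).1.
have pi0 n x : (0 <= partial_integral mu r (pow (B_ n)) x)%E.
  by apply: integral_ge0 => y _; rewrite lee_fin.
have h n p : {ae pm m.+1, forall x, pow (B_ p) x ->
    (partial_integral mu r (pow (B_ n)) x < +oo)%E}.
  have mf : measurable_fun setT (partial_integral mu r (pow (B_ n)) \_ (pow (B_ p))).
    by apply/(measurable_restrictT _ (mpow _ p)); exact: measurable_funTS.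
  have f0 x : (0 <= (partial_integral mu r (pow (B_ n)) \_ (pow (B_ p))) x)%E.
    by rewrite patchE; case: ifP.
  have If : (\int[pm m.+1]_x (partial_integral mu r (pow (B_ n)) \_ (pow (B_ p))) x < +oo)%E.
    by rewrite -integral_mkcond; exact: (partial_integral_lty cr (n := n) (p := p)).
  by apply: ae_imp (integral_lty_ae mf f0 If) => x + Bx; rewrite patchE mem_set.
apply: ae_imp (ae_foralln (fun n => ae_foralln (h n))) => x hx n.
have /choice[F hF] : forall i : 'I_m.+1, exists n, B_ n (tnth x i).
  by move=> i; exact: exhaustion_cover.
apply: (hx n (\max_i F i)%N) => i; apply: exhaustion_mono (hF i).
exact: leq_bigmax.
Qed.

Lemma partial_integral_diagonal : {ae pm m.+1, forall x : m.+1.-tuple T,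
  partial_integral mu r [set y : k.+1.-tuple T | ~~ uniq (y ++ x)] x = 0%E}.
Proof.
have [V [mV _ genV sepV]] := borel_countable_basis hE.
have [mr r0 _ _] := cr.
pose D := [set q : (k.+1 + m.+1).-tuple T | ~~ uniq q].
have mD : measurable D.
  rewrite (_ : D = ~` [set q | uniq (q ++ ([tuple] : 0.-tuple T))]).
    by apply: measurableC; exact: measurable_uniq.
  by apply/seteqP; split=> q /=; rewrite cats0 => /negP.
have mf : measurable_fun setT ((EFin \o r) \_ D : _ -> \bar R).
  by apply/(measurable_restrictT _ mD); apply: measurable_funTS; exact/measurable_EFinP.
have f0 q : (0 <= ((EFin \o r) \_ D) q)%E by rewrite patchE; case: ifP => // _; rewrite lee_fin.
have If : (\int[pm (k.+1 + m.+1)%N]_q ((EFin \o r) \_ D) q = 0)%E.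
  by rewrite -integral_mkcond; exact: (correlation_diagonal hE (k := k + m.+1) sP cr).
apply: ae_imp (section_eq0 mf f0 If) => x Ix.
by rewrite -[RHS]Ix /partial_integral [LHS]integral_mkcond.
Qed.

Variables (lambda : {measure set (m.+1.-tuple T) -> \bar R}) (rho : m.+1.-tuple T -> R).
Hypothesis mrho : measurable_fun setT rho.
Hypothesis rho0 : forall x, 0 <= rho x.
Hypothesis lambdaE : forall A, measurable A ->
  lambda A = (\int[pm m.+1]_(x in A) (rho x)%:E)%E.
Variable Palm : m.+1.-tuple T -> point_process E.
Hypothesis hPalm : palm_measures P lambda Palm.

Lemma palm_correlation_ae : {ae lambda, forall x, 0 < rho x /\
  correlation_function mu (Palm x) (fun y : k.+1.-tuple T => r (cat_tuple y x) / rho x)}.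
Proof.
have [V [mV _ genV sepV]] := borel_countable_basis hE.
have [mr r0 _ _] := cr.
have cells : {ae pm m.+1, forall x : m.+1.-tuple T, forall N n (w : k.+1.-tuple (N.-tuple bool)),
    uniq (w ++ codes V N x) ->
    partial_integral mu r (level V w `&` pow (B_ n)) x =
    ((\int[Palm x]_X (cells_palm V n w (x, X))%:E) * (rho x)%:E)%E}.
  (* Depth and radius range over the integers and [w] over a finite type, so one null set serves for
     all cells. *)
  apply: ae_foralln => N; apply: ae_foralln => n; apply: filter_forall => w.
  exact: (palm_cells hE sP mrho rho0 lambdaE hPalm cr mV n w).
have toL := density_ae mrho lambdaE.
have h := ae_and (ae_and (density_ae_gt0 mrho rho0 lambdaE) (palm_simple hE sP hPalm))
  (ae_and (toL _ partial_integral_lty_ae)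
    (ae_and (toL _ partial_integral_diagonal) (toL _ cells))).
apply: ae_imp h => x [[rx sx] [fx [dx cx]]]; split=> //.
exact: (palm_correlation hE sx rx mr r0 fx dx mV genV sepV cx).
Qed.

End Sections.
End AlmostEveryPoint.

Theorem corollary1p2 (R : realType) (E : pmetricType R)
    (mu : {sigma_finite_measure set (borel E) -> \bar R})
    (K : E -> E -> quat R[i]) (PK : point_process E)
    (hE : proper_space E) (hmu : radon mu) (hPK : pfaffian_process mu PK K)
    (m : nat) (lambda : {measure set (m.+1.-tuple (borel E)) -> \bar R})
    (hlambda : correlation_measure mu PK lambda)
    (Palm : m.+1.-tuple (borel E) -> point_process E)
    (hPalm : palm_measures PK lambda Palm) :
  {ae lambda, forall x : m.+1.-tuple (borel E),
    (exists2 r : R, 0 < r & Qdet (kernel_mx K x x) = (real_complex R r)%:A) /\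
    pfaffian_process mu (Palm x) (palm_kernel K x)}.
Proof.
have sP := pfaffian_simple hE hPK.
have [saK hK] := hPK.
have [rho crho lambdaE] := hlambda.
have [mrho rho0 _ _] := crho.
have two : 2%:R != 0 :> R[i] by rewrite pnatr_eq0.
have toL := density_ae mrho lambdaE.
have [rho' crho' Qrho'] := hK m.
have det := toL _ (ae_and Qrho' (correlation_unique hE sP crho' crho)).
have palm k : {ae lambda, forall x, 0 < rho x /\
    exists r : (k.+1 + m.+1).-tuple (borel E) -> R,
      correlation_function mu (Palm x) (fun y : k.+1.-tuple _ => r (cat_tuple y x) / rho x) /\
      {ae power_measure mu k.+1, forall y : k.+1.-tuple (borel E),
        Qdet (kernel_mx K (cat_tuple y x) (cat_tuple y x)) =
        (real_complex R (r (cat_tuple y x)))%:A}}.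
  (* Orders are counted from 1 in [pfaffian_process]: this index gives tuples of length k+1+m+1,
     that is, the pairs of [y] and [x]. *)
  have [r cr Qr] := hK (k + m.+1)%N.
  have h1 := palm_correlation_ae hE sP (k := k) (r := r) cr mrho rho0 lambdaE hPalm.
  have h2 := toL _ (section_ae (k := k.+1) (m := m.+1) Qr).
  by apply: ae_imp (ae_and h1 h2) => x [[rx cx] qx]; split=> //; exists r.
apply: ae_imp (ae_and det (ae_foralln palm)) => x [[detx rhox] px].
have [rx _] := px 0%N; rewrite rhox in detx.
split; first by exists (rho x).
split; first exact: palm_kernel_selfadj.
move=> k; have [_ [r [cr Qr]]] := px k; exists (fun y => r (cat_tuple y x) / rho x) => //.
apply: ae_imp Qr => y Qy; rewrite (palm_kernel_qdet two y saK detx); last first.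
  by rewrite -(rmorph0 (real_complex R)) (inj_eq (@complexI R)) gt_eqF.
by rewrite Qy scalerA rmorphM fmorphV mulrC.
Qed.
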